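(* Let $p$ be an odd prime, $\varepsilon>0$, and let $A, B\subseteq \mathbb{F}_p$ with $|B| \ge p^\varepsilon$ and $|A+B| \le K |A|$ for some $K\ge 1$. Then there is $k=k(\varepsilon)$ such that for any $\lambda \neq 0$ one has $$\left| \left\{ (a_1,a_2)\in A\times A ~:~ \frac{1}{a_1} - \frac{1}{a_2} = \lambda \right\} \right| \le \frac{K^2 |A|^2}{p} + 2 K |A| p^{-1/2^{k+2}}.$$ Also, $$\mathsf{T}_2^{+} (1/A, 1/B) - \frac{K^2 |A|^2 |B|^2}{p} \ll K^{5/4} |A|^{5/4} |B|^{3/2} + K^2 |A|^2.$$
   Context: $A+B=\{a+b: a\in A,b\in B\}$. For $X\subseteq\mathbb{F}_p$, $1/X=\{1/x: x\in X, x\neq 0\}$. For sets $X,Y\subseteq\mathbb{F}_p$, $\mathsf{T}_2^{+}(X,Y)$ (the common additive energy) is the number of quadruples $(x_1,x_2,y_1,y_2)\in X\times X\times Y\times Y$ with $x_1+y_1=x_2+y_2$. The symbol $\ll$ denotes inequality up to an absolute constant factor. *)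

(* Defs.v *)
From mathcomp Require Import all_boot all_order all_algebra.
From mathcomp Require Import reals exp.

Set Implicit Arguments.
Unset Strict Implicit.
Unset Printing Implicit Defensive.

Import Order.TTheory GRing.Theory Num.Theory.
Local Open Scope ring_scope.

Definition sumset (p : nat) (X Y : {set 'F_p}) : {set 'F_p} :=
  [set x + y | x in X, y in Y].

(* The filter is needed: 0^-1 = 0 in MathComp. *)
Definition invset (p : nat) (X : {set 'F_p}) : {set 'F_p} :=
  [set x^-1 | x in X & x != 0].

(* The quadruple is ((x1, x2), (y1, y2)). *)
Definition T2plus (p : nat) (X Y : {set 'F_p}) : nat :=
  #|[set q : ('F_p * 'F_p) * ('F_p * 'F_p) |
      [&& q.1.1 \in X, q.1.2 \in X, q.2.1 \in Y, q.2.2 \in Y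
        & q.1.1 + q.2.1 == q.1.2 + q.2.2]]|.

(* Here too a1, a2 != 0 is required for 1/a1 and 1/a2 to make sense. *)
Definition inv_diff_pairs (p : nat) (A : {set 'F_p}) (lambda : 'F_p) :
    {set 'F_p * 'F_p} :=
  [set a : 'F_p * 'F_p |
    [&& a.1 \in A, a.2 \in A, a.1 != 0, a.2 != 0
      & a.1^-1 - a.2^-1 == lambda]].

(* Main.v *)
(* Both bounds rest on Rudnev's incidence theorem. Points are encoded as null lines
   (s, w1, w2) in 3-space, two of which meet exactly when they are incident. A surface
   of low degree through a sample of the lines contains all those with many neighbours;
   on an irreducible surface, a differential equation along a line forces its neighbours
   to be collinear points, which the hypothesis bounds.

   Second bound: apart from trivial solutions, T_2^+(1/A, 1/B) counts incidences between
   the Cartesian square of 1/(A + B) and at most |B|^2 lines. A second moment over all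
   lines settles large A + B, and Rudnev's theorem the rest.

   First bound: for every b1, b2 in B the solutions inject into the pairs of elements of
   A + B related by a fixed element of SL2(F_p). Hence it suffices to bound the norm of
   the average of these |B|^2 elements on mean-zero functions on the projective line. If
   the norm exceeds p^(-delta), let f be an almost extremal function and rho(g) its
   correlation with its translate by g. As rho is positive definite and almost harmonic,
   and square-summable with sum O(p^2), pigeonholing its level sets and applying
   Balog-Szemeredi-Gowers produces an approximate group H of size at most p^(2 + o(1))
   with many elements in two different unipotent subgroups. Rudnev's theorem shows that
   such an H has size at least p^(3 - o(1)). *)

Require Import Defs.
From HB Require Import structures.
From mathcomp Require Import all_boot all_order all_fingroup all_algebra.
From mathcomp Require Import reals exp.
From mathcomp Require Import ring lra zify.
From Stdlib Require Import Classical_Prop.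

Set Implicit Arguments.
Unset Strict Implicit.
Unset Printing Implicit Defensive.

Import Order.TTheory GRing.Theory Num.Theory.
Local Open Scope ring_scope.

(** * Rudnev's point-plane theorem *)

(** Over ['F_p] three null lines may pass through one point, and two may have the same projection;
    then neither counting zeros along a line nor elimination bounds anything. Every point is
    therefore taken in two colours, and the two families of lines are moved by a transcendental of
    the field of fractions of [{poly 'F_p}], so that incidences survive exactly between the colours.
    The characteristic is still p, and derivatives control only polynomials of degree below p. This
    limits the point set to p^2 elements.

    In the group part every loss is a power of one number q, itself a small power of p, so exponents
    such as 42 or 69 are harmless and none is optimised. The only expensive choice is that of the
    thresholds of the level sets: each is about the square of the one before, and as many of them as
    are needed to exceed the order of the group by powers of q must stay below q. The saving is thus
    a power of p whose exponent is exponentially small in the number of thresholds, which is the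
    origin of 1/2^(k+2). *)

Definition dvdr (R : idomainType) (p a : R) : Prop := exists c, a = c * p.

Definition prime_elt (R : idomainType) (p : R) : Prop :=
  [/\ p != 0, p \isn't a GRing.unit
    & forall a b, dvdr p (a * b) -> dvdr p a \/ dvdr p b].

(** Prime rather than irreducible factors are asked for: uniqueness is then automatic, and only
    existence has to pass to polynomial rings. *)
Definition factorial_ring (R : idomainType) : Prop :=
  forall r : R, r != 0 ->
  exists (u : R) (ps : seq R),
    [/\ u \is a GRing.unit, forall p, p \in ps -> prime_elt p
      & r = u * \prod_(p <- ps) p].

Lemma dvdr_polyC (R : idomainType) (p : R) (f : {poly R}) :
  dvdr p%:P f <-> forall i, dvdr p f`_i.
Proof.
split=> [[g ->] i|]; first by exists g`_i; rewrite coefMC.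
elim/poly_ind: f => [|f c IH] H; first by exists 0; rewrite mul0r.
have [i|g Eg] := IH.
  by have := H i.+1; rewrite coefD coefMX coefC /= addr0.
have [d Ed] := H 0%N; rewrite coefD coefMX coefC /= add0r in Ed.
by exists (g * 'X + d%:P); rewrite Eg Ed polyCM; ring.
Qed.

(** Gauss's lemma without the quotient ring. Both factors are peeled from the constant term: if [p]
    does not divide that of the left factor, it divides that of the right one, and removing this
    multiple of [p] leaves a shifted product. *)
Lemma prime_polyC (R : idomainType) (p : R) :
  prime_elt p -> prime_elt p%:P.
Proof.
move=> [p0 pu pP]; split; first by rewrite polyC_eq0.
  by rewrite poly_unitE size_polyC p0 coefC.
have shift f : dvdr p%:P (f * 'X) -> dvdr p%:P f.
  move/dvdr_polyC=> H; apply/dvdr_polyC=> i.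
  by have := H i.+1; rewrite coefMX.
have dvdB (a b : {poly R}) : dvdr p%:P a -> dvdr p%:P (a + b) -> dvdr p%:P b.
  move=> [c ->] [d Ed]; exists (d - c).
  by rewrite mulrBl -Ed; ring.
elim/poly_ind => [|f c IH] g; first by left; exists 0; rewrite mul0r.
case: (classic (dvdr p c)) => [[d Ed]|Nc] H.
  have /IH[[e Ee]|] : dvdr p%:P (f * g).
  - apply: shift; apply: (dvdB (c%:P * g)).
      by exists (d%:P * g); rewrite Ed polyCM; ring.
    by move: H; congr dvdr; ring.
  - by left; exists (e * 'X + d%:P); rewrite Ee Ed polyCM; ring.
  - by right.
right; elim/poly_ind: g H => [|g d IHg] H; first by exists 0; rewrite mul0r.
have [//|[d' Ed']] : dvdr p c \/ dvdr p d.
  apply: pP; move/dvdr_polyC: H => /(_ 0%N).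
  by rewrite coef0M !coefD !coefMX !coefC /= !add0r.
have /IHg[e Ee] : dvdr p%:P ((f * 'X + c%:P) * g).
  apply: shift; apply: (dvdB ((f * 'X + c%:P) * d%:P)).
    by exists ((f * 'X + c%:P) * d'%:P); rewrite Ed' polyCM; ring.
  by move: H; congr dvdr; ring.
by exists (e * 'X + d'%:P); rewrite Ee Ed' polyCM; ring.
Qed.

(** The primes of [c] stay prime as polynomials, so each of them can be charged to [g] or to [h].
    This turns pseudo-division, valid up to a constant, into true divisibility. *)
Lemma factorial_cancel_const (R : idomainType) (c : R) (f g h : {poly R}) :
  factorial_ring R -> c != 0 -> c%:P * f = g * h ->
  exists (a b : R) (g' h' : {poly R}),
    [/\ a != 0, b != 0, g = a%:P * g', h = b%:P * h' & f = g' * h'].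
Proof.
move=> facR /facR[u [ps [uu]]].
elim: ps c f g h => [|p ps IH] c f g h Hps ->.
  rewrite big_nil mulr1 => E.
  exists u, 1, (u^-1%:P * g), h; split; rewrite ?oner_neq0 ?mul1r //.
  - by apply: contraTneq uu => ->; rewrite unitr0.
  - by rewrite mulrA -polyCM divrr // mul1r.
  - by rewrite -mulrA -E mulrA -polyCM mulVr // mul1r.
rewrite big_cons => E.
have pp : prime_elt p by apply: Hps; rewrite mem_head.
have p0 : p != 0 by case: pp.
have p0' : p%:P != 0 by rewrite polyC_eq0.
have Hps' q : q \in ps -> prime_elt q by move=> qs; apply: Hps; rewrite in_cons qs orbT.
have [_ _ pP] := prime_polyC pp.
have [|[g1 Eg]|[h1 Eh]] := pP g h.
- exists ((u * \prod_(q <- ps) q)%:P * f); rewrite -E !polyCM; ring.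
- have [|a [b [g' [h' [a0 b0 Eg1 Eh ->]]]]] := IH _ f g1 h Hps' erefl.
    apply: (mulfI p0'); rewrite !polyCM.
    by transitivity (g * h); [rewrite -E !polyCM; ring | rewrite Eg; ring].
  exists (a * p), b, g', h'; split; rewrite ?mulf_neq0 //.
  by rewrite Eg Eg1 polyCM; ring.
- have [|a [b [g' [h' [a0 b0 Eg Eh1 ->]]]]] := IH _ f g h1 Hps' erefl.
    apply: (mulfI p0'); rewrite !polyCM.
    by transitivity (g * h); [rewrite -E !polyCM; ring | rewrite Eh; ring].
  exists a, (b * p), g', h'; split; rewrite ?mulf_neq0 //.
  by rewrite Eh Eh1 polyCM; ring.
Qed.

Lemma prime_dvd_prod (R : idomainType) (q u : R) (ps : seq R) :
  prime_elt q -> u \is a GRing.unit -> dvdr q (u * \prod_(p <- ps) p) ->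
  exists2 p, p \in ps & dvdr q p.
Proof.
move=> [q0 qu qP] uu; elim: ps => [|p ps IH].
  rewrite big_nil mulr1 => -[c Ec]; case/negP: qu.
  by move: uu; rewrite Ec unitrM => /andP[].
rewrite big_cons mulrCA => /qP[H|/IH[r rs H]].
  by exists p => //; rewrite mem_head.
by exists r => //; rewrite in_cons rs orbT.
Qed.

Lemma prime_dvd_assoc (R : idomainType) (p q c : R) :
  prime_elt p -> q \isn't a GRing.unit -> p = c * q -> c \is a GRing.unit.
Proof.
move=> [p0 _ pP] qu E; have [||] := pP c q.
- by exists 1; rewrite mul1r.
- move=> [d Ed]; case/negP: qu; apply/unitrP; exists d.
  have : (d * q) * p = 1 * p.
    by rewrite mul1r; transitivity (d * p * q); [ring | rewrite -Ed -E].
  by move/(mulIf p0) => E1; split; rewrite // mulrC.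
- move=> [d Ed]; apply/unitrP; exists d.
  have : (d * c) * p = 1 * p.
    by rewrite mul1r; transitivity (c * (d * p)); [ring | rewrite -Ed -E].
  by move/(mulIf p0) => E1; split; rewrite // mulrC.
Qed.

Definition primitive_elt (R : idomainType) (f : {poly R}) : Prop :=
  forall q, prime_elt q -> ~ dvdr q%:P f.

(** A prime constant dividing [f] divides its leading coefficient, so the number of primes in the
    latter bounds how often one can be removed. *)
Lemma factorial_primitive_part (R : idomainType) (f : {poly R}) :
  factorial_ring R -> f != 0 ->
  exists (c : R) (g : {poly R}), [/\ c != 0, f = c%:P * g & primitive_elt g].
Proof.
move=> facR f0; have [u [ps [uu Hps]]] : exists (u : R) (ps : seq R),
    [/\ u \is a GRing.unit, forall p, p \in ps -> prime_elt p
      & lead_coef f = u * \prod_(p <- ps) p] by apply: facR; rewrite lead_coef_eq0.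
have [n] := ubnP (size ps); elim: n => // n IH in u uu ps Hps f f0 *.
rewrite ltnS => sz E.
case: (classic (exists2 q, prime_elt q & dvdr q%:P f)); last first.
  move=> N; exists 1, f; split; rewrite ?oner_neq0 ?mul1r //.
  by move=> q qp qd; apply: N; exists q.
move=> [q qp [g Eg]].
have Eq : lead_coef f = lead_coef g * q by rewrite Eg lead_coefM lead_coefC.
have [|p ps_p [w Ew]] := @prime_dvd_prod _ q u ps qp uu.
  by exists (lead_coef g); rewrite -E.
have [q0 qu _] := qp.
have wu := prime_dvd_assoc (Hps p ps_p) qu Ew.
have g0 : g != 0 by apply: contraNneq f0 => g0; rewrite Eg g0 mul0r.
have [||||c [h [c0 Eh hp]]] := IH (u * w) _ (rem p ps) _ g g0.
- by rewrite unitrM uu.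
- by move=> r /mem_rem; apply: Hps.
- by rewrite size_rem //; case: (ps) ps_p sz.
- apply: (mulIf q0); rewrite -Eq E (perm_big _ (perm_to_rem ps_p)) big_cons /= Ew.
  by ring.
exists (c * q), h; split=> //; first by rewrite mulf_neq0.
by rewrite Eg Eh polyCM; ring.
Qed.

(** [dvdp] is divisibility up to a constant. When that constant is cancelled, the share [b] taken
    out of [f] has no prime factor, because [f] is primitive, and so is a unit. *)
Lemma primitive_dvdp (R : idomainType) (f g : {poly R}) :
  factorial_ring R -> f != 0 -> primitive_elt f -> dvdp f g -> dvdr f g.
Proof.
move=> facR f0 pf; rewrite (@Pdiv.Idomain.dvdp_eq R) => /eqP; rewrite -mul_polyC => E.
have [|a [b [g' [h' [a0 b0 Eg Ef ->]]]]] := factorial_cancel_const facR _ E.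
  by rewrite expf_neq0 // lead_coef_eq0.
have [u [ps [uu Hps Eb]]] := facR b b0.
case: ps => [|p ps] in Hps Eb.
  exists (u^-1%:P * g'); rewrite Ef Eb big_nil mulr1.
  transitivity ((u^-1%:P * u%:P) * (g' * h')); last by ring.
  by rewrite -polyCM mulVr // mul1r.
case: (pf p); first by apply: Hps; rewrite mem_head.
exists ((u * \prod_(j <- ps) j)%:P * h'); rewrite Ef Eb big_cons !polyCM; ring.
Qed.

(** Induction on the degree. If [f] does not split into factors of smaller degree, its primitive
    part [f1] is prime: the gcd of [f1] and [g] is either constant, and [f1] divides the other
    factor, or of full degree, and [f1] divides [g]. *)
Theorem factorial_poly (R : idomainType) :
  factorial_ring R -> factorial_ring {poly R}.
Proof.
move=> facR f; have [n] := ubnP (size f); elim: n f => // n IH f.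
rewrite ltnS => szf f0.
have [sz1|sz1] := leqP (size f) 1.
  have Ef := size1_polyC sz1.
  have [|u [ps [uu Hps E]]] := facR f`_0.
    by apply: contraNneq f0 => H; rewrite Ef H.
  exists u%:P, (map polyC ps); split.
  - by rewrite rmorph_unit.
  - by move=> p /mapP[q qs ->]; apply: prime_polyC; apply: Hps.
  - by rewrite Ef E polyCM rmorph_prod big_map.
case: (classic (exists g h : {poly R},
    [/\ f = g * h, (size g < size f)%N & (size h < size f)%N])).
  move=> [g [h [E szg szh]]].
  have /andP[g0 h0] : (g != 0) && (h != 0) by move: f0; rewrite E mulf_eq0 negb_or.
  have [u [ps [uu Hps Eg]]] := IH g (leq_trans szg szf) g0.
  have [v [qs [vv Hqs Eh]]] := IH h (leq_trans szh szf) h0.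
  exists (u * v), (ps ++ qs); split.
  - by rewrite unitrM uu.
  - by move=> p; rewrite mem_cat => /orP[/Hps|/Hqs].
  - by rewrite big_cat /= E Eg Eh; ring.
move=> nosplit.
have [c [f1 [c0 Ef pf]]] := factorial_primitive_part facR f0.
have szf1 : size f1 = size f by rewrite Ef size_Cmul.
have f10 : f1 != 0 by rewrite -size_poly_gt0 szf1 (leq_trans _ sz1).
have f1prime : prime_elt f1.
  split=> //; first by rewrite poly_unitE szf1 (gtn_eqF sz1).
  move=> g h [k Ek].
  have dgh : dvdp f1 (g * h) by rewrite Ek dvdp_mull.
  case: (boolP (coprimep f1 g)) => [co|].
    by right; apply: primitive_dvdp => //; rewrite Gauss_dvdpr in dgh.
  rewrite /coprimep => nco; left; apply: primitive_dvdp => //.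
  have := dvdp_gcdl f1 g; rewrite (@Pdiv.Idomain.dvdp_eq R) => /eqP.
  rewrite -mul_polyC => E.
  have [|a [b [q' [d' [a0 b0 Eq Ed Ef1]]]]] := factorial_cancel_const facR _ E.
    by rewrite expf_neq0 // lead_coef_eq0 gcdp_eq0 (negPf f10).
  have szd : size (gcdp f1 g) = size d' by rewrite Ed size_Cmul.
  have [q0 d0] : q' != 0 /\ d' != 0.
    by move: f10; rewrite Ef1 mulf_eq0 negb_or => /andP.
  have sE : (size f = (size q' + size d').-1)%N by rewrite -szf1 Ef1 size_mul.
  have sq : size q' = 1%N.
    apply/eqP; apply: contra_notT nosplit => sq; exists (c%:P * q'), d'.
    move: q0 d0 nco; rewrite -!size_poly_gt0 szd => ? ? ?.
    by split; [rewrite Ef Ef1; ring | rewrite size_Cmul // | ]; lia.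
  have e : eqp (gcdp f1 g) f1.
    rewrite -(dvdp_size_eqp (dvdp_gcdl _ _)) szf1 sE sq szd; apply/eqP; lia.
  by rewrite -(eqp_dvdl _ e) dvdp_gcdr.
have [u [ps [uu Hps E]]] := facR c c0.
exists u%:P, (f1 :: map polyC ps); split.
- by rewrite rmorph_unit.
- move=> p; rewrite in_cons => /predU1P[-> //|/mapP[q qs ->]].
  by apply: prime_polyC; apply: Hps.
- by rewrite Ef E big_cons big_map polyCM rmorph_prod; ring.
Qed.

Lemma factorial_field (K : fieldType) : factorial_ring K.
Proof.
move=> r r0; exists r, [::]; split=> //; first by rewrite unitfE.
by rewrite big_nil mulr1.
Qed.

Lemma factorial_split (R : idomainType) (F : R) :
  factorial_ring R -> F != 0 -> F \isn't a GRing.unit ->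
  prime_elt F \/ exists G H, [/\ F = G * H, G \isn't a GRing.unit
    & H \isn't a GRing.unit].
Proof.
move=> facR /facR[u [ps [uu Hps ->]]] Fu.
case: ps => [|p ps] in Hps Fu *; first by rewrite big_nil mulr1 uu in Fu.
have [p0 pu pP] := Hps p (mem_head _ _).
case: ps => [|q ps] in Hps Fu *.
  left; rewrite big_seq1; split.
  - by rewrite mulf_neq0 //; apply: contraTneq uu => ->; rewrite unitr0.
  - by rewrite unitrM (negPf pu) andbF.
  - have H a : dvdr p a -> dvdr (u * p) a.
      by move=> [c ->]; exists (c * u^-1); rewrite mulrA mulrVK.
    move=> a b [c E]; have [|/H|/H] := pP a b; [|by left|by right].
    by exists (c * u); rewrite E; ring.
right; exists (u * p), (\prod_(r <- q :: ps) r); split.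
- by rewrite big_cons; ring.
- by rewrite unitrM (negPf pu) andbF.
- have [q0 qu _] : prime_elt q by apply: Hps; rewrite !inE eqxx orbT.
  by rewrite big_cons unitrM (negPf qu).
Qed.

Lemma size_det_leq (R : comNzRingType) (n e : nat) (M : 'M[{poly R}]_n) :
  (forall i j, (size (M i j) <= e.+1)%N) -> (size (\det M) <= (n * e).+1)%N.
Proof.
move=> HM; apply: leq_trans (size_sum _ _ _) _; apply/bigmax_leqP => s _.
apply: leq_trans (size_polyMleq _ _) _.
have -> : (size ((-1) ^+ s : {poly R}) = 1)%N.
  by rewrite -signr_odd; case: (odd s); rewrite ?size_polyN ?expr1 ?expr0 ?size_polyN size_poly1.
rewrite add1n /=; apply: leq_trans (size_poly_prod_leq _ _) _.
have : (\sum_(i < n) size (M i (s i)) <= \sum_(i < n) e.+1)%N by apply: leq_sum.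
rewrite sum_nat_const !card_ord mulnS => H; rewrite leq_subLR addnS ltnS; exact: H.
Qed.

(** * Elimination: lines common to two surfaces *)

Section Lines.

Variable K : fieldType.
Local Notation T2 := {poly {poly K}}.
Local Notation T3 := {poly {poly {poly K}}}.

(* Polynomials in x, y, z are nested with x outermost; [restr al be] substitutes
   y := al(z) and x := be(z). *)
Definition restr (al be : {poly K}) : T3 -> {poly K} :=
  horner_eval be \o map_poly (horner_eval al).

HB.instance Definition _ al be := GRing.RMorphism.on (restr al be).

Lemma restr_polyC al be (c : T2) : restr al be c%:P = c.[al].
Proof. by rewrite /restr /= map_polyC /horner_eval /= hornerC. Qed.

(** [r] is the resultant in x, a determinant of order at most 2e. If it were zero, F and G would
    share a divisor of positive x-degree; F, being prime, would divide it, hence a constant multiple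
    of G, hence G. The two early cases are those of a polynomial free of x. *)
Lemma coprime_elimination (F G : T3) (e : nat) :
  prime_elt F -> ~ dvdr F G ->
  (size F <= e.+1)%N -> (size G <= e.+1)%N ->
  (sizeY F <= e.+1)%N -> (sizeY G <= e.+1)%N ->
  exists (r : T2) (u v : T3),
    [/\ r != 0, r%:P = u * F + v * G & (size r <= (2 * e * e).+1)%N].
Proof.
move=> [F0 Fu FP] FG sF sG yF yG.
have G0 : G != 0.
  by apply: contra_notN FG => /eqP ->; exists 0; rewrite mul0r.
have ele : (e.+1 <= (2 * e * e).+1)%N by case: (e) => // e'; nia.
have coefE (H : T3) : (sizeY H <= e.+1)%N -> (size (H`_0)%R <= (2 * e * e).+1)%N.
  by move=> yH; apply: leq_trans (max_size_coefXY _ _) (leq_trans yH ele).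
(* Stated for abstract rings: unifying 0 with 1 in nested polynomials is slow. *)
have L (S : nzRingType) (a b : S) : a = 1 * a + 0 * b by rewrite mul1r mul0r addr0.
have R (S : nzRingType) (a b : S) : b = 0 * a + 1 * b by rewrite mul1r mul0r add0r.
have aux (a b : nat) : (1 < b -> 0 < a -> true = (a + b).-1 :> nat -> False)%N by lia.
have [s1|sF1] := leqP (size F) 1.
  have EF := size1_polyC s1.
  exists F`_0, 1, 0; split; last exact: coefE.
  - by apply: contraNneq F0 => H; rewrite EF H.
  - by transitivity F; [exact: (esym EF) | exact: L].
have [s1|sG1] := leqP (size G) 1.
  have EG := size1_polyC s1.
  exists G`_0, 0, 1; split; last exact: coefE.
  - by apply: contraNneq G0 => H; rewrite EG H.
  - by transitivity G; [exact: (esym EG) | exact: R].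
exists (resultant F G).
have [[u v] _ /= Er] := resultant_in_ideal sF1 sG1.
exists u, v; split=> //; last first.
  apply: leq_trans (size_det_leq (e := e) _) _.
    move=> i j; rewrite Sylvester_mxE; case: split => k;
    case: (k <= j)%N; rewrite ?mulr0n ?size_poly0 // mulr1n;
    by apply: leq_trans (max_size_coefXY _ _) _.
  rewrite ltnS leq_mul2r; apply/orP; right; move: sF sG.
  by move: (size F) (size G) => a b; clear; lia.
rewrite resultant_eq0 -leqNgt leqNgt; apply/negP => sD.
set D := gcdp F G in sD.
have := dvdp_gcdl F G; rewrite (@Pdiv.Idomain.dvdp_eq T2) -mul_polyC -/D.
set c := _ ^+ _; set E := _ %/ _ => /eqP Ec.
have D0 : D != 0 by rewrite -size_poly_gt0 ltnW.
have c0 : c != 0 by rewrite expf_neq0 // lead_coef_eq0.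
have E0 : E != 0.
  apply: contraNneq F0 => E0; move/eqP: Ec; rewrite E0 mul0r mulf_eq0 polyC_eq0.
  by rewrite (negPf c0).
have [|[E' EE]|[D' ED]] := FP E D; first by exists c%:P; rewrite Ec.
  have cE : c%:P = E' * D :> T3 by apply: (mulIf F0); rewrite Ec EE; ring.
  have : size (c%:P : T3) = size (E' * D) by rewrite cE.
  have E'0 : E' != 0 by apply: contraNneq E0 => H; rewrite EE H mul0r.
  rewrite size_polyC c0 size_mul //; move: E'0 sD; rewrite -size_poly_gt0.
  by move: (size E') (size D) => a b; clear; lia.
have := dvdp_gcdr F G; rewrite (@Pdiv.Idomain.dvdp_eq T2) -mul_polyC -/D.
set c' := _ ^+ _; set E2 := _ %/ _ => /eqP Ec'.
have c'0 : c' != 0 by rewrite expf_neq0 // lead_coef_eq0.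
have [||//] := FP c'%:P G; first by exists (E2 * D'); rewrite Ec' ED; ring.
case=> w Ew.
have w0 : w != 0.
  by apply: contraNneq c'0 => w0; move/eqP: Ew; rewrite w0 mul0r polyC_eq0.
have : size (c'%:P : T3) = size (w * F) by rewrite Ew.
rewrite size_polyC c'0 size_mul //; move: w0; rewrite -size_poly_gt0.
by move=> w0 H; apply: (aux _ _ sF1 w0 H).
Qed.

(** A common line gives the root y = [al i], a polynomial in z, of the resultant. Lines are counted
    separately only because their projections [al i] to the (y, z)-plane differ. *)
Lemma common_lines (F G : T3) (e : nat) (I : finType) (X : {set I})
    (al be : I -> {poly K}) :
  prime_elt F -> ~ dvdr F G ->
  (size F <= e.+1)%N -> (size G <= e.+1)%N ->
  (sizeY F <= e.+1)%N -> (sizeY G <= e.+1)%N ->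
  {in X &, injective al} ->
  (forall i, i \in X -> restr (al i) (be i) F = 0 /\ restr (al i) (be i) G = 0) ->
  (#|X| <= 2 * e * e)%N.
Proof.
move=> Fp FG sF sG yF yG inj H.
have [r [u [v [r0 Er sr]]]] := coprime_elimination Fp FG sF sG yF yG.
rewrite -ltnS (leq_trans _ sr) //.
have -> : #|X| = size [seq al i | i <- enum X] by rewrite size_map cardE.
apply: max_poly_roots => //.
  apply/allP => x /mapP[i]; rewrite mem_enum => iX ->{x}.
  have [HF HG] := H i iX.
  rewrite /root -(restr_polyC _ (be i)) Er rmorphD !rmorphM /= HF HG.
  by rewrite !mulr0 addr0.
rewrite map_inj_in_uniq ?enum_uniq // => i j.
by rewrite !mem_enum; apply: inj.
Qed.

End Lines.

Definition derivation (R : comNzRingType) (f : {additive R -> R}) : Prop :=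
  forall a b, f (a * b) = f a * b + a * f b.

Lemma map_derivation (R : comNzRingType) (f : {additive R -> R}) :
  derivation f ->
  forall a b, map_poly f (a * b) = map_poly f a * b + a * map_poly f b.
Proof.
move=> fM a b; apply/polyP=> i.
rewrite coef_map coefD !coefM raddf_sum -big_split /=.
by apply: eq_bigr => j _; rewrite fM !coef_map.
Qed.

Lemma derivation_horner (R : comNzRingType) (f : {additive R -> R}) :
  derivation f -> f 1 = 0 -> forall (p : {poly R}) (a : R),
  f p.[a] = f a * p^`().[a] + (map_poly f p).[a].
Proof.
move=> fM f1 p a; elim/poly_ind: p => [|p c IH].
  by rewrite derivC map_poly0 !horner0 mulr0 raddf0 addr0.
rewrite hornerMXaddC raddfD /= fM IH.
have -> : map_poly f (p * ('X) + c%:P) = map_poly f (p * 'X) + map_poly f c%:P by rewrite raddfD.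
rewrite map_polyC /=.
have dX : map_poly f 'X = 0.
  apply/polyP=> i; rewrite coef_map coefX coef0 /=.
  by case: (i == 1%N); rewrite ?f1 ?raddf0.
rewrite map_derivation // dX mulr0 addr0 derivMXaddC !hornerE /=; ring.
Qed.

Lemma deriv_derivation (R : comNzRingType) : derivation (@deriv R).
Proof. by move=> a b; exact: derivM. Qed.

Lemma deriv_map_additive (R S : nzRingType) (f : {additive R -> S}) (p : {poly R}) :
  (map_poly f p)^`() = map_poly f p^`().
Proof. by apply/polyP => i; rewrite !(coef_map, coef_deriv) //= raddfMn. Qed.

(** * Partial derivatives and degrees in x, y, z *)

Section Jets.

Variable K : fieldType.
Local Notation T2 := {poly {poly K}}.
Local Notation T3 := {poly {poly {poly K}}}.

Definition dx (F : T3) : T3 := F^`().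
Definition dy (F : T3) : T3 := map_poly (@deriv {poly K}) F.
Definition dz (F : T3) : T3 := map_poly (map_poly (@deriv K)) F.

Lemma dxD (F G : T3) : dx (F + G) = dx F + dx G.
Proof. exact: derivD. Qed.

Lemma dyD (F G : T3) : dy (F + G) = dy F + dy G.
Proof. exact: raddfD. Qed.

Lemma dzD (F G : T3) : dz (F + G) = dz F + dz G.
Proof. exact: raddfD. Qed.

Lemma dxM (F G : T3) : dx (F * G) = dx F * G + F * dx G.
Proof. exact: derivM. Qed.

Lemma dyM (F G : T3) : dy (F * G) = dy F * G + F * dy G.
Proof. exact: (map_derivation (@deriv_derivation _)). Qed.

Lemma dxC (c : T2) : dx c%:P = 0.
Proof. exact: derivC. Qed.

Lemma dyC (c : {poly K}) : dy c%:P%:P = 0.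
Proof. by rewrite /dy map_polyC /= derivC. Qed.

Lemma dxdy F : dx (dy F) = dy (dx F).
Proof. exact: deriv_map_additive. Qed.

Lemma dxdz F : dx (dz F) = dz (dx F).
Proof. exact: deriv_map_additive. Qed.

Lemma dydz F : dy (dz F) = dz (dy F).
Proof. by apply/polyP => i; rewrite !coef_map /= deriv_map_additive. Qed.

Lemma restr_deriv al be (F : T3) :
  (restr al be F)^`() =
  al^`() * restr al be (dy F) + be^`() * restr al be (dx F) + restr al be (dz F).
Proof.
have E : map_poly (@deriv K) (map_poly (horner_eval al) F) =
    al^`()%:P * map_poly (horner_eval al) (dy F) + map_poly (horner_eval al) (dz F).
  apply/polyP => i; rewrite coefD coefCM !coef_map /= !horner_evalE.
  exact: (derivation_horner (@deriv_derivation _) (derivC _)).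
rewrite {1}/restr /= horner_evalE.
rewrite (derivation_horner (@deriv_derivation _) (derivC _)) E deriv_map.
by rewrite !hornerE /restr /= !horner_evalE; ring.
Qed.

Lemma restr_eq_at al be al' be' (F : T3) (t : K) :
  al.[t] = al'.[t] -> be.[t] = be'.[t] ->
  (restr al be F).[t] = (restr al' be' F).[t].
Proof.
have E a b : (restr a b F).[t] =
    (map_poly (fun c : T2 => (map_poly (horner_eval t) c).[a.[t]]) F).[b.[t]].
  rewrite /restr /= horner_evalE -[LHS]/(horner_eval t _) -horner_map /=.
  rewrite -map_poly_comp; congr (_.[_]).
  apply: eq_map_poly => c /=; rewrite /horner_eval -[LHS]/(horner_eval t _).
  by rewrite -horner_map.
by move=> Ha Hb; rewrite !E Ha Hb.
Qed.

(** Partial degrees rather than the total degree: they are read off the nested coefficients and add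
    up under products and under restriction to a line. *)
Definition tri (a b c : nat) (F : T3) : Prop :=
  forall i j k, ((a < i) || (b < j) || (c < k))%N -> F`_i`_j`_k = 0.

Lemma triD a b c F G : tri a b c F -> tri a b c G -> tri a b c (F + G).
Proof. by move=> HF HG i j k H; rewrite !coefD HF // HG // addr0. Qed.

Lemma triN a b c F : tri a b c F -> tri a b c (- F).
Proof. by move=> HF i j k H; rewrite !coefN HF // oppr0. Qed.

Lemma triM a b c a' b' c' F G :
  tri a b c F -> tri a' b' c' G -> tri (a + a') (b + b') (c + c') (F * G).
Proof.
move=> HF HG i j k H; rewrite coefM !coef_sum big1 // => i' _.
rewrite coefM coef_sum big1 // => j' _; rewrite coefM big1 // => k' _.
have [E|E] := boolP ((a < i') || (b < j') || (c < k'))%N.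
  by rewrite HF // mul0r.
rewrite HG ?mulr0 //; move: H E.
by have := ltn_ord i'; have := ltn_ord j'; have := ltn_ord k'; lia.
Qed.

Lemma tri_dx a b c F : tri a b c F -> tri a b c (dx F).
Proof.
move=> HF i j k H; rewrite coef_deriv !coefMn HF ?mul0rn //.
by move: H => /orP[/orP[]|] H; rewrite ?H ?orbT // (leq_trans H) //= orbT.
Qed.

Lemma tri_dy a b c F : tri a b c F -> tri a b c (dy F).
Proof.
move=> HF i j k H; rewrite coef_map /= coef_deriv coefMn HF ?mul0rn //.
by move: H => /orP[/orP[]|] H; rewrite ?H ?orbT // (leq_trans H) //= orbT.
Qed.

Lemma tri_dz a b c F : tri a b c F -> tri a b c (dz F).
Proof.
move=> HF i j k H; rewrite coef_map /= coef_map /= coef_deriv HF ?mul0rn //.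
by move: H => /orP[/orP[]|] H; rewrite ?H ?orbT // (leq_trans H) //= orbT.
Qed.

Lemma tri_size a b c F : tri a b c F -> (size F <= a.+1)%N.
Proof.
move=> HF; apply/leq_sizeP => i Hi; apply/polyP => j; apply/polyP => k.
by rewrite !coef0 HF // Hi.
Qed.

Lemma tri_sizeY a b c F : tri a b c F -> (sizeY F <= b.+1)%N.
Proof.
move=> HF; apply/bigmax_leqP => i _; apply/leq_sizeP => j Hj; apply/polyP => k.
by rewrite !coef0 HF // Hj orbT.
Qed.

Lemma size_horner_leq (R : nzRingType) (p : {poly {poly R}}) (u : {poly R}) (n m : nat) :
  (size p <= n.+1)%N -> (forall i, (size (p`_i)%R <= m.+1)%N) -> (size u <= 2)%N ->
  (size p.[u] <= (n + m).+1)%N.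
Proof.
move=> sp sc su; rewrite (horner_coef_wide _ sp).
apply: leq_trans (size_sum _ _ _) _; apply/bigmax_leqP => i _.
apply: leq_trans (size_polyMleq _ _) _.
have := sc i; have : (size (u ^+ i) <= i.+1)%N.
  apply: leq_trans (size_poly_exp_leq _ _) _.
  by rewrite ltnS -{2}[nat_of_ord i]mul1n leq_mul2r; apply/orP; right; lia.
by have := ltn_ord i; move: (size _) (size _) => x y; lia.
Qed.

Lemma size_restr a b c (al be : {poly K}) F :
  tri a b c F -> (size al <= 2)%N -> (size be <= 2)%N ->
  (size (restr al be F) <= (a + b + c).+1)%N.
Proof.
move=> HF sa sb; rewrite /restr /= horner_evalE -addnA.
apply: size_horner_leq => // [|i].
  by apply: leq_trans (size_poly _ _) _; exact: tri_size HF.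
rewrite coef_map /= horner_evalE; apply: size_horner_leq => //.
  by apply/leq_sizeP => j Hj; apply/polyP => k; rewrite coef0 HF // Hj orbT.
by move=> j; apply/leq_sizeP => k Hk; rewrite HF // Hk orbT.
Qed.

End Jets.

(* Remainder of the quartic h modulo the quadratic q = A s^2 - B s + C in the
   slope s, after multiplication by A^3. *)
Definition rem1 (R : comNzRingType) (A B C h4 h3 h2 h1 : R) : R :=
  A ^+ 3 * h1 + A ^+ 2 * B * h2 + A * (B ^+ 2 - A * C) * h3
  + (B ^+ 3 - 2 * A * B * C) * h4.

Definition rem0 (R : comNzRingType) (A B C h4 h3 h2 h0 : R) : R :=
  A ^+ 3 * h0 - A ^+ 2 * C * h2 - A * B * C * h3 - C * (B ^+ 2 - A * C) * h4.

Definition quo0 (R : comNzRingType) (A B C h4 h3 h2 s : R) : R :=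
  A ^+ 2 * h4 * s ^+ 2 + (A ^+ 2 * h3 + A * B * h4) * s
  + (A ^+ 2 * h2 + A * B * h3 + (B ^+ 2 - A * C) * h4).

(** * First and second order conditions along a null line *)

Section Core.

Variable K : fieldType.
Local Notation T3 := {poly {poly {poly K}}}.
Implicit Types (F G : T3).

(* A null line (s, w1, w2): its points are x = w2 - s z, y = w1 - s w2 + s^2 z. *)
Definition nly (q : K * K * K) : {poly K} :=
  (q.1.2 - q.1.1 * q.2)%:P + (q.1.1 ^+ 2)%:P * 'X.
Definition nlx (q : K * K * K) : {poly K} := q.2%:P - q.1.1%:P * 'X.
Definition onl (q : K * K * K) : T3 -> {poly K} := restr (nly q) (nlx q).

HB.instance Definition _ q := GRing.RMorphism.on (onl q).

Definition cst (s : K) : T3 := s%:P%:P%:P.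

Lemma onl_cst q s : onl q (cst s) = s%:P.
Proof. by rewrite /onl restr_polyC hornerC. Qed.

(** Derivative in the direction (-s, s^2, 1) of the null lines of slope s. It is quadratic in s, so
    that in general at most two null lines of a surface pass through one of its points. *)
Definition dnull (s : K) (G : T3) : T3 := cst s ^+ 2 * dy G - cst s * dx G + dz G.

Lemma onl_dnull q s G :
  onl q (dnull s G) =
  s%:P ^+ 2 * onl q (dy G) - s%:P * onl q (dx G) + onl q (dz G).
Proof.
have gen (R S : comNzRingType) (f : {rmorphism R -> S}) (c a b d : R) :
    f (c ^+ 2 * a - c * b + d) = f c ^+ 2 * f a - f c * f b + f d.
  by rewrite !expr2 rmorphD rmorphB !rmorphM.
by rewrite -(onl_cst q); exact: gen.
Qed.

Lemma onl_deriv q F : (onl q F)^`() = onl q (dnull q.1.1 F).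
Proof.
rewrite onl_dnull {1}/onl restr_deriv.
have -> : (nly q)^`() = q.1.1%:P ^+ 2.
  by rewrite /nly derivD derivC derivM derivC derivX mul0r !add0r mulr1 polyC_exp.
have -> : (nlx q)^`() = - q.1.1%:P.
  by rewrite /nlx derivB derivC derivM derivC derivX mul0r !add0r mulr1.
by rewrite mulNr.
Qed.

(** [dnull s F] is [A_ s^2 - B_ s + C_], and [dnull s (dnull s F)] is the quartic in s with
    coefficients [h4_] to [h0_]. Along a null line of slope s in the surface both vanish, hence so
    does the linear remainder [R1_ s + R0_]. *)
Definition A_ F := dy F.
Definition B_ F := dx F.
Definition C_ F := dz F.
Definition h4_ F := dy (dy F).
Definition h3_ F := - (2 * dx (dy F)).
Definition h2_ F := dx (dx F) + 2 * dz (dy F).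
Definition h1_ F := - (2 * dz (dx F)).
Definition h0_ F := dz (dz F).
Definition R1_ F := rem1 (A_ F) (B_ F) (C_ F) (h4_ F) (h3_ F) (h2_ F) (h1_ F).
Definition R0_ F := rem0 (A_ F) (B_ F) (C_ F) (h4_ F) (h3_ F) (h2_ F) (h0_ F).
Definition k_ F s := quo0 (A_ F) (B_ F) (C_ F) (h4_ F) (h3_ F) (h2_ F) (cst s).

Lemma dzM F G : dz (F * G) = dz F * G + F * dz G.
Proof.
apply: map_derivation => a b; apply: map_derivation; exact: deriv_derivation.
Qed.

Lemma dnull_comm (D : T3 -> T3) s G :
  (forall F G, D (F * G) = D F * G + F * D G) ->
  (forall F G, D (F + G) = D F + D G) -> D (cst s) = 0 ->
  D (dnull s G) = cst s ^+ 2 * D (dy G) - cst s * D (dx G) + D (dz G).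
Proof.
move=> DM DD Dc; rewrite /dnull expr2.
have DN F : D (- F) = - D F.
  apply/eqP; rewrite -subr_eq0 opprK -DD addNr -[X in D X](mul0r 0) DM.
  by rewrite mulr0 mul0r addr0.
by rewrite !DD DN !DM Dc; ring.
Qed.

Lemma dnull_dy s G : dy (dnull s G) = dnull s (dy G).
Proof.
rewrite (dnull_comm _ (@dyM K) (@dyD K)); last exact: dyC.
by rewrite /dnull dxdy dydz.
Qed.

Lemma dnull_dx s G : dx (dnull s G) = dnull s (dx G).
Proof.
rewrite (dnull_comm _ (@dxM K) (@dxD K)); last exact: dxC.
by rewrite /dnull dxdy dxdz.
Qed.

Lemma dzC (c : K) : dz (cst c) = 0.
Proof. by rewrite /dz /cst map_polyC /= map_polyC /= derivC !polyC0. Qed.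

Lemma dnull_dz s G : dz (dnull s G) = dnull s (dz G).
Proof.
rewrite (dnull_comm _ dzM (@dzD K)); last exact: dzC.
by rewrite /dnull dydz dxdz.
Qed.

Lemma dnull2E s F :
  dnull s (dnull s F) = h4_ F * cst s ^+ 4 + h3_ F * cst s ^+ 3
    + h2_ F * cst s ^+ 2 + h1_ F * cst s + h0_ F.
Proof.
rewrite {1}/dnull dnull_dy dnull_dx dnull_dz /dnull /h4_ /h3_ /h2_ /h1_ /h0_.
rewrite -!dydz -!dxdz -!dxdy.
by move: (cst s) (dy _) (dx _) => c; intros; ring.
Qed.

Lemma remainder_identity s F :
  A_ F ^+ 3 * dnull s (dnull s F) =
  dnull s F * k_ F s + (R1_ F * cst s + R0_ F).
Proof.
rewrite dnull2E /dnull -/(A_ F) -/(B_ F) -/(C_ F) /R1_ /R0_ /k_ /rem1 /rem0 /quo0.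
move: (A_ F) (B_ F) (C_ F) (h4_ F) (h3_ F) (h2_ F) (h1_ F) (h0_ F) (cst s).
by move=> *; ring.
Qed.

(** This is [remainder_identity] differentiated in [s], with the derivative of the quartic expressed
    by those of [A_] and [B_] along the line. *)
Lemma remainder_identity_slope s F :
  A_ F ^+ 3 * (2 * (2 * cst s * dnull s (A_ F) - dnull s (B_ F))) =
  (2 * cst s * A_ F - B_ F) * k_ F s
  + dnull s F * (2 * A_ F ^+ 2 * h4_ F * cst s + (A_ F ^+ 2 * h3_ F + A_ F * B_ F * h4_ F))
  + R1_ F.
Proof.
have -> : 2 * (2 * cst s * dnull s (A_ F) - dnull s (B_ F)) =
    4 * h4_ F * cst s ^+ 3 + 3 * h3_ F * cst s ^+ 2 + 2 * h2_ F * cst s + h1_ F.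
  rewrite /dnull /A_ /B_ /h4_ /h3_ /h2_ /h1_ -!dxdy.
  by move: (cst s) => c; ring.
rewrite /dnull -/(A_ F) -/(B_ F) -/(C_ F) /R1_ /k_ /rem1 /quo0.
move: (A_ F) (B_ F) (C_ F) (h4_ F) (h3_ F) (h2_ F) (h1_ F) (cst s).
by move=> *; ring.
Qed.

(** By Vieta, g / f is s' - s, where s' is the other root of the quadratic at a point of the line;
    the equation says that (f / g)'' = 0. It comes from differentiating [remainder_identity] in y
    and in x, restricting to the line, and eliminating [k_] and the multiplier of F by means of
    [remainder_identity_slope]. *)
Lemma null_line_ode q F E0 E1 (f := onl q (A_ F))
    (g := onl q (B_ F) - 2 * q.1.1%:P * f) :
  onl q F = 0 -> R0_ F = E0 * F -> R1_ F = E1 * F -> f != 0 ->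
  g * (g * f^`()^`() - f * g^`()^`()) = 2 * g^`() * (g * f^`() - f * g^`()).
Proof.
move=> HF H0 H1 f0; set s := q.1.1 in g *; set f2 := onl q (B_ F).
have od G : onl q (dnull s G) = (onl q G)^`() by rewrite onl_deriv.
have Hq : onl q (dnull s F) = 0 by rewrite -onl_deriv HF derivC.
have Hh : onl q (dnull s (dnull s F)) = 0 by rewrite -onl_deriv Hq derivC.
have I := remainder_identity s F.
set E := E1 * cst s + E0.
have HE : R1_ F * cst s + R0_ F = E * F by rewrite H0 H1 /E; ring.
have gen (R S : comNzRingType) (h : {rmorphism R -> S}) (da a H dH dq p k dk de e G dG : R) :
    da * H + a * dH = (dq * k + p * dk) + (de * G + e * dG) ->
    h H = 0 -> h p = 0 -> h G = 0 -> h a * h dH = h dq * h k + h e * h dG.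
  move=> EE H0' p0 G0; have := congr1 h EE; rewrite !rmorphD !rmorphM H0' p0 G0.
  by rewrite !mulr0 !mul0r !add0r addr0.
have gen' (R S : comNzRingType) (h : {rmorphism R -> S}) (a c u v b k p m e G : R) :
    a ^+ 3 * (2 * (2 * c * u - v)) = (2 * c * a - b) * k + p * m + e * G ->
    h p = 0 -> h G = 0 ->
    h a ^+ 3 * (2 * (2 * h c * h u - h v)) = (2 * h c * h a - h b) * h k.
  move=> EE p0 G0; have := congr1 h EE.
  rewrite !(rmorphD, rmorphN, rmorphM, rmorph_nat) p0 G0.
  by rewrite mul0r mulr0 !addr0 => <-; ring.
(* F and its first two null derivatives vanish on the line, so in each product only the term where D
   hits the vanishing factor survives. *)
have key (D : T3 -> T3) : (forall G H, D (G * H) = D G * H + G * D H) ->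
    (forall G H, D (G + H) = D G + D H) -> (forall G, D (dnull s G) = dnull s (D G)) ->
    f ^+ 3 * (onl q (D F))^`()^`() = (onl q (D F))^`() * onl q (k_ F s) + onl q E * onl q (D F).
  move=> DM DD Dn.
  have L : D (A_ F ^+ 3) * dnull s (dnull s F) + A_ F ^+ 3 * dnull s (dnull s (D F)) =
      (dnull s (D F) * k_ F s + dnull s F * D (k_ F s)) + (D E * F + E * D F).
    by rewrite -!Dn -!DM -DD -HE -I.
  have : onl q (A_ F ^+ 3) * onl q (dnull s (dnull s (D F))) =
      onl q (dnull s (D F)) * onl q (k_ F s) + onl q E * onl q (D F).
    exact: gen _ _ (onl q) _ _ _ _ _ _ _ _ _ _ _ _ L Hh Hq HF.
  by rewrite !od rmorphXn.
have e1 := key _ (@dyM K) (@dyD K) (@dnull_dy s).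
have e2 := key _ (@dxM K) (@dxD K) (@dnull_dx s).
have e3 : f ^+ 3 * (2 * (2 * s%:P * f^`() - f2^`())) = (2 * s%:P * f - f2) * onl q (k_ F s).
  have := remainder_identity_slope s F; rewrite H1 => J.
  have : onl q (A_ F) ^+ 3 * (2 * (2 * onl q (cst s) * onl q (dnull s (A_ F))
        - onl q (dnull s (B_ F)))) =
      (2 * onl q (cst s) * onl q (A_ F) - onl q (B_ F)) * onl q (k_ F s).
    exact: gen' _ _ (onl q) _ _ _ _ _ _ _ _ _ _ J Hq HF.
  by rewrite !od onl_cst.
rewrite -[onl q (dy F)]/f in e1; rewrite -[onl q (dx F)]/f2 in e2.
move: (onl q E) (onl q (k_ F s)) e1 e2 e3 => e k e1 e2 e3.
have dg : g^`() = f2^`() - 2 * s%:P * f^`().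
  rewrite /g derivB derivM -/f2; congr (_ - _).
  by rewrite -polyC_natr -polyCM derivC mul0r add0r.
have d2g : g^`()^`() = f2^`()^`() - 2 * s%:P * f^`()^`().
  rewrite dg derivB derivM; congr (_ - _).
  by rewrite -polyC_natr -polyCM derivC mul0r add0r.
have Eg : f2 = g + 2 * s%:P * f by rewrite /g subrK.
rewrite d2g dg; apply: (mulfI (expf_neq0 3 f0)).
(* The multiplier [e] of F cancels in this antisymmetric combination of [e1] and [e2]. *)
have Hg : f ^+ 3 * (g * f^`()^`() - f * (f2^`()^`() - 2 * s%:P * f^`()^`())) =
    k * (g * f^`() - f * (f2^`() - 2 * s%:P * f^`())).
  transitivity (g * (f ^+ 3 * f^`()^`())
      - f * (f ^+ 3 * f2^`()^`() - 2 * s%:P * (f ^+ 3 * f^`()^`()))); first by ring.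
  by rewrite e1 e2; move: (f2^`()) (f^`()) => d2 d; rewrite Eg; ring.
transitivity (g * (f ^+ 3 * (g * f^`()^`() - f * (f2^`()^`() - 2 * s%:P * f^`()^`())))).
  by ring.
rewrite Hg.
transitivity (- ((2 * s%:P * f - f2) * k) * (g * f^`() - f * (f2^`() - 2 * s%:P * f^`()))).
  by move: (f2^`()) (f^`()) => d2 d; rewrite Eg; ring.
by rewrite -e3; ring.
Qed.

End Core.

(** * Wronskians in characteristic p *)

Section Wronskian.

Variables (K : fieldType) (p : nat).
Hypothesis charK : forall n, (0 < n < p)%N -> n%:R != 0 :> K.
Implicit Types U V : {poly K}.

Lemma deriv_eq0_size U : U^`() = 0 -> (size U <= p)%N -> (size U <= 1)%N.
Proof.
move=> dU sU; apply/leq_sizeP => i Hi.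
have [Hp|Hp] := leqP p i; first by rewrite nth_default // (leq_trans sU).
have := congr1 (fun P : {poly K} => P`_i.-1) dU.
rewrite coef_deriv coef0 prednK // -mulr_natr => /eqP.
by rewrite mulf_eq0 (negPf (charK _)) ?orbF ?Hi // => /eqP.
Qed.

(** Writing U = QV + R, the hypothesis becomes Q' V^2 = R V' - R' V, and the right side has too
    small a degree unless Q' = 0. *)
Lemma wronskian_quotient U V :
  V != 0 -> U^`() * V = U * V^`() -> (U %/ V)^`() = 0.
Proof.
move=> V0 H; apply/eqP; apply: contraT => Q0.
have E := divp_eq U V; set Q := U %/ V in E Q0 *; set R := U %% V in E.
have sR : (size R < size V)%N by rewrite ltn_modp.
have EQ : Q^`() * (V * V) = R * V^`() - R^`() * V.
  have -> : Q^`() * (V * V) = (Q * V + R)^`() * V - R^`() * V - Q * V * V^`().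
    by rewrite !derivE; ring.
  by rewrite -E H {1}E; ring.
have s1 : (size (Q^`() * (V * V))%R = (size (Q^`())%R + (size V + size V).-1).-1)%N.
  by rewrite size_mul ?mulf_neq0 // size_mul.
have s2 : (size (R * V^`())%R <= (size V).-1 + (size V).-1 - 1)%N.
  apply: leq_trans (size_polyMleq _ _) _; have := lt_size_deriv V0.
  by move: (size _) (size _) (size _) sR => x y z; lia.
have s3 : (size (R^`() * V)%R <= (size V).-1 + (size V).-1)%N.
  apply: leq_trans (size_polyMleq _ _) _; have : (size (R^`())%R <= (size R).-1)%N by apply: size_poly.
  by move: (size _) (size _) (size _) sR => x y z; lia.
have := size_polyD (R * V^`()) (- (R^`() * V)).
rewrite size_polyN -EQ s1; move: Q0; rewrite -size_poly_gt0.
have : (0 < size V)%N by rewrite size_poly_gt0.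
move: s2 s3; move: (size (R * _)) (size (R^`() * _)) (size (Q^`())%R) (size V) => x y z v.
by clear; lia.
Qed.

(** The quotient is a constant c, and R = U - cV satisfies the same equation with V. If R were not
    zero, V would have a constant quotient by R in turn, although deg R < deg V. *)
Lemma wronskian_proportional U V :
  V != 0 -> (size U <= p)%N -> (size V <= p)%N ->
  U^`() * V = U * V^`() -> exists c, U = c%:P * V.
Proof.
move=> V0 sU sV H.
have dQ := wronskian_quotient V0 H.
have sQ : (size (U %/ V)%R <= 1)%N.
  by apply: deriv_eq0_size dQ _; apply: leq_trans (leq_divp _ _) sU.
have EQ := size1_polyC sQ; have E := divp_eq U V.
exists ((U %/ V)`_0); rewrite -EQ; apply/eqP; rewrite {1}E -subr_eq0 addrC addKr.
apply: contraT => R0; set R := U %% V in E R0.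
have sR : (size R < size V)%N by rewrite ltn_modp.
have HR : V^`() * R = V * R^`().
  have : R^`() * V = R * V^`(); last by move=> e; rewrite mulrC -e mulrC.
  have -> : R = U - (U %/ V) * V by rewrite {1}E addrC addKr.
  rewrite derivB derivM dQ mul0r add0r !mulrBl H; ring.
have := wronskian_quotient R0 HR => /deriv_eq0_size -/(_ (leq_trans (leq_divp _ _) sV)).
rewrite size_divp //; move: R0 sR; rewrite -size_poly_gt0.
by move: (size R) (size V) => x y; clear; lia.
Qed.

(** The equation is (f / g)'' = 0. With W = g f' - f g' it gives W' g^2 = W (g^2)', so W = c g^2,
    and then f - c X g has zero Wronskian with g. Degree 2m occurs here, whence 2m < p. *)
Lemma ratio_linear (m : nat) (f g : {poly K}) :
  (0 < m)%N -> (2 * m < p)%N -> (size f <= m.+1)%N -> (size g <= m.+1)%N -> g != 0 ->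
  g * (g * f^`()^`() - f * g^`()^`()) = 2 * g^`() * (g * f^`() - f * g^`()) ->
  exists c b : K, f = (c%:P * 'X + b%:P) * g.
Proof.
move=> m0 mp sf sg g0 H; set W := g * f^`() - f * g^`() in H.
have dW : W^`() = g * f^`()^`() - f * g^`()^`() by rewrite /W !derivE; ring.
have sd (h : {poly K}) : (size h <= m.+1)%N -> (size (h^`())%R <= m)%N.
  by move=> sh; apply: leq_trans (size_poly _ _) _; lia.
have sM (a b : {poly K}) x y : (size a <= x)%N -> (size b <= y)%N -> (size (a * b)%R <= (x + y).-1)%N.
  by move=> sa sb; apply: leq_trans (size_polyMleq _ _) _; lia.
have sW : (size W <= 2 * m)%N.
  apply: leq_trans (size_polyD _ _) _; rewrite size_polyN geq_max.
  have := sM _ _ _ _ sg (sd _ sf); have := sM _ _ _ _ sf (sd _ sg).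
  by move: (size _) (size _) => x y H1 H2; apply/andP; split; lia.
have [||||c Ec] := @wronskian_proportional W (g * g).
- by rewrite mulf_neq0.
- by lia.
- by have := sM _ _ _ _ sg sg; lia.
- rewrite -dW in H; rewrite derivM mulrC -mulrA H; ring.
have [||||b Eb] := @wronskian_proportional (f - c%:P * 'X * g) g => //.
- apply: leq_trans (size_polyD _ _) _; rewrite size_polyN geq_max.
  apply/andP; split; first by lia.
  have s2 : (size (c%:P * 'X)%R <= 2)%N.
    apply: leq_trans (size_polyMleq _ _) _; rewrite size_polyX size_polyC.
    by case: (c != 0).
  by apply: leq_trans (sM _ _ _ _ s2 sg) _; lia.
- by lia.
- apply/eqP; rewrite -subr_eq0; apply/eqP.
  transitivity (W - c%:P * (g * g)); last by rewrite Ec subrr.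
  by rewrite /W !derivE; ring.
by exists c, b; rewrite mulrDl -Eb; ring.
Qed.

End Wronskian.

(** The 2 x 2 minors of the two difference vectors, so that repeated points need no separate
    case. *)
Definition collinear (R : pzRingType) (q1 q2 q3 : R * R * R) : Prop :=
  [/\ (q2.1.1 - q1.1.1) * (q3.1.2 - q1.1.2) = (q3.1.1 - q1.1.1) * (q2.1.2 - q1.1.2),
      (q2.1.1 - q1.1.1) * (q3.2 - q1.2) = (q3.1.1 - q1.1.1) * (q2.2 - q1.2)
    & (q2.1.2 - q1.1.2) * (q3.2 - q1.2) = (q3.1.2 - q1.1.2) * (q2.2 - q1.2)].

(** * Null lines of a surface that meet each other *)

Section NullLines.

Variables (K : fieldType) (p : nat).
Hypothesis charK : forall n, (0 < n < p)%N -> n%:R != 0 :> K.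
Local Notation T3 := {poly {poly {poly K}}}.
Implicit Types (F G : T3) (q : K * K * K).

(* A coordinate swap reduces the y and z derivatives to the outermost one. *)
Lemma deriv_dvdr_eq0 (R : idomainType) (P c : {poly R}) :
  P^`() = c * P -> P^`() = 0.
Proof.
move=> E; apply/eqP; apply: contraT => d0; exfalso.
have P0 : P != 0 by apply: contraNneq d0 => ->; rewrite derivC.
have c0 : c != 0 by apply: contraNneq d0 => c0; rewrite E c0 mul0r.
have := lt_size_deriv P0; rewrite E size_mul //.
by move: c0; rewrite -size_poly_gt0; move: (size c) (size P) => x y; lia.
Qed.

Lemma dvdr_dx F : dvdr F (dx F) -> dx F = 0.
Proof. by move=> [c E]; exact: deriv_dvdr_eq0 E. Qed.

Lemma dvdr_dy F : dvdr F (dy F) -> dy F = 0.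
Proof.
move=> [c E]; have sE : swapXY (dy F) = (swapXY F)^`().
  by apply/polyP => i; apply/polyP => j; rewrite !(coef_swapXY, coef_map, coef_deriv, coefMn).
apply: (inv_inj (@swapXYK _)); rewrite sE rmorph0.
by apply: (@deriv_dvdr_eq0 _ _ (swapXY c)); rewrite -sE E rmorphM.
Qed.

Lemma dvdr_dz F : dvdr F (dz F) -> dz F = 0.
Proof.
move=> [c E]; pose sw (G : T3) : T3 := swapXY (map_poly swapXY G).
have swE G i j k : (sw G)`_i`_j`_k = G`_j`_k`_i.
  by rewrite coef_swapXY coef_map /= coef_swapXY.
have sE : sw (dz F) = (sw F)^`().
  apply/polyP => i; apply/polyP => j; apply/polyP => k.
  by rewrite swE coef_deriv !coefMn swE coef_map /= coef_map /= coef_deriv.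
have d0 : (sw F)^`() = 0.
  by apply: (@deriv_dvdr_eq0 _ _ (sw c)); rewrite -sE E /sw !rmorphM.
apply/polyP => j; apply/polyP => k; apply/polyP => i.
by rewrite -swE sE d0 !coef0.
Qed.

Lemma derivatives_eq0 a b c F :
  tri a b c F -> (a < p)%N -> (b < p)%N -> (c < p)%N ->
  dx F = 0 -> dy F = 0 -> dz F = 0 -> F = (F`_0`_0`_0)%:P%:P%:P.
Proof.
move=> HF ap bp cp Hx Hy Hz.
have ch n x : (0 < n < p)%N -> x *+ n = 0 :> K -> x = 0.
  by move=> Hn /eqP; rewrite -mulr_natr mulf_eq0 (negPf (charK Hn)) orbF => /eqP.
apply/polyP => i; apply/polyP => j; apply/polyP => k.
rewrite !coefC; case: i => [|i] /=; last first.
  rewrite !coef0; have [Hi|Hi] := ltnP a i.+1; first by rewrite HF // Hi.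
  apply: (@ch i.+1); first by lia.
  have := congr1 (fun P : T3 => P`_i`_j`_k) Hx.
  by rewrite coef_deriv !coefMn !coef0.
rewrite !coefC; case: j => [|j] /=; last first.
  rewrite !coef0; have [Hj|Hj] := ltnP b j.+1; first by rewrite HF // Hj orbT.
  apply: (@ch j.+1); first by lia.
  have := congr1 (fun P : T3 => P`_0`_j`_k) Hy.
  by rewrite coef_map /= coef_deriv coefMn !coef0.
rewrite coefC; case: k => [|k] //=.
have [Hk|Hk] := ltnP c k.+1; first by rewrite HF // Hk orbT.
apply: (@ch k.+1); first by lia.
have := congr1 (fun P : T3 => P`_0`_0`_k) Hz.
by rewrite coef_map /= coef_map /= coef_deriv !coef0.
Qed.

Lemma tri_cst n a b c : tri a b c (n%:R : T3).
Proof.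
move=> i j k H; rewrite -polyC_natr coefC; case: i H => [|i] H; last by rewrite !coef0.
rewrite /= -polyC_natr coefC; case: j H => [|j] H; last by rewrite !coef0.
rewrite /= -polyC_natr coefC; case: k H => [|k] H //; lia.
Qed.

Lemma tri_rem a b c F : tri a b c F ->
  tri (4 * a) (4 * b) (4 * c) (R1_ F) /\ tri (4 * a) (4 * b) (4 * c) (R0_ F).
Proof.
move=> HF; set a4 := (4 * a)%N; set b4 := (4 * b)%N; set c4 := (4 * c)%N.
have tA : tri a b c (A_ F) by apply: tri_dy.
have tB : tri a b c (B_ F) by apply: tri_dx.
have tC : tri a b c (C_ F) by apply: tri_dz.
have t2 G : tri a b c G -> tri a b c (2 * G).
  by move=> HG; have := triM (@tri_cst 2 0 0 0) HG; rewrite !add0n.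
have t4 : tri a b c (h4_ F) by do 2!apply: tri_dy.
have t3 : tri a b c (h3_ F) by apply: triN; apply: t2; apply: tri_dx; apply: tri_dy.
have th2 : tri a b c (h2_ F).
  by apply: triD; [do 2!apply: tri_dx | apply: t2; apply: tri_dz; apply: tri_dy].
have t1 : tri a b c (h1_ F) by apply: triN; apply: t2; apply: tri_dz; apply: tri_dx.
have t0 : tri a b c (h0_ F) by do 2!apply: tri_dz.
have quad (x y z w : T3) : tri a b c x -> tri a b c y -> tri a b c z -> tri a b c w ->
    tri a4 b4 c4 (x * y * z * w).
  move=> hx hy hz hw; have := triM (triM (triM hx hy) hz) hw.
  by congr tri; lia.
have t24 G : tri a4 b4 c4 G -> tri a4 b4 c4 (2 * G).
  by move=> HG; have := triM (@tri_cst 2 0 0 0) HG; rewrite !add0n.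
rewrite /R1_ /R0_ /rem1 /rem0; move: (A_ F) (B_ F) (C_ F) (h4_ F) (h3_ F) (h2_ F)
  (h1_ F) (h0_ F) tA tB tC t4 t3 th2 t1 t0 => A B C h4 h3 h2 h1 h0 tA tB tC t4 t3 th2 t1 t0.
split.
  have -> : A ^+ 3 * h1 + A ^+ 2 * B * h2 + A * (B ^+ 2 - A * C) * h3
      + (B ^+ 3 - 2 * A * B * C) * h4 =
    A * A * A * h1 + A * A * B * h2 + (A * B * B * h3 - A * A * C * h3)
      + (B * B * B * h4 - 2 * (A * B * C * h4)) by ring.
  by repeat (apply: triD || apply: triN || apply: t24 || apply: quad).
have -> : A ^+ 3 * h0 - A ^+ 2 * C * h2 - A * B * C * h3 - C * (B ^+ 2 - A * C) * h4 =
  A * A * A * h0 - A * A * C * h2 - A * B * C * h3 - (C * B * B * h4 - C * A * C * h4) by ring.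
by repeat (apply: triD || apply: triN || apply: t24 || apply: quad).
Qed.

Lemma size_nly q : (size (nly q) <= 2)%N.
Proof.
apply: leq_trans (size_polyD _ _) _; rewrite geq_max size_polyC.
apply/andP; split; first by case: (_ != 0).
apply: leq_trans (size_polyMleq _ _) _; rewrite size_polyX size_polyC.
by case: (_ != 0).
Qed.

Lemma size_nlx q : (size (nlx q) <= 2)%N.
Proof.
apply: leq_trans (size_polyD _ _) _; rewrite geq_max size_polyN size_polyC.
apply/andP; split; first by case: (_ != 0).
apply: leq_trans (size_polyMleq _ _) _; rewrite size_polyX size_polyC.
by case: (_ != 0).
Qed.

Lemma size_onl a b c q F : tri a b c F -> (size (onl q F) <= (a + b + c).+1)%N.
Proof. by move=> HF; apply: size_restr => //; [apply: size_nly|apply: size_nlx]. Qed.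

Lemma onlD q F G : onl q (F + G) = onl q F + onl q G.
Proof. exact: rmorphD. Qed.

Lemma onlM q F G : onl q (F * G) = onl q F * onl q G.
Proof. exact: rmorphM. Qed.

(** Distinct slopes, so that two meeting lines provide two different roots of the polynomials in the
    slope. *)
Definition meet_at q1 q2 (t : K) : Prop :=
  [/\ q1.1.1 != q2.1.1, (nly q1).[t] = (nly q2).[t] & (nlx q1).[t] = (nlx q2).[t]].

Lemma onl_meet q1 q2 t G : meet_at q1 q2 t -> (onl q1 G).[t] = (onl q2 G).[t].
Proof. by case=> _ hy hx; apply: restr_eq_at. Qed.

(** Both slopes are roots of [A_ s^2 - B_ s + C_] at the common point; these are Vieta's formulas,
    free of division by [A_]. *)
Lemma meet_gradient q1 q2 t F :
  onl q1 F = 0 -> onl q2 F = 0 -> meet_at q1 q2 t ->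
  (onl q1 (B_ F)).[t] - 2 * q1.1.1 * (onl q1 (A_ F)).[t] =
    (onl q1 (A_ F)).[t] * (q2.1.1 - q1.1.1)
  /\ (onl q1 (C_ F)).[t] = q1.1.1 * q2.1.1 * (onl q1 (A_ F)).[t].
Proof.
move=> H1 H2 M.
have E q : onl q F = 0 -> q.1.1 ^+ 2 * (onl q (A_ F)).[t] - q.1.1 * (onl q (B_ F)).[t]
    + (onl q (C_ F)).[t] = 0.
  move=> Hq; have := congr1 (fun P : {poly K} => P.[t]) (onl_deriv q F).
  by rewrite Hq derivC onl_dnull !hornerE => <-.
have := E _ H2; have := E _ H1; rewrite -!(onl_meet _ M); case: M => s12 _ _.
move: (onl q1 (A_ F)).[t] (onl q1 (B_ F)).[t] (onl q1 (C_ F)).[t] => a b c e1 e2.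
have d : q1.1.1 - q2.1.1 != 0 by rewrite subr_eq0.
have hb : b = (q1.1.1 + q2.1.1) * a.
  apply: (mulfI d); apply/eqP; rewrite -subr_eq0; apply/eqP.
  transitivity ((q2.1.1 ^+ 2 * a - q2.1.1 * b + c) - (q1.1.1 ^+ 2 * a - q1.1.1 * b + c)).
    by ring.
  by rewrite e1 e2 subr0.
rewrite hb in e1 *; split; first by ring.
by apply/eqP; rewrite -subr_eq0 -e1; apply/eqP; ring.
Qed.

(** The linear polynomial [R1_ s + R0_] has two distinct roots at the common point, namely the two
    slopes. *)
Lemma meet_remainder q1 q2 t F :
  onl q1 F = 0 -> onl q2 F = 0 -> meet_at q1 q2 t ->
  (onl q1 (R1_ F)).[t] = 0 /\ (onl q1 (R0_ F)).[t] = 0.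
Proof.
move=> H1 H2 M.
have E q : onl q F = 0 -> (onl q (R1_ F)).[t] * q.1.1 + (onl q (R0_ F)).[t] = 0.
  move=> Hq; have Hd : onl q (dnull q.1.1 F) = 0 by rewrite -onl_deriv Hq derivC.
  have Hh : onl q (dnull q.1.1 (dnull q.1.1 F)) = 0 by rewrite -onl_deriv Hd derivC.
  have := congr1 (onl q) (remainder_identity q.1.1 F).
  rewrite onlM Hh mulr0 onlD onlM Hd mul0r add0r onlD onlM onl_cst => EE.
  by have := congr1 (fun P : {poly K} => P.[t]) EE; rewrite /= !hornerE => <-.
have := E _ H2; have := E _ H1; rewrite -!(onl_meet _ M); case: M => s12 _ _.
move: (onl q1 (R1_ F)).[t] (onl q1 (R0_ F)).[t] => a b e1 e2.
have a0 : a = 0.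
  have d : q1.1.1 - q2.1.1 != 0 by rewrite subr_eq0.
  apply: (mulfI d); rewrite mulr0 -[RHS](subrr 0) -{1}e1 -e2; ring.
by move: e1; rewrite a0 mul0r add0r.
Qed.

(** For a line of slope S' that meets [q], of slope S, at height t, all three coordinates are affine
    in S' - S and (S' - S) t. The hypothesis is one affine equation between these two quantities,
    and cuts a line out of a plane. *)
Lemma meet_collinear (c b : K) q q1 q2 q3 (t1 t2 t3 : K) :
  meet_at q q1 t1 -> meet_at q q2 t2 -> meet_at q q3 t3 ->
  (c * t1 + b) * (q1.1.1 - q.1.1) = 1 -> (c * t2 + b) * (q2.1.1 - q.1.1) = 1 ->
  (c * t3 + b) * (q3.1.1 - q.1.1) = 1 -> collinear q1 q2 q3.
Proof.
have P q' t : meet_at q q' t ->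
    q'.2 = q.2 + (q'.1.1 - q.1.1) * t /\
    q'.1.2 = q.1.2 + (q'.1.1 - q.1.1) * q.2 - q.1.1 * ((q'.1.1 - q.1.1) * t).
  move=> [_]; rewrite /nly /nlx !hornerE /= => hy hx.
  have h2 : q'.2 = q.2 + (q'.1.1 - q.1.1) * t.
    by apply/eqP; rewrite -subr_eq0; apply/eqP; transitivity ((q'.2 - q'.1.1 * t) - (q.2 - q.1.1 * t)); [ring | rewrite hx subrr].
  split=> //; rewrite h2 in hy.
  apply/eqP; rewrite -subr_eq0; apply/eqP.
  transitivity ((q'.1.2 - q'.1.1 * (q.2 + (q'.1.1 - q.1.1) * t) + q'.1.1 ^+ 2 * t)
    - (q.1.2 - q.1.1 * q.2 + q.1.1 ^+ 2 * t)); [ring | by rewrite hy subrr].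
move=> /P[a1 b1] /P[a2 b2] /P[a3 b3].
move: b1 b2 b3; rewrite /collinear a1 a2 a3 => -> -> ->.
set S := q.1.1; set S1 := q1.1.1; set S2 := q2.1.1; set S3 := q3.1.1 => e1 e2 e3.
have e r t : (c * t + b) * r = 1 -> c * (r * t) + b * r = 1 by move=> <-; ring.
have := e _ _ e3; have := e _ _ e2; have := e _ _ e1 => {e1 e2 e3} e1 e2 e3.
move: e1 e2 e3; move: (_ * t1) (_ * t2) (_ * t3) => v1 v2 v3 e1 e2 e3.
have D : (S2 - S1) * (v3 - v1) - (S3 - S1) * (v2 - v1) = 0.
  have [c0|c0] := eqVneq c 0.
    rewrite c0 !mul0r !add0r in e1 e2 e3.
    have b0 : b != 0.
      by apply: contra_eq_neq e1 => ->; rewrite mul0r eq_sym oner_eq0.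
    have E21 : S2 = S1 by apply: (addIr (- S)); apply: (mulfI b0); rewrite e1 e2.
    have E31 : S3 = S1 by apply: (addIr (- S)); apply: (mulfI b0); rewrite e1 e3.
    by rewrite E21 E31 subrr !mul0r subrr.
  have cv x y Sx Sy : c * x + b * (Sx - S) = 1 -> c * y + b * (Sy - S) = 1 ->
      c * (y - x) = - (b * (Sy - Sx)).
    move=> h1 h2; apply/eqP; rewrite -subr_eq0; apply/eqP.
    transitivity ((c * y + b * (Sy - S)) - (c * x + b * (Sx - S))); first by ring.
    by rewrite h1 h2 subrr.
  apply: (mulfI c0); rewrite mulr0.
  transitivity ((S2 - S1) * (c * (v3 - v1)) - (S3 - S1) * (c * (v2 - v1))); first by ring.
  by rewrite (cv _ _ _ _ e1 e2) (cv _ _ _ _ e1 e3); ring.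
split; apply/eqP; rewrite -subr_eq0; apply/eqP.
- by rewrite -[RHS](mulr0 (- S)) -D; ring.
- by rewrite -[RHS]D; ring.
- by rewrite -[RHS](mulr0 q.2) -D; ring.
Qed.

End NullLines.

Section Degree.

Variable K : fieldType.
Local Notation T3 := {poly {poly {poly K}}}.
Implicit Types F G : T3.

Definition cycle_vars F : T3 := swapXY (map_poly swapXY F).

Lemma coef_cycle_vars F i j k : (cycle_vars F)`_i`_j`_k = F`_j`_k`_i.
Proof. by rewrite /cycle_vars coef_swapXY coef_map /= coef_swapXY. Qed.

(** Sum of the degrees in the three variables. It is additive on products and, among nonzero
    polynomials, zero only for units, so it can drive an induction over factorisations. *)
Definition deg3 F : nat :=
  ((size F).-1 + (size (swapXY F)).-1 + (size (cycle_vars F)).-1)%N.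

Lemma tri_deg3 F :
  tri (size F).-1 (size (swapXY F)).-1 (size (cycle_vars F)).-1 F.
Proof.
have le n (P : {poly {poly {poly K}}}) : ((size P).-1 < n -> size P <= n)%N by lia.
move=> i j k /orP[/orP[]|] /le H.
- by rewrite (nth_default _ H) !coef0.
- by rewrite -[F`_i`_j]coef_swapXY (nth_default _ H) !coef0.
- by rewrite -coef_cycle_vars (nth_default _ H) !coef0.
Qed.

Lemma deg3M F G : F != 0 -> G != 0 -> deg3 (F * G) = (deg3 F + deg3 G)%N.
Proof.
move=> F0 G0; rewrite /deg3 /cycle_vars !rmorphM.
have cv0 H : H != 0 -> map_poly swapXY H != 0 :> T3.
  by move=> H0; rewrite map_poly_eq0_id0 // swapXY_eq0 lead_coef_eq0.
have sz (P Q : {poly {poly {poly K}}}) : P != 0 -> Q != 0 ->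
    ((size (P * Q)%R).-1 = (size P).-1 + (size Q).-1)%N.
  by move=> P0 Q0; rewrite size_mul // polySpred // [size Q]polySpred //; lia.
have L (a b c d e f : nat) : ((a + b) + (c + d) + (e + f) = (a + c + e) + (b + d + f))%N.
  by lia.
by rewrite /= !sz ?swapXY_eq0 ?cv0 // L.
Qed.

Lemma deg3_eq0_unit F : F != 0 -> deg3 F = 0%N -> F \is a GRing.unit.
Proof.
move=> F0 d0; have H : tri 0 0 0 F.
  by move: d0 (@tri_deg3 F); rewrite /deg3; move: (_.-1) (_.-1) (_.-1) => [|?] [|?] [|?].
have EF : F = (F`_0`_0`_0)%:P%:P%:P.
  apply/polyP => i; apply/polyP => j; apply/polyP => k.
  rewrite coefC; case: i => [|i] /=; last by rewrite H // !coef0.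
  rewrite coefC; case: j => [|j] /=; last by rewrite H // !coef0.
  by rewrite coefC; case: k => [|k] //=; rewrite H.
rewrite EF !rmorph_unit // unitfE; apply: contraNneq F0 => c0.
by rewrite EF c0 !polyC0.
Qed.

End Degree.

(** * Lines with many neighbours on an irreducible surface *)

Section Family.

Variables (K : fieldType) (p : nat).
Hypothesis charK : forall n, (0 < n < p)%N -> n%:R != 0 :> K.
Local Notation T3 := {poly {poly {poly K}}}.

Variables (I : finType) (q : I -> K * K * K) (E : rel I) (par : I -> I -> K) (k : nat).
Hypothesis Esym : symmetric E.
Hypothesis Emeet : forall i j, E i j -> meet_at (q i) (q j) (par i j).
(** Neighbours of a line meet it at different points, so they can be counted as zeros of a
    polynomial on that line. *)
Hypothesis Einj : forall i j j', E i j -> E i j' -> par i j = par i j' -> j = j'.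
Hypothesis nly_inj : injective (fun i => nly (q i)).
Hypothesis few_collinear : forall (i : I) (Q : {set I}),
  (forall j, j \in Q -> E i j) ->
  (forall j1 j2 j3, j1 \in Q -> j2 \in Q -> j3 \in Q -> collinear (q j1) (q j2) (q j3)) ->
  (#|Q| <= k)%N.

Definition nbr i (L : {set I}) : {set I} := [set j in L | E i j].

Lemma roots_nbr i (J : {set I}) (P : {poly K}) :
  P != 0 -> (forall j, j \in J -> E i j /\ P.[par i j] = 0) -> (#|J| < size P)%N.
Proof.
move=> P0 H; have -> : #|J| = size [seq par i j | j <- enum J] by rewrite size_map cardE.
apply: max_poly_roots => //.
  apply/allP => x /mapP[j]; rewrite mem_enum => /H[_ Hj] ->.
  by rewrite /root Hj.
rewrite map_inj_in_uniq ?enum_uniq // => j j'; rewrite !mem_enum => /H[Ej _] /H[Ej' _].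
exact: Einj.
Qed.

Lemma nbr_vanish i (L : {set I}) (G : T3) (n : nat) :
  (size (onl (q i) G) <= n)%N -> (n <= #|nbr i L|)%N ->
  (forall j, j \in L -> E i j -> (onl (q i) G).[par i j] = 0) -> onl (q i) G = 0.
Proof.
move=> sG nb H; apply/eqP; apply: contraT => G0.
have := @roots_nbr i (nbr i L) _ G0 _; rewrite ltnNge (leq_trans sG nb).
by apply=> j; rewrite inE => /andP[jL Eij]; rewrite Eij H.
Qed.

(** Let m = [deg3 F] and suppose that more than 2 (4m)^2 lines are rich. [R1_] and [R0_], of degree
    at most 4m, vanish at more than 4m points of each, so F divides both by elimination and
    [null_line_ode] applies. On a rich line where [A_] is not identically zero, all neighbours away
    from its at most m zeros are then collinear, and there are more than k of them. *)
Lemma prime_surface_rich_lines (F : T3) (L : {set I}) :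
  prime_elt F -> (2 * deg3 F < p)%N -> (forall i, i \in L -> onl (q i) F = 0) ->
  (#|[set i in L | 5 * deg3 F + k < #|nbr i L|]| <= 32 * deg3 F ^ 2)%N.
Proof.
move=> Fp mp HL; set m := deg3 F in mp *; set X := [set i in L | _].
rewrite leqNgt; apply/negP => bigX.
have [F0 Fu _] := Fp.
have HF := @tri_deg3 _ F.
have m0 : (0 < m)%N.
  by rewrite lt0n; apply: contra Fu => /eqP; apply: deg3_eq0_unit.
move: HF; set a := (size F).-1; set b := (size (swapXY F)).-1; set c := (size (cycle_vars F)).-1.
move=> HF; have Em : m = (a + b + c)%N by [].
have [tR1 tR0] := tri_rem HF.
have XL i : i \in X -> i \in L by rewrite inE => /andP[].
have Xn i : i \in X -> (5 * m + k < #|nbr i L|)%N by rewrite inE => /andP[].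
have divides (G : T3) : tri (4 * a) (4 * b) (4 * c) G ->
    (forall i, i \in X -> onl (q i) G = 0) -> dvdr F G.
  move=> tG HG; apply: NNPP => nd.
  have := @common_lines _ F G (4 * m) _ X (fun i => nly (q i)) (fun i => nlx (q i)) Fp nd.
  move=> H; have : (#|X| <= 2 * (4 * m) * (4 * m))%N.
    apply: H.
    - by have := tri_size HF; rewrite Em; move: (size _) => x; lia.
    - by have := tri_size tG; rewrite Em; move: (size _) => x; lia.
    - by have := tri_sizeY HF; rewrite Em; move: (sizeY _) => x; lia.
    - by have := tri_sizeY tG; rewrite Em; move: (sizeY _) => x; lia.
    - by move=> i j _ _; apply: nly_inj.
    - by move=> i iX; split; [apply: HL; apply: XL | apply: HG].
  by move: bigX; rewrite expnS expn1; nia.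
have tri4 G : tri a b c G -> tri (4 * a) (4 * b) (4 * c) G.
  by move=> tG i j l H; apply: tG; move: H; lia.
have meets i j : i \in X -> j \in L -> E i j ->
    [/\ onl (q i) F = 0, onl (q j) F = 0 & meet_at (q i) (q j) (par i j)].
  by move=> iX jL Eij; split; [apply: HL; apply: XL | apply: HL | apply: Emeet].
have big4 i : i \in X -> ((4 * m).+1 <= #|nbr i L|)%N by move/Xn; lia.
have sz4 i G : tri (4 * a) (4 * b) (4 * c) G -> (size (onl (q i) G) <= (4 * m).+1)%N.
  by move=> tG; have := size_onl (q i) tG; rewrite Em; move: (size _) => x; lia.
have dR1 : dvdr F (R1_ F).
  apply: divides => // i iX; apply: (nbr_vanish (sz4 i _ tR1) (big4 i iX)) => j jL Eij.
  by have [h1 h2 M] := meets i j iX jL Eij; case: (meet_remainder h1 h2 M).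
have dR0 : dvdr F (R0_ F).
  apply: divides => // i iX; apply: (nbr_vanish (sz4 i _ tR0) (big4 i iX)) => j jL Eij.
  by have [h1 h2 M] := meets i j iX jL Eij; case: (meet_remainder h1 h2 M).
(* If F divided [A_], then [A_] = 0 by degree, so by Vieta [B_] and [C_] vanish at every meeting
   point; F divides them as well, they are zero, and F is constant because its degree is below p. *)
have ndA : ~ dvdr F (A_ F).
  move=> /dvdr_dy A0.
  have grad i j : i \in X -> j \in L -> E i j ->
      (onl (q i) (B_ F)).[par i j] = 0 /\ (onl (q i) (C_ F)).[par i j] = 0.
    move=> iX jL Eij; have [h1 h2 M] := meets i j iX jL Eij.
    have [] := meet_gradient h1 h2 M; rewrite /A_ A0 rmorph0 horner0 !mulr0 subr0 mul0r.
    by [].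
  have dB : dvdr F (B_ F).
    have tB : tri (4 * a) (4 * b) (4 * c) (B_ F) by apply: tri4; apply: tri_dx.
    apply: divides => // i iX; apply: (nbr_vanish (sz4 i _ tB) (big4 i iX)) => j jL Eij.
    by case: (grad i j iX jL Eij).
  have dC : dvdr F (C_ F).
    have tC : tri (4 * a) (4 * b) (4 * c) (C_ F) by apply: tri4; apply: tri_dz.
    apply: divides => // i iX; apply: (nbr_vanish (sz4 i _ tC) (big4 i iX)) => j jL Eij.
    by case: (grad i j iX jL Eij).
  have EF : F = (F`_0`_0`_0)%:P%:P%:P.
    apply: (derivatives_eq0 charK HF); try (by move: mp Em; clear; lia).
    - exact: dvdr_dx dB.
    - exact: A0.
    - exact: dvdr_dz dC.
  case/negP: Fu; rewrite EF !rmorph_unit // unitfE; apply: contraNneq F0 => c0.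
  by rewrite EF c0 !polyC0.
have [i iX fi0] : exists2 i, i \in X & onl (q i) (A_ F) != 0.
  apply: NNPP => N; apply: ndA; apply: divides.
    by apply: tri4; apply: tri_dy.
  by move=> i iX; apply/eqP; apply: contra_notT N => ?; exists i.
have [E1 HE1] := dR1; have [E0 HE0] := dR0.
have ode := null_line_ode (HL i (XL i iX)) HE0 HE1 fi0.
set f := onl (q i) (A_ F) in fi0 ode; set g := onl (q i) (B_ F) - _ in ode.
have sf : (size f <= m.+1)%N by apply: size_onl; apply: tri_dy.
have sB : (size (onl (q i) (B_ F)) <= m.+1)%N by apply: size_onl; apply: tri_dx.
have sg : (size g <= m.+1)%N.
  apply: leq_trans (size_polyD _ _) _; rewrite size_polyN geq_max sB /=.
  have -> : 2 * (q i).1.1%:P * f = (2 * (q i).1.1) *: f.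
    by rewrite -mul_polyC polyCM polyC_natr.
  exact: leq_trans (size_scale_leq _ _) sf.
(* At a zero of [f] the polynomial [g] vanishes too, and the ratio says nothing about the slope of
   the neighbour. *)
set J := [set j in nbr i L | f.[par i j] != 0].
have JE j : j \in J -> [/\ j \in L, E i j & f.[par i j] != 0].
  by rewrite !inE => /andP[/andP[]].
have bigJ : (k < #|J|)%N.
  have : (#|nbr i L :\: J| < size f)%N.
    apply: (@roots_nbr i _ f fi0) => j; rewrite !inE => /andP[+ /andP[jL Eij]].
    by rewrite jL Eij /= negbK => /eqP.
  have := cardsID J (nbr i L); have -> : nbr i L :&: J = J.
    by apply/setIidPr/subsetP => j; rewrite inE => /andP[].
  by have := Xn i iX; move: sf; move: (size f) #|_ :\: _| #|J| #|_| => x y z w; clear; lia.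
have gat j : j \in J -> g.[par i j] = f.[par i j] * ((q j).1.1 - (q i).1.1).
  move=> /JE[jL Eij _]; have [h1 h2 M] := meets i j iX jL Eij.
  have [<- _] := meet_gradient h1 h2 M.
  by rewrite /g !hornerE. 
have g0 : g != 0.
  have [j jJ] : exists j, j \in J by apply/set0Pn; rewrite -card_gt0; case: #|J| bigJ.
  apply: contra_eq_neq (gat j jJ) => ->; rewrite horner0 eq_sym mulf_neq0 //.
    by case: (JE j jJ).
  by have [jL Eij _] := JE j jJ; have [+ _ _] := Emeet Eij; rewrite eq_sym subr_eq0.
have [cc [bb Ef]] := ratio_linear charK m0 mp sf sg g0 ode.
have lin j : j \in J -> (cc * par i j + bb) * ((q j).1.1 - (q i).1.1) = 1.
  move=> jJ; have [_ _ fj] := JE j jJ; apply: (mulfI fj); rewrite mulr1.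
  by rewrite mulrCA -gat // [in RHS]Ef !hornerE.
have : (#|J| <= k)%N.
  apply: (@few_collinear i) => [j /JE[]//|j1 j2 j3 h1 h2 h3].
  apply: (@meet_collinear _ cc bb (q i) _ _ _ (par i j1) (par i j2) (par i j3)) => //;
  by [apply: Emeet; case: (JE _ h1) | apply: Emeet; case: (JE _ h2)
     | apply: Emeet; case: (JE _ h3) | exact: lin].
by rewrite leqNgt bigJ.
Qed.

End Family.

(** * Surfaces through given lines *)

Section Interpolation.

Variable K : fieldType.
Local Notation T3 := {poly {poly {poly K}}}.

Lemma linear_kernel (n m : nat) (f : 'rV[K]_n -> 'rV[K]_m) :
  (forall a u v, f (a *: u + v) = a *: f u + f v) -> (m < n)%N ->
  exists2 v, v != 0 & f v = 0.
Proof.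
move=> lf mn.
pose g : {linear 'rV[K]_n -> 'rV[K]_m} :=
  HB.pack f (GRing.isLinear.Build _ _ _ _ f lf).
have : kermx (lin1_mx g) != 0.
  rewrite -mxrank_eq0 mxrank_ker subn_eq0 -ltnNge.
  by apply: leq_ltn_trans (rank_leq_col _) mn.
move=> /rowV0Pn[v /sub_kermxP H v0]; exists v => //.
by rewrite mul_rV_lin1 in H.
Qed.

(** There are (D+1)^3 coefficients, and each line imposes 3D+1 linear conditions because the
    restriction to it has degree at most 3D. *)
Lemma surface_through_lines (I : finType) (q : I -> K * K * K) (M : {set I}) (D : nat) :
  (3 * #|M| <= D.+1 ^ 2)%N ->
  exists F : T3, [/\ F != 0, (deg3 F <= 3 * D)%N
    & forall i, i \in M -> onl (q i) F = 0].
Proof.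
move=> HM.
pose T := ('I_D.+1 * 'I_D.+1 * 'I_D.+1)%type.
pose U := ({i | i \in M} * 'I_(3 * D).+1)%type.
pose P (v : 'rV[K]_#|{: T}|) : T3 := \poly_(a < D.+1) \poly_(b < D.+1) \poly_(c < D.+1)
  v 0 (enum_rank (inord a, inord b, inord c)).
have PE v i j l : (P v)`_i`_j`_l = if (i < D.+1)%N then if (j < D.+1)%N then
    if (l < D.+1)%N then v 0 (enum_rank (inord i, inord j, inord l)) else 0 else 0 else 0.
  rewrite coef_poly; case: ifP => _; last by rewrite !coef0.
  rewrite coef_poly; case: ifP => _; last by rewrite !coef0.
  by rewrite coef_poly.
have Plin a u v : P (a *: u + v) = cst a * P u + P v.
  apply/polyP => i; apply/polyP => j; apply/polyP => l.
  rewrite !coefD !coefCM !PE.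
  by case: ifP => _; [case: ifP => _; [case: ifP => _|]|]; rewrite ?mxE ?mulr0 ?addr0.
pose f (v : 'rV[K]_#|{: T}|) : 'rV[K]_#|{: U}| :=
  \row_(u < #|{: U}|) (onl (q (val (enum_val u : U).1)) (P v))`_((enum_val u : U).2 : 'I__).
have [||v v0 fv] := @linear_kernel _ _ f.
- move=> a u v; apply/rowP => x; rewrite !mxE Plin onlD onlM onl_cst.
  by rewrite coefD coefCM.
- rewrite !card_prod !card_ord card_sig.
  have -> : #|[pred x | x \in M]| = #|M| by apply: eq_card.
  by move: HM; rewrite expnS expn1; move: #|M| => m; clear; nia.
have tP : tri D D D (P v).
  move=> i j l H; rewrite PE; case: ifP => // h1; case: ifP => // h2; case: ifP => // h3.
  by move: H h1 h2 h3; clear; lia.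
exists (P v); split.
- apply: contraNneq v0 => P0; apply/eqP/rowP => x; rewrite [RHS]mxE.
  have := PE v (enum_val x : T).1.1 (enum_val x : T).1.2 (enum_val x : T).2.
  rewrite P0 !coef0 !ltn_ord !inord_val => /esym.
  by rewrite -!surjective_pairing enum_valK.
- have h (n : nat) (R : nzRingType) (G : {poly R}) : (size G <= n.+1 -> (size G).-1 <= n)%N.
    by lia.
  rewrite /deg3 mulSn mulSn mul1n addnA !leq_add // h //.
  + exact: tri_size tP.
  + by rewrite -sizeYE; exact: tri_sizeY tP.
  + apply/leq_sizeP => i Hi; apply/polyP => j; apply/polyP => l.
    by rewrite coef_cycle_vars !coef0 tP // Hi orbT.
- move=> i iM; apply/polyP => l; rewrite coef0.
  have [Hl|Hl] := ltnP l (3 * D).+1; last first.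
    rewrite nth_default //; apply: leq_trans (size_onl _ tP) _.
    by move: Hl; clear; lia.
  have := congr1 (fun w : 'rV[K]_#|{: U}| => w 0 (enum_rank (exist _ i iM, Ordinal Hl))) fv.
  by rewrite !mxE enum_rankK.
Qed.

End Interpolation.

Lemma Posz_exp (a n : nat) : (a ^ n)%:Z = a%:Z ^+ n.
Proof. by elim: n => // n IH; rewrite expnS PoszM IH exprS. Qed.

(** * Second moment of a random sample *)

Section Sampling.

Variables (I : finType) (r : nat).
Hypothesis r0 : (0 < r)%N.
Local Notation T := {ffun I -> 'I_r}.
Let z0 : 'I_r := Ordinal r0.
(** r times the centred indicator of being sampled, an event of probability 1/r. Sums over all
    functions replace expectations, which keeps everything in the integers. *)
Let y (x : 'I_r) : int := if x == z0 then (r%:Z - 1) else - 1.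

Lemma sum_hit : \sum_x y x = 0.
Proof.
rewrite (bigD1 z0) //= /y eqxx (eq_bigr (fun=> - 1)); last by move=> x /negPf->.
rewrite sumr_const -[(#|_|)]/(#|[pred x | x != z0]|).
have -> : #|[pred x : 'I_r | x != z0]| = r.-1.
  by have := cardC1 z0; rewrite card_ord => <-; apply: eq_card.
by case: (r) r0 => // n _ /=; rewrite mulNrn -natz; lia.
Qed.

Lemma sum_hit2 : \sum_x y x ^+ 2 = r%:Z * (r%:Z - 1).
Proof.
rewrite (bigD1 z0) //= /y eqxx (eq_bigr (fun=> 1)); last by move=> x /negPf->; rewrite sqrrN expr1n.
rewrite sumr_const -[(#|_|)]/(#|[pred x | x != z0]|).
have -> : #|[pred x : 'I_r | x != z0]| = r.-1.
  by have := cardC1 z0; rewrite card_ord => <-; apply: eq_card.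
by case: (r) r0 => // n _ /=; rewrite natz; nia.
Qed.

Lemma sum_pair (j j' : I) :
  \sum_(f : T) y (f j) * y (f j') = if j == j' then (r ^ #|I|)%:Z * (r%:Z - 1) else 0.
Proof.
pose G (i : I) (x : 'I_r) : int := (if i == j then y x else 1) * (if i == j' then y x else 1).
have -> : \sum_(f : T) y (f j) * y (f j') = \sum_(f : T) \prod_i G i (f i).
  apply: eq_bigr => f _; rewrite /G big_split /=; congr (_ * _);
  by rewrite -big_mkcond /= big_pred1_eq.
rewrite -(bigA_distr_bigA G) /=; case: (eqVneq j j') => [E|jj'].
  subst j'.
  rewrite (bigD1 j) //= {1}/G eqxx.
  have -> : \sum_x y x * y x = r%:Z * (r%:Z - 1) by rewrite -sum_hit2; apply: eq_bigr => x _; rewrite expr2.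
  rewrite (eq_bigr (fun=> r%:Z)); last first.
    move=> i /negPf ij; rewrite /G ij (eq_bigr (fun=> 1)); last by move=> x _; rewrite mulr1.
    by rewrite sumr_const card_ord natz.
  rewrite prodr_const -[(#|_|)]/(#|[pred x | x != j]|).
  have -> : #|[pred x | x != j]| = #|I|.-1 by rewrite -(cardC1 j); apply: eq_card.
  have I0 : (0 < #|I|)%N by apply/card_gt0P; exists j.
  rewrite -[in RHS](prednK I0) expnS PoszM Posz_exp.
  by move: (r%:Z) (_ ^+ _) => a b; ring.
rewrite (bigD1 j) //= {1}/G eqxx (negPf jj').
rewrite (eq_bigr y); last by move=> x _; rewrite mulr1.
by rewrite sum_hit mul0r.
Qed.

Definition excess (S : {set I}) (f : T) : int := \sum_(j in S) y (f j).

Lemma excess_card (S : {set I}) (f : T) :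
  excess S f = (r * #|[set j in S | f j == z0]|)%:Z - #|S|%:Z.
Proof.
rewrite /excess (eq_bigr (fun j => r%:Z * (f j == z0)%:Z - 1)); last first.
  by move=> j _; rewrite /y; case: eqP => _; rewrite ?mulr1 ?mulr0 ?sub0r.
rewrite sumrB -mulr_sumr sumr_const natz PoszM; congr (_ * _ - _).
rewrite -sum1_card (eq_bigr (fun j => (if f j == z0 then 1 else 0) : int)); last first.
  by move=> j _; case: eqP.
by rewrite -big_mkcondr /= -[RHS]natz natr_sum; apply: eq_bigl => j; rewrite inE.
Qed.

Lemma sum_excess (S : {set I}) : \sum_f excess S f = 0.
Proof.
rewrite /excess exchange_big big1 //= => j _.
have -> : \sum_(f : T) y (f j) = \sum_(f : T) \prod_i (if i == j then y (f i) else 1).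
  by apply: eq_bigr => f _; rewrite -big_mkcond /= big_pred1_eq.
rewrite -(bigA_distr_bigA (fun i x => if i == j then y x else 1)) /= (bigD1 j) //= eqxx.
by rewrite sum_hit mul0r.
Qed.

Lemma sum_excess2 (S : {set I}) :
  \sum_f excess S f ^+ 2 = (#|S| * r ^ #|I|)%:Z * (r%:Z - 1).
Proof.
transitivity (\sum_(j in S) \sum_(j' in S) \sum_(f : T) y (f j) * y (f j')).
  under eq_bigr => f _ do rewrite expr2 /excess big_distrlr /=.
  by rewrite exchange_big /=; apply: eq_bigr => j _; rewrite exchange_big.
rewrite (eq_bigr (fun=> (r ^ #|I|)%:Z * (r%:Z - 1))); last first.
  move=> j jS; rewrite (bigD1 j) //= sum_pair eqxx big1 ?addr0 // => j' /andP[_ /negPf jj'].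
  by rewrite sum_pair eq_sym jj'.
by rewrite sumr_const PoszM -mulr_natl natz mulrA.
Qed.

End Sampling.

(** Chebyshev's inequality: if a vertex of degree d >= Q is bad, its [excess] is at most -d/2, which
    happens with probability at most 4r/d <= 1/16. *)
Lemma sampling (I : finType) (E : rel I) (L : {set I}) (r Q : nat) :
  (0 < r)%N -> (64 * r <= Q)%N -> (0 < #|L|)%N ->
  (forall i, i \in L -> Q <= #|nbr E i L|)%N ->
  exists M : {set I}, [/\ M \subset L, (r * #|M| <= 4 * #|L|)%N &
    (#|L| <= 2 * #|[set i in L | (Q <= 2 * r * #|nbr E i M|)%N]|)%N].
Proof.
move=> r0 rQ L0 HQ; pose z0 : 'I_r := Ordinal r0.
pose T := {ffun I -> 'I_r}; pose N := (r ^ #|I|)%N.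
have cT : #|{: T}| = N by rewrite card_ffun card_ord.
pose M (f : T) : {set I} := [set j in L | f j == z0].
pose bad (f : T) i := ~~ (Q <= 2 * r * #|nbr E i (M f)|)%N.
have N0 : (0 < N)%N by rewrite expn_gt0 r0.
have sM : (\sum_(f : T) r * #|M f| = #|L| * N)%N.
  have := sum_excess r0 L; rewrite (eq_bigr _ (fun f _ => excess_card r0 L f)) sumrB.
  rewrite sumr_const cT => /eqP; rewrite subr_eq0 => /eqP e.
  have : ((\sum_(f : T) r * #|M f|)%N)%:Z = (#|L| * N)%N%:Z.
    by rewrite (big_morph Posz PoszD (erefl _)) e PoszM -mulr_natr natz.
  by case.
have sbad i : i \in L -> (16 * \sum_(f : T) bad f i <= N)%N.
  move=> iL; set d := #|nbr E i L|; have dQ : (Q <= d)%N by exact: HQ.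
  have nM f : nbr E i (M f) = [set j in nbr E i L | f j == z0].
    by apply/setP => j; rewrite !inE andbAC.
  have pt (f : T) : ((d * d * bad f i)%N)%:Z <= 4 * excess r0 (nbr E i L) f ^+ 2.
    rewrite /bad nM excess_card -/z0 -/d; case: leqP => /= h.
      by rewrite muln0; have := sqr_ge0 ((r * #|[set j in nbr E i L | f j == z0]|)%N%:Z - d%:Z); lia.
    rewrite muln1; move: h dQ; move: #|[set j in nbr E i L | f j == z0]| => x h dQ.
    have : (2 * (r * x) <= d)%N by nia.
    by move: (r * x)%N => u hu; nia.
  have : \sum_(f : T) (((d * d * bad f i)%N)%:Z) <= \sum_(f : T) 4 * excess r0 (nbr E i L) f ^+ 2.
    by apply: ler_sum => f _; exact: pt.
  rewrite -mulr_sumr sum_excess2 -/d -/N.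
  have -> : \sum_(f : T) (((d * d * bad f i)%N)%:Z) = (d * d * \sum_(f : T) bad f i)%N%:Z.
    by rewrite big_distrr (big_morph Posz PoszD (erefl _)).
  move: (\sum_f _)%N => b h.
  have {}h : (d * d * b <= 4 * (d * N) * (r - 1))%N by nia.
  have d0 : (0 < d)%N by lia.
  have {}h : (d * b <= 4 * N * (r - 1))%N by rewrite -(leq_pmul2l d0); nia.
  have : (64 * r * b <= 4 * N * r)%N by nia.
  by rewrite -(leq_pmul2l r0); nia.
have [f [h1 h2]] : exists f : T, (r * #|M f| <= 4 * #|L|)%N /\
    (#|L| <= 2 * #|[set i in L | (Q <= 2 * r * #|nbr E i (M f)|)%N]|)%N.
  apply: NNPP => Nf.
  (* Failure of either conclusion makes the right side at least 4|L|, while its mean over all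
     samples is at most 3|L|/2. *)
  have pt (f : T) : (4 * #|L| <= r * #|M f| + 8 * \sum_(i in L) bad f i)%N.
    rewrite leqNgt; apply/negP => lt; apply: Nf; exists f; split; first by lia.
    have : (\sum_(i in L) bad f i + #|[set i in L | (Q <= 2 * r * #|nbr E i (M f)|)%N]| = #|L|)%N.
      rewrite -!sum1_card big_mkcond /= [X in (_ + X)%N]big_mkcond [RHS]big_mkcond -big_split /=.
      apply: eq_bigr => i _; rewrite /bad inE; case: (i \in L) => //=.
      by case: (Q <= _)%N.
    by move: lt; lia.
  have : (\sum_(f : T) 4 * #|L| <= \sum_(f : T) (r * #|M f| + 8 * \sum_(i in L) bad f i))%N.
    by apply: leq_sum => f _; exact: pt.
  rewrite sum_nat_const cT big_split /= sM -big_distrr /= exchange_big /=.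
  have : (16 * \sum_(i in L) \sum_(f : T) bad f i <= #|L| * N)%N.
    by rewrite big_distrr /= -sum_nat_const; apply: leq_sum => i iL; exact: sbad.
  by move: (\sum_(i in L) _)%N => b; nia.
by exists (M f); split => //; apply/subsetP => i; rewrite inE => /andP[].
Qed.

Lemma setDUU_disjoint (I : finType) (A B X Y : {set I}) :
  X \subset A -> Y \subset B -> [disjoint A & B] ->
  (A :|: B) :\: (X :|: Y) = (A :\: X) :|: (B :\: Y).
Proof.
move=> /subsetP XA /subsetP YB /disjoint_setI0/setP dis; apply/setP => i.
have := dis i; have := YB i; have := XA i; rewrite !inE.
by case: (i \in X); case: (i \in Y); case: (i \in A); case: (i \in B) => //= h1 h2 _;
  first [by have := h1 isT | by have := h2 isT].
Qed.

(** * Counting meeting pairs of lines *)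

Section LineEdges.

Variables (K : fieldType) (p : nat).
Hypothesis charK : forall n, (0 < n < p)%N -> n%:R != 0 :> K.
Local Notation T3 := {poly {poly {poly K}}}.

Variables (I : finType) (q : I -> K * K * K) (E : rel I) (par : I -> I -> K) (k : nat).
Hypothesis Esym : symmetric E.
Hypothesis Emeet : forall i j, E i j -> meet_at (q i) (q j) (par i j).
Hypothesis Einj : forall i j j', E i j -> E i j' -> par i j = par i j' -> j = j'.
Hypothesis nly_inj : injective (fun i => nly (q i)).
Hypothesis few_collinear : forall (i : I) (Q : {set I}),
  (forall j, j \in Q -> E i j) ->
  (forall j1 j2 j3, j1 \in Q -> j2 \in Q -> j3 \in Q -> collinear (q j1) (q j2) (q j3)) ->
  (#|Q| <= k)%N.
Local Notation nbr := (nbr E).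

Lemma nbr_sum i (L : {set I}) : #|nbr i L| = (\sum_(j in L) E i j)%N.
Proof.
rewrite -sum1_card [RHS]big_mkcond [LHS]big_mkcond /=.
by apply: eq_bigr => j _; rewrite inE; case: (j \in L); case: (E i j).
Qed.

Lemma edges_sym (P Q : {set I}) :
  (\sum_(i in P) #|nbr i Q| = \sum_(j in Q) #|nbr j P|)%N.
Proof.
under eq_bigr => i _ do rewrite nbr_sum.
rewrite exchange_big /=; apply: eq_bigr => j _; rewrite nbr_sum.
by apply: eq_bigr => i _; rewrite Esym.
Qed.

Lemma nbrD i (P Q : {set I}) : (#|nbr i (P :|: Q)| <= #|nbr i P| + #|nbr i Q|)%N.
Proof.
have -> : nbr i (P :|: Q) = nbr i P :|: nbr i Q.
  by apply/setP => j; rewrite !inE andb_orl.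
by rewrite cardsU leq_subr.
Qed.

Lemma few_nbrs_on_surface (G : T3) (L : {set I}) j :
  (forall i, i \in L -> onl (q i) G = 0) -> onl (q j) G != 0 ->
  (#|nbr j L| <= deg3 G)%N.
Proof.
move=> HL G0; rewrite -ltnS; apply: leq_trans (size_onl (q j) (@tri_deg3 _ G)).
apply: (@roots_nbr _ _ _ _ Einj j _ _ G0) => i; rewrite inE => /andP[iL Eji]; split=> //.
by have := onl_meet G (Emeet Eji); rewrite (HL _ iL) horner0.
Qed.

(** Induction over the factorisations F = GH. Lines of L not on G lie on H, and each meets at most
    deg G of the lines on G. The bounds for the discarded sets add up because squares of degrees are
    superadditive, and the cross pairs, counted twice, are absorbed by the factor 5. *)
Lemma surface_lines (F : T3) (L : {set I}) :
  F != 0 -> (2 * deg3 F < p)%N -> (forall i, i \in L -> onl (q i) F = 0) ->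
  exists X : {set I}, [/\ X \subset L, (#|X| <= 32 * deg3 F ^ 2)%N
    & (\sum_(i in L :\: X) #|nbr i L| <= (5 * deg3 F + k) * #|L|)%N].
Proof.
have [n] := ubnP (deg3 F); elim: n F L => // n IH F L; rewrite ltnS => ltn F0 ltp HL.
have facT : factorial_ring T3 by do 3!apply: factorial_poly; apply: factorial_field.
have [Fu|Fu] := boolP (F \is a GRing.unit).
  have L0 : L = set0.
    apply/eqP/set0Pn => -[i /HL H].
    have := congr1 (onl (q i)) (divrr Fu); rewrite onlM H mul0r.
    have -> : onl (q i) 1 = 1 by exact: rmorph1.
    by move/eqP; rewrite eq_sym oner_eq0.
  by exists set0; rewrite L0 setD0 big_set0 cards0.
have [Fp|[G [H [EF Gu Hu]]]] := factorial_split facT F0 Fu.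
  exists [set i in L | (5 * deg3 F + k < #|nbr i L|)%N]; split.
  - by apply/subsetP => i; rewrite inE => /andP[].
  - exact: (prime_surface_rich_lines charK Emeet Einj nly_inj few_collinear Fp ltp HL).
  - rewrite [leqRHS]mulnC -sum_nat_const big_mkcond [leqRHS]big_mkcond; apply: leq_sum => i _.
    by rewrite !inE; case: (i \in L); rewrite ?andbF //= -leqNgt andbT; case: ifP.
have [G0 H0] : G != 0 /\ H != 0 by move: F0; rewrite EF mulf_eq0 negb_or => /andP.
have dF : deg3 F = (deg3 G + deg3 H)%N by rewrite EF deg3M.
have dG : (0 < deg3 G)%N by rewrite lt0n; apply: contra Gu => /eqP; apply: deg3_eq0_unit.
have dH : (0 < deg3 H)%N by rewrite lt0n; apply: contra Hu => /eqP; apply: deg3_eq0_unit.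
pose L1 := [set i in L | onl (q i) G == 0]; pose L2 := L :\: L1.
have [||||X1 [sX1 cX1 eX1]] := IH G L1 => //; [lia|lia|by move=> i; rewrite inE => /andP[_ /eqP]|].
have [||||X2 [sX2 cX2 eX2]] := IH H L2 => //; [lia|lia| |].
  move=> i; rewrite !inE => /andP[+ iL]; rewrite iL /= => Gi.
  have := HL i iL; rewrite EF onlM => /eqP; rewrite mulf_eq0 (negPf Gi) /=.
  by move/eqP.
have EL : L = L1 :|: L2.
  by apply/setP => i; rewrite !inE; case: (i \in L) => //=; case: eqP.
have dis : [disjoint L1 & L2] by rewrite -setI_eq0; apply/eqP/setP => i; rewrite !inE; case: (i \in L); case: eqP.
exists (X1 :|: X2); split.
- by rewrite EL setUSS.
- apply: leq_trans (leq_card_setU _ _) _; rewrite dF sqrnD.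
  by move: cX1 cX2; clear; lia.
have cross : (\sum_(i in L2) #|nbr i L1| <= deg3 G * #|L2|)%N.
  rewrite [leqRHS]mulnC -sum_nat_const; apply: leq_sum => i; rewrite !inE => /andP[+ iL].
  rewrite iL /= => Gi; apply: few_nbrs_on_surface => // j.
  by rewrite inE => /andP[_ /eqP].
have cL : #|L| = (#|L1| + #|L2|)%N by rewrite EL cardsU disjoint_setI0 // cards0 subn0.
have -> : L :\: (X1 :|: X2) = (L1 :\: X1) :|: (L2 :\: X2).
  by rewrite EL; apply: setDUU_disjoint.
rewrite (eq_bigl (mem [predU (L1 :\: X1) & (L2 :\: X2)])); last by move=> i; rewrite !inE.
rewrite bigU /=; last exact: disjointWl (subsetDl L1 X1) (disjointWr (subsetDl L2 X2) dis).
have b1 : (\sum_(i in L1 :\: X1) #|nbr i L| <= \sum_(i in L1 :\: X1) #|nbr i L1| + deg3 G * #|L2|)%N.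
  apply: (@leq_trans (\sum_(i in L1 :\: X1) #|nbr i L1| + \sum_(i in L1 :\: X1) #|nbr i L2|)%N).
    by rewrite -big_split /=; apply: leq_sum => i _; rewrite EL nbrD.
  rewrite leq_add2l (leq_trans _ cross) // [leqRHS](edges_sym L2 L1).
  by rewrite [leqRHS](big_setID X1) /= (setIidPr sX1) leq_addl.
have b2 : (\sum_(i in L2 :\: X2) #|nbr i L| <= \sum_(i in L2 :\: X2) #|nbr i L2| + deg3 G * #|L2|)%N.
  apply: (@leq_trans (\sum_(i in L2 :\: X2) #|nbr i L2| + \sum_(i in L2 :\: X2) #|nbr i L1|)%N).
    by rewrite -big_split /=; apply: leq_sum => i _; rewrite EL setUC nbrD.
  rewrite leq_add2l (leq_trans _ cross) //.
  by rewrite [leqRHS](big_setID X2) /= leq_addl.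
by move: b1 b2 eX1 eX2; rewrite dF cL; nia.
Qed.

End LineEdges.

(** Deleting a vertex of degree below Q destroys fewer than 2Q ordered pairs, so the hypothesis
    survives the deletion, and it is false for the empty set. *)
Lemma rich_subset (I : finType) (E : rel I) (Q : nat) (L : {set I}) :
  symmetric E -> irreflexive E ->
  (2 * Q * #|L| < \sum_(i in L) #|nbr E i L|)%N ->
  exists L' : {set I}, (0 < #|L'|)%N /\ forall i, i \in L' -> (Q <= #|nbr E i L'|)%N.
Proof.
move=> Es Ei; have [n] := ubnP #|L|; elim: n L => // n IH L; rewrite ltnS => ltn H.
have [/forall_inP all|] := boolP [forall i in L, (Q <= #|nbr E i L|)%N].
  exists L; split=> //; rewrite lt0n; apply: contraTneq H => L0.
  by rewrite (cards0_eq L0) big_set0 cards0 muln0.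
case/forall_inPn => i iL; rewrite -ltnNge => lti.
have cL : #|L| = #|L :\ i|.+1 by rewrite (cardsD1 i) iL.
apply: (IH (L :\ i)); first by rewrite -cL.
move: H; rewrite (big_setD1 i iL) /= cL mulnS.
have : (\sum_(j in L :\ i) #|nbr E j L| = \sum_(j in L :\ i) #|nbr E j (L :\ i)| + #|nbr E i L|)%N.
  have -> : #|nbr E i L| = (\sum_(j in L :\ i) E j i)%N.
    rewrite nbr_sum (big_setD1 i iL) /= Ei add0n.
    by apply: eq_bigr => j _; rewrite Es.
  rewrite -big_split /=; apply: eq_bigr => j _.
  by rewrite !nbr_sum (big_setD1 i iL) /= addnC.
by move=> ->; move: (\sum_(j in _) _)%N #|_ :\ _| => s c; move: lti; lia.
Qed.

Section EdgeBound.

Variables (K : fieldType) (p : nat).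
Hypothesis charK : forall n, (0 < n < p)%N -> n%:R != 0 :> K.
Local Notation T3 := {poly {poly {poly K}}}.

Variables (I : finType) (q : I -> K * K * K) (E : rel I) (par : I -> I -> K) (k : nat).
Hypothesis Esym : symmetric E.
Hypothesis Emeet : forall i j, E i j -> meet_at (q i) (q j) (par i j).
Hypothesis Einj : forall i j j', E i j -> E i j' -> par i j = par i j' -> j = j'.
Hypothesis nly_inj : injective (fun i => nly (q i)).
Hypothesis few_collinear : forall (i : I) (Q : {set I}),
  (forall j, j \in Q -> E i j) ->
  (forall j1 j2 j3, j1 \in Q -> j2 \in Q -> j3 \in Q -> collinear (q j1) (q j2) (q j3)) ->
  (#|Q| <= k)%N.
Local Notation nbr := (nbr E).

(** Suppose there are more pairs; pass to n lines L of degree at least Q each. A surface of degree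
    at most 3D through a random 1/r part M of L, with D^2 about 3|M|, contains at least half of L.
    By [surface_lines] these lines, up to n/8 of them, have at most (18D + k) n neighbours in all,
    which is too few. *)
Theorem line_edges (r Q : nat) :
  (864 * 32 <= r)%N -> (432 * r * #|I| < Q ^ 2)%N -> (64 * r <= Q)%N -> (4 * k <= Q)%N ->
  (#|I| <= 2 * p ^ 2)%N ->
  (\sum_i #|nbr i setT| <= 2 * Q * #|I|)%N.
Proof.
move=> r_big Q_big rQ kQ Ip; rewrite leqNgt; apply/negP => H.
have Ei : irreflexive E.
  by move=> i; apply/negP => /Emeet[/eqP].
have r0 : (0 < r)%N by apply: leq_trans r_big.
have [|L [L0 HL]] := @rich_subset I E Q setT Esym Ei.
  by rewrite cardsT; under eq_bigl => i do rewrite inE.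
have [M [sM rM good]] := sampling r0 rQ L0 HL.
set n := #|L| in L0 rM good; have nI : (n <= #|I|)%N by apply: max_card.
set m := #|M| in rM.
have [D D1 D2] : exists2 D, (3 * m <= D.+1 ^ 2)%N & (D ^ 2 <= 3 * m)%N.
  have ex : exists D, (3 * m <= D.+1 ^ 2)%N by exists (3 * m)%N; nia.
  case: (ex_minnP ex) => D h hmin; exists D => //.
  case: D h hmin => [|D] h hmin; first by rewrite exp0n.
  by rewrite leqNgt; apply/negP => lt; have := hmin D (ltnW lt); rewrite ltnn.
have [F [F0 dF FM]] := surface_through_lines q D1.
have Dr : (D ^ 2 * r <= 12 * n)%N by move: D2 rM; clear; nia.
(* So a line with at least Q / (2r) neighbours in M has more than 3D of them and lies on the
   surface. *)
have D6 : (6 * r * D < Q)%N.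
  rewrite -(ltn_sqr); apply: leq_ltn_trans Q_big.
  have -> : ((6 * r * D) ^ 2 = 36 * r * (D ^ 2 * r))%N by rewrite !expnMn; lia.
  apply: (@leq_trans (36 * r * (12 * n))%N); first by rewrite leq_mul2l Dr orbT.
  by move: nI; clear; nia.
(* Twice the degree has to stay below p; here the bound |I| <= 2 p^2 enters. *)
have Dp : (6 * D < p)%N.
  rewrite -ltn_sqr -(ltn_pmul2r r0).
  apply: (@leq_ltn_trans (36 * (12 * n))%N).
    by rewrite expnMn -mulnA leq_mul.
  apply: (@leq_ltn_trans (36 * (12 * (2 * p ^ 2)))%N); first by lia.
  have p0 : (0 < p ^ 2)%N by lia.
  by move: p0 r_big; move: (p ^ 2)%N => P; clear; nia.
pose L1 := [set i in L | onl (q i) F == 0].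
have HL1 i : i \in L1 -> onl (q i) F = 0 by rewrite inE => /andP[_ /eqP].
have few j : onl (q j) F != 0 -> forall P : {set I}, (forall i, i \in P -> onl (q i) F = 0) ->
    (#|nbr j P| <= 3 * D)%N.
  move=> Fj P HP; apply: leq_trans dF.
  exact: (few_nbrs_on_surface Emeet Einj HP Fj).
have cL1 : (n <= 2 * #|L1|)%N.
  apply: leq_trans good _; rewrite leq_mul2l /=; apply: subset_leq_card.
  apply/subsetP => i; rewrite !inE => /andP[-> h] /=; apply: contraTT h => Fi.
  rewrite -ltnNge; apply: leq_ltn_trans D6.
  by have := few i Fi M FM; clear; nia.
have [|X [sX cX eX]] := surface_lines charK Esym Emeet Einj nly_inj few_collinear F0 _ HL1.
  by move: dF Dp; clear; lia.
(* Origin of the constant in [r_big]: |X| <= 288 D^2 and r D^2 <= 12 n, while 864 * 32 = 8 * 288 *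
   12. *)
have cX8 : (8 * #|X| <= n)%N.
  have : (#|X| <= 288 * D ^ 2)%N.
    apply: leq_trans cX _; have : (deg3 F ^ 2 <= (3 * D) ^ 2)%N by rewrite leq_sqr.
    by rewrite expnMn; clear; lia.
  rewrite -(leq_pmul2l r0); move: r_big Dr; move: (D ^ 2)%N #|X| => d x; clear -L0; nia.
have lower : (Q * (#|L1| - #|X|) <= \sum_(i in L1 :\: X) #|nbr i L|)%N.
  have -> : (#|L1| - #|X| = #|L1 :\: X|)%N by rewrite cardsD (setIidPr sX).
  rewrite mulnC -sum_nat_const; apply: leq_sum => i; rewrite inE => /andP[_].
  by rewrite inE => /andP[iL _]; apply: HL.
have upper : (\sum_(i in L1 :\: X) #|nbr i L| <= (18 * D + k) * n)%N.
  have EL : L = L1 :|: (L :\: L1).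
    by apply/setP => i; rewrite !inE; case: (i \in L); case: eqP.
  apply: (@leq_trans (\sum_(i in L1 :\: X) #|nbr i L1| + \sum_(i in L1 :\: X) #|nbr i (L :\: L1)|)%N).
    rewrite -big_split /=; apply: leq_sum => i _; rewrite {1}EL; exact: nbrD.
  have e1 : (\sum_(i in L1 :\: X) #|nbr i L1| <= (15 * D + k) * n)%N.
    apply: leq_trans eX _; apply: leq_mul; first by move: dF; clear; lia.
    by apply: subset_leq_card; apply/subsetP => i; rewrite inE => /andP[].
  have e2 : (\sum_(i in L1 :\: X) #|nbr i (L :\: L1)| <= 3 * D * n)%N.
    apply: (@leq_trans (\sum_(i in L1) #|nbr i (L :\: L1)|)%N).
      by rewrite [leqRHS](big_setID X) /= leq_addl.
    rewrite (edges_sym Esym) [leqRHS]mulnC.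
    apply: (@leq_trans (#|L :\: L1| * (3 * D))%N); last first.
      by rewrite leq_mul2r; apply/orP; right; apply: subset_leq_card; apply: subsetDl.
    rewrite -sum_nat_const; apply: leq_sum => j; rewrite !inE => /andP[+ jL].
    by rewrite jL /= => Fj; apply: few.
  by move: e1 e2; clear; lia.
have : (3 * Q <= 8 * (18 * D + k))%N.
  rewrite -(leq_pmul2r L0).
  by have := leq_trans lower upper; move: cL1 cX8; clear; nia.
by move: kQ D6 r_big rQ; clear; nia.
Qed.

End EdgeBound.

(** The point e lies in the plane attached to e' by a null polarity. For distinct slopes this says
    that the two null lines meet, see [incid_meet]. *)
Definition incid (R : pzRingType) (e e' : R * R * R) : bool :=
  e.1.2 + e'.1.1 * e.2 == e'.1.2 + e.1.1 * e'.2.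

(** * Moving the null lines into general position *)

Section Twist.

Variables (F K : fieldType) (iota : {rmorphism F -> K}) (tX : K).
Hypothesis tX_independent : forall a b c : F,
  iota a + iota b * tX + iota c * tX ^+ 2 = 0 -> [/\ a = 0, b = 0 & c = 0].

Lemma tX_neq0 : tX != 0.
Proof.
apply/eqP => X0; have [] := @tX_independent 0 1 0.
  by rewrite X0 rmorph0 !mul0r mulr0 !addr0.
by move=> _ /eqP; rewrite oner_eq0.
Qed.

(** An incidence between opposite colours acquires the same multiple of [tX ^+ 2] on both sides and
    so is preserved. Within one colour it splits into its coefficients at 1, [tX] and [tX ^+ 2],
    which force the two points to be equal. *)
Definition twist (b : bool) (e : F * F * F) : K * K * K :=
  if b then (iota e.1.1, iota e.1.2, (iota e.2 + tX ^+ 2) / tX)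
  else (iota e.1.1 * tX, iota e.1.2 + iota e.1.1 * tX ^+ 2, iota e.2).

Lemma twist_incid b e e' : incid e e' -> incid (twist b e) (twist (~~ b) e').
Proof.
rewrite /incid /twist; have X0 := tX_neq0 => /eqP H.
have Hi : iota e.1.2 + iota e'.1.1 * iota e.2 = iota e'.1.2 + iota e.1.1 * iota e'.2.
  by rewrite -!rmorphM -!rmorphD /= H.
case: b => /=; apply/eqP.
  transitivity (iota e.1.2 + iota e'.1.1 * iota e.2 + iota e'.1.1 * tX ^+ 2); first by field.
  by rewrite Hi; ring.
transitivity (iota e.1.2 + iota e'.1.1 * iota e.2 + iota e.1.1 * tX ^+ 2); first by ring.
by rewrite Hi; field.
Qed.

Lemma twist_slope b e e' : e.1.1 != 0 -> e'.1.1 != 0 ->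
  (twist b e).1.1 != (twist (~~ b) e').1.1.
Proof.
have aux (a a' : F) : a != 0 -> iota a * tX != iota a'.
  move=> a0; apply: contraNneq a0 => H.
  have [] := @tX_independent (- a') a 0; last by move=> _ -> _.
  by rewrite rmorphN rmorph0 mul0r addr0 H addNr.
by move=> h h'; case: b => /=; [rewrite eq_sym|]; apply: aux.
Qed.

Lemma twist_self_incid b e e' : e.1.1 != 0 -> incid (twist b e) (twist b e') -> e = e'.
Proof.
move=> s0 /eqP; have X0 := tX_neq0.
case: e e' s0 => [[s c] m] [[s' c'] m'] /= s0; case: b => /= H.
  have [] := @tX_independent (s' * m - s * m') (c - c') (s' - s).
    rewrite !(rmorphB, rmorphM) /=.
    transitivity (tX * ((iota c + iota s' * ((iota m + tX ^+ 2) / tX))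
      - (iota c' + iota s * ((iota m' + tX ^+ 2) / tX)))); first by field.
    by rewrite H subrr mulr0.
  move=> h1 /subr0_eq -> /subr0_eq E; move: h1; rewrite E -mulrBr => /eqP.
  by rewrite mulf_eq0 (negPf s0) /= subr_eq0 => /eqP ->.
have [] := @tX_independent (c - c') (s' * m - s * m') (s - s').
  rewrite !(rmorphB, rmorphM) /=.
  transitivity ((iota c + iota s * tX ^+ 2 + iota s' * tX * iota m)
    - (iota c' + iota s' * tX ^+ 2 + iota s * tX * iota m')); first by ring.
  by rewrite H subrr.
move=> /subr0_eq -> h1 /subr0_eq E; move: h1; rewrite -E -mulrBr => /eqP.
by rewrite mulf_eq0 (negPf s0) /= subr_eq0 => /eqP ->.
Qed.

Lemma nly_eq (q q' : K * K * K) : nly q = nly q' ->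
  q.1.2 - q.1.1 * q.2 = q'.1.2 - q'.1.1 * q'.2 /\ q.1.1 ^+ 2 = q'.1.1 ^+ 2.
Proof.
move=> H; have E i : (nly q)`_i = (nly q')`_i by rewrite H.
have := E 1%N; have := E 0%N.
by rewrite /nly !coefD !coefCM !coefC !coefX /= !mulr0 !mulr1 !addr0 !add0r.
Qed.

Lemma twist_nly_inj b b' e e' : e.1.1 != 0 -> e'.1.1 != 0 ->
  nly (twist b e) = nly (twist b' e') -> b = b' /\ e = e'.
Proof.
have X0 := tX_neq0.
have aux (a a' : F) : a != 0 -> (iota a * tX) ^+ 2 != iota a' ^+ 2.
  move=> a0; apply: contraNneq a0 => H.
  have [] := @tX_independent (- a' ^+ 2) 0 (a ^+ 2).
    by rewrite rmorphN !rmorphXn rmorph0 /= mul0r addr0 -H exprMn addNr.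
  by move=> _ _ /eqP; rewrite expf_eq0.
case: e e' => [[s c] m] [[s' c'] m'] /= s0 s0' /nly_eq[].
case: b; case: b' => /= H1 H2.
- have [] := @tX_independent (s' * m' - s * m) (c - c') (s' - s).
    rewrite !(rmorphB, rmorphM) /=.
    transitivity (tX * ((iota c - iota s * ((iota m + tX ^+ 2) / tX))
      - (iota c' - iota s' * ((iota m' + tX ^+ 2) / tX)))); first by field.
    by rewrite H1 subrr mulr0.
  move=> h1 /subr0_eq -> /subr0_eq E; move: h1; rewrite E -mulrBr => /eqP.
  by rewrite mulf_eq0 (negPf s0) /= subr_eq0 => /eqP ->.
- by move: (aux s' s s0'); rewrite H2 eqxx.
- by move: (aux s s' s0); rewrite H2 eqxx.
- have [] := @tX_independent (c - c') (s' * m' - s * m) (s - s').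
    rewrite !(rmorphB, rmorphM) /=.
    transitivity ((iota c + iota s * tX ^+ 2 - iota s * tX * iota m)
      - (iota c' + iota s' * tX ^+ 2 - iota s' * tX * iota m')); first by ring.
    by rewrite H1 subrr.
  move=> /subr0_eq -> h1 /subr0_eq E; move: h1; rewrite -E -mulrBr => /eqP.
  by rewrite mulf_eq0 (negPf s0) /= subr_eq0 => /eqP ->.
Qed.

(** On each colour [twist] is an invertible affine map. *)
Lemma twist_collinear b e1 e2 e3 :
  collinear (twist b e1) (twist b e2) (twist b e3) -> collinear e1 e2 e3.
Proof.
have X0 := tX_neq0.
case: e1 e2 e3 => [[s1 c1] m1] [[s2 c2] m2] [[s3 c3] m3].
rewrite /collinear; case: b => /= -[h1 h2 h3].
  split; apply: (fmorph_inj iota); rewrite !(rmorphM, rmorphB) //=.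
    apply: (mulIf (invr_neq0 X0)); apply/eqP; rewrite -subr_eq0 -[X in _ == X](subrr 
      ((iota s2 - iota s1) * ((iota m3 + tX ^+ 2) / tX - (iota m1 + tX ^+ 2) / tX))).
    by rewrite {2}h2; apply/eqP; field.
  apply: (mulIf (invr_neq0 X0)); apply/eqP; rewrite -subr_eq0 -[X in _ == X](subrr 
      ((iota c2 - iota c1) * ((iota m3 + tX ^+ 2) / tX - (iota m1 + tX ^+ 2) / tX))).
  by rewrite {2}h3; apply/eqP; field.
have e2 : (iota s2 - iota s1) * (iota m3 - iota m1) = (iota s3 - iota s1) * (iota m2 - iota m1).
  apply: (mulIf X0); apply/eqP; rewrite -subr_eq0 -[X in _ == X](subrr 
      ((iota s2 * tX - iota s1 * tX) * (iota m3 - iota m1))).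
  by rewrite {2}h2; apply/eqP; ring.
split; apply: (fmorph_inj iota); rewrite !(rmorphM, rmorphB) //=.
  apply: (mulIf X0); apply/eqP; rewrite -subr_eq0 -[X in _ == X](subrr 
      ((iota s2 * tX - iota s1 * tX) * (iota c3 + iota s3 * tX ^+ 2 - (iota c1 + iota s1 * tX ^+ 2)))).
  by rewrite {2}h1; apply/eqP; ring.
apply/eqP; rewrite -subr_eq0; apply/eqP.
transitivity ((iota c2 + iota s2 * tX ^+ 2 - (iota c1 + iota s1 * tX ^+ 2)) * (iota m3 - iota m1)
  - (iota c3 + iota s3 * tX ^+ 2 - (iota c1 + iota s1 * tX ^+ 2)) * (iota m2 - iota m1)
  - tX ^+ 2 * ((iota s2 - iota s1) * (iota m3 - iota m1) - (iota s3 - iota s1) * (iota m2 - iota m1))).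
  by ring.
by rewrite h3 e2 !subrr mulr0 subr0.
Qed.

End Twist.

Definition meet_par (K : fieldType) (q q' : K * K * K) : K :=
  (q.2 - q'.2) / (q.1.1 - q'.1.1).

Lemma incid_meet (K : fieldType) (q q' : K * K * K) :
  q.1.1 != q'.1.1 -> incid q q' -> meet_at q q' (meet_par q q').
Proof.
case: q q' => [[s w] v] [[s' w'] v'] /= ss; rewrite /incid /= => /eqP H.
have d0 : s - s' != 0 by rewrite subr_eq0.
rewrite /meet_at /nly /nlx /meet_par !hornerE /=; split=> //; last by field.
have -> : w = w' + s * v' - s' * v by rewrite -H addrK.
by field.
Qed.

(** Together with [twist_self_incid] this excludes two neighbours of the same colour at one
    point. *)
Lemma meet_incid (K : fieldType) (q q1 q2 : K * K * K) t :
  meet_at q q1 t -> meet_at q q2 t -> incid q1 q2.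
Proof.
case: q1 q2 => [[s1 w1] v1] [[s2 w2] v2] [_ hy1 hx1] [_ hy2 hx2].
move: hy1 hx1 hy2 hx2; rewrite /nly /nlx !hornerE /=.
move: (_ + _ * t) (_ - _ * t) => y x hy1 hx1 hy2 hx2.
have E1 : v1 = x + s1 * t by rewrite hx1 subrK.
have E2 : v2 = x + s2 * t by rewrite hx2 subrK.
have F1 : w1 = y + s1 * x by rewrite hy1 hx1; ring.
have F2 : w2 = y + s2 * x by rewrite hy2 hx2; ring.
by rewrite /incid /= E1 E2 F1 F2; apply/eqP; ring.
Qed.

(** * Rudnev's theorem over the prime field *)

Section Rudnev.

Variable p : nat.
Hypothesis pp : prime p.
Local Notation F := 'F_p.
Local Notation K := {fraction {poly F}}.

Definition iota : F -> K := @tofrac {poly F} \o polyC.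
HB.instance Definition _ := GRing.RMorphism.on iota.

Lemma fracX_independent (a b c : F) :
  iota a + iota b * tofrac 'X + iota c * tofrac 'X ^+ 2 = 0 :> K ->
  [/\ a = 0, b = 0 & c = 0].
Proof.
rewrite /iota /= -tofracXn -!tofracM -!tofracD => /eqP; rewrite tofrac_eq0 => /eqP H.
have E i : (a%:P + b%:P * 'X + c%:P * 'X^2)`_i = 0 by rewrite H coef0.
have := E 0%N; have := E 1%N; have := E 2.
by rewrite !coefD !coefCM !coefC !coefX !coefXn /= !mulr0 !mulr1 !addr0 !add0r.
Qed.

Lemma frac_char n : (0 < n < p)%N -> n%:R != 0 :> K.
Proof.
move=> /andP[n0 np]; rewrite -(rmorph_nat iota) fmorph_eq0.
rewrite -(dvdn_pcharf (pchar_Fp pp)); apply: contraL np => /dvdn_leq.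
by rewrite -leqNgt; apply.
Qed.

(* The incidences of Rudnev's point-plane theorem, for a point set and its image
   under a null polarity. *)
Theorem rudnev (P : {set F * F * F}) (r k Q : nat) :
  (forall e, e \in P -> e.1.1 != 0) ->
  (forall S : {set F * F * F}, S \subset P ->
    (forall e1 e2 e3, e1 \in S -> e2 \in S -> e3 \in S -> collinear e1 e2 e3) ->
    (#|S| <= k)%N) ->
  (#|P| <= p ^ 2)%N ->
  (864 * 32 <= r)%N -> (432 * r * (2 * #|P|) < Q ^ 2)%N -> (64 * r <= Q)%N -> (4 * k <= Q)%N ->
  (#|[set e | [&& e.1 \in P, e.2 \in P & incid e.1 e.2]]| <= 2 * Q * #|P|)%N.
Proof.
move=> s0 Pk Pp r_big Q1 Q2 Q3.
pose I := (bool * {e | e \in P})%type.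
pose q (i : I) : K * K * K := twist iota (tofrac 'X) i.1 (val i.2).
pose E (i j : I) := (i.1 != j.1) && incid (val i.2) (val j.2).
have ind := fracX_independent.
have Is0 (i : I) : (val i.2).1.1 != 0 by apply: s0; exact: valP.
have incC (e e' : F * F * F) : incid e e' = incid e' e by rewrite /incid eq_sym.
have Esym : symmetric E by move=> i j; rewrite /E eq_sym incC.
have Eb i j : E i j -> j.1 = ~~ i.1.
  by move=> /andP[]; case: (i.1); case: (j.1).
have Emeet i j : E i j -> meet_at (q i) (q j) (meet_par (q i) (q j)).
  move=> Eij; have bj := Eb i j Eij; move: Eij => /andP[_ inc].
  apply: incid_meet; rewrite /q bj; first by apply: twist_slope.
  exact: twist_incid.
have Einj i j j' : E i j -> E i j' -> meet_par (q i) (q j) = meet_par (q i) (q j') -> j = j'.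
  move=> Ej Ej' Et; have M := Emeet _ _ Ej; have M' := Emeet _ _ Ej'; rewrite -Et in M'.
  have := meet_incid M M'; rewrite /q (Eb _ _ Ej) (Eb _ _ Ej') => /(twist_self_incid ind (Is0 j)) H.
  rewrite [j]surjective_pairing [j']surjective_pairing (Eb _ _ Ej) (Eb _ _ Ej').
  by congr (_, _); apply: val_inj.
have nly_inj : injective (fun i => nly (q i)).
  move=> i j /(twist_nly_inj ind (Is0 i) (Is0 j))[E1 E2].
  by rewrite [i]surjective_pairing [j]surjective_pairing E1; congr (_, _); apply: val_inj.
have few (i : I) (S : {set I}) : (forall j, j \in S -> E i j) ->
    (forall j1 j2 j3, j1 \in S -> j2 \in S -> j3 \in S -> collinear (q j1) (q j2) (q j3)) ->
    (#|S| <= k)%N.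
  move=> HS Hc; pose f (j : I) := val j.2.
  have f_inj : {in S &, injective f}.
    move=> j j' /HS/Eb bj /HS/Eb bj' H.
    rewrite [j]surjective_pairing [j']surjective_pairing bj bj'.
    by congr (_, _); apply: val_inj.
  rewrite -(card_in_imset f_inj); apply: Pk.
    by apply/subsetP => e /imsetP[j _ ->]; exact: valP.
  move=> e1 e2 e3 /imsetP[j1 h1 ->] /imsetP[j2 h2 ->] /imsetP[j3 h3 ->].
  have := Hc _ _ _ h1 h2 h3.
  by rewrite /q (Eb _ _ (HS _ h1)) (Eb _ _ (HS _ h2)) (Eb _ _ (HS _ h3)); apply: twist_collinear.
have cI : #|{: I}| = (2 * #|P|)%N.
  by rewrite card_prod card_bool card_sig; congr (_ * _)%N; apply: eq_card.
have := @line_edges K p frac_char I q E (fun i j => meet_par (q i) (q j)) k Esym Emeet Einj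
  nly_inj few r Q r_big.
rewrite cI => /(_ Q1 Q2 Q3).
rewrite leq_mul2l Pp orbT => /(_ isT).
set inc := [set e | _]; rewrite [leqRHS]mulnCA => H; rewrite -(leq_pmul2l (isT : (0 < 2)%N)).
(* Each ordered incidence is seen once from either colour, which compensates for the doubled vertex
   set. *)
apply: leq_trans H; have cS : (forall b, #|inc| <= \sum_(x : {e | e \in P}) #|nbr E (b, x) setT|)%N.
  move=> b; pose D := [set z : {e | e \in P} * I | z.2 \in nbr E (b, z.1) setT].
  have -> : (\sum_(x : {e | e \in P}) #|nbr E (b, x) setT| = #|D|)%N.
    rewrite -sum1_card (eq_bigl (fun z => z.2 \in nbr E (b, z.1) setT)); last by move=> z; rewrite inE.
    rewrite -(pair_big_dep xpredT (fun x j => j \in nbr E (b, x) setT) (fun _ _ => 1%N)) /=.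
    by apply: eq_bigr => x _; rewrite sum1_card.
  pose g (z : {e | e \in P} * I) := (val z.1, val z.2.2).
  apply: leq_trans (leq_imset_card g D); apply: subset_leq_card.
  apply/subsetP => -[e e']; rewrite inE /= => /and3P[eP e'P ee'].
  apply/imsetP; exists (exist _ e eP, (~~ b, exist _ e' e'P)) => //.
  by rewrite !inE /= /E /= ee' andbT; case: (b).
rewrite mul2n -addnn (eq_bigr (fun i : I => (fun b x => #|nbr E (b, x) setT|) i.1 i.2)); last by case.
rewrite -(pair_big xpredT xpredT (fun b x => #|nbr E (b, x) setT|)) /=.
by rewrite big_bool /= leq_add.
Qed.

End Rudnev.

(** * The energy bound *)

Lemma sum_card_dep (I J : finType) (A : {set I}) (f : I -> {set J}) :
  (\sum_(i in A) #|f i| = #|[set z : I * J | (z.1 \in A) && (z.2 \in f z.1)]|)%N.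
Proof.
rewrite -[RHS]sum1_card (eq_bigl (fun z : I * J => (z.1 \in A) && (z.2 \in f z.1))); last first.
  by move=> z; rewrite inE.
rewrite -(pair_big_dep (fun i => i \in A) (fun i j => j \in f i) (fun _ _ => 1%N)) /=.
by apply: eq_bigr => i _; rewrite sum1_card.
Qed.

(** * Lines and Cartesian squares *)

Section CartesianIncidences.

Variable F : finFieldType.
Implicit Types (S B : {set F}) (l : F * F).

Definition line_count S l : nat := #|[set x in S | l.1 * x + l.2 \in S]|.

Lemma line_countE S l : line_count S l = (\sum_(x in S) ((l.1 * x + l.2)%R \in S))%N.
Proof.
rewrite /line_count -sum1_card [LHS]big_mkcond [RHS]big_mkcond /=.
by apply: eq_bigr => x _; rewrite inE; case: (x \in S); case: (_ \in S).
Qed.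

Lemma shift_count S (a : F) : (\sum_(c : F) ((a + c)%R \in S) = #|S|)%N.
Proof.
rewrite -sum1_card [RHS]big_mkcond [RHS](reindex_inj (addrI a)) /=.
by apply: eq_bigr => c _; case: (_ \in S).
Qed.

Lemma sum_line_count S : (\sum_l line_count S l = #|S| ^ 2 * #|F|)%N.
Proof.
under eq_bigr => l _ do rewrite line_countE.
rewrite exchange_big /=.
transitivity (\sum_(x in S) #|F| * #|S|)%N; last first.
  by rewrite sum_nat_const expnS expn1 -mulnA (mulnC #|F|).
apply: eq_bigr => x _.
rewrite -(pair_big xpredT xpredT (fun m c => nat_of_bool (m * x + c \in S))) /=.
by under eq_bigr => m _ do rewrite shift_count; rewrite sum_nat_const.
Qed.

(** A line y = mx + c is determined by its values at two different abscissae, so each such pair of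
    abscissae accounts for at most |S|^2 lines. *)
Lemma sum_line_count2 S :
  (\sum_l line_count S l ^ 2 <= #|S| ^ 2 * #|F| + #|S| ^ 3 * (#|S| - 1))%N.
Proof.
under eq_bigr => l _ do rewrite line_countE expnS expn1 big_distrlr /=.
rewrite exchange_big /=.
apply: (@leq_trans (\sum_(x in S) (#|F| * #|S| + (#|S| - 1) * #|S| ^ 2))%N); last first.
  rewrite sum_nat_const mulnDr; apply: eq_leq; congr (_ + _)%N.
    by rewrite mulnA mulnAC expnS expn1.
  by rewrite mulnCA -expnS mulnC.
apply: leq_sum => x xS; rewrite exchange_big /= (bigD1 x) //=; apply: leq_add.
  under eq_bigr => l _ do rewrite mulnb andbb.
  rewrite -(pair_big xpredT xpredT (fun m c => nat_of_bool (m * x + c \in S))) /=.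
  by under eq_bigr => m _ do rewrite shift_count; rewrite sum_nat_const.
have -> : (#|S| - 1 = #|[pred x' in S | x' != x]|)%N.
  have := cardD1 x (mem S); rewrite xS => ->; rewrite add1n subn1 /=.
  by apply: eq_card => z; rewrite !inE andbC.
rewrite -sum_nat_const; apply: leq_sum => x' /andP[_ xx'].
pose g (l : F * F) := (l.1 * x + l.2, l.1 * x' + l.2).
have g_inj : injective g.
  move=> [m c] [m' c'] [] /= h1 h2.
  have d : x' - x != 0 by rewrite subr_eq0.
  have E : m = m'.
    apply: (mulIf d); transitivity ((m * x' + c) - (m * x + c)); first by ring.
    by rewrite h1 h2; ring.
  by move: h1; rewrite E => /addrI ->.
rewrite (eq_bigr (fun l => nat_of_bool (g l \in setX S S))); last first.
  by move=> l _; rewrite inE mulnb.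
have -> : (#|S| ^ 2 = #|setX S S|)%N by rewrite cardsX expnS expn1.
rewrite -big_mkcond /= sum1_card -(card_imset _ g_inj).
by apply: subset_leq_card; apply/subsetP => z /imsetP[l lS ->].
Qed.

(* With s_i = 1 / (a_i + b_i), the equation 1/a_1 + 1/b_1 = 1/a_2 + 1/b_2 reads
   b_1 - b_1^2 s_1 = b_2 - b_2^2 s_2; [hyp_line (b_1, b_2)] is the line s_1 |-> s_2. *)
Definition hyp_line (d : F * F) : F * F :=
  (d.1 ^+ 2 / d.2 ^+ 2, (d.2 - d.1) / d.2 ^+ 2).

Lemma sum_line_count_card S (L : F * F -> F * F) (D : {set F * F}) :
  (\sum_(d in D) line_count S (L d))%N =
  #|[set z : (F * F) * F | [&& z.1 \in D, z.2 \in S &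
       ((L z.1).1 * z.2 + (L z.1).2 \in S)%R]]|.
Proof.
rewrite /line_count sum_card_dep; apply: eq_card => z; rewrite !inE.
by rewrite andbA.
Qed.

Definition off_diag B : {set F * F} := [set d in setX B B | d.1 != d.2].

Lemma card_roots_quadratic (a b c : F) (B : {set F}) :
  (a, b, c) != (0, 0, 0) -> (forall x, x \in B -> a * x ^+ 2 + b * x + c = 0) ->
  (#|B| <= 2)%N.
Proof.
move=> nz HB; pose P := a *: 'X^2 + b *: 'X + c%:P : {poly F}.
have P0 : P != 0.
  apply: contraNneq nz => P0; have E i : P`_i = 0 by rewrite P0 coef0.
  have := E 0%N; have := E 1%N; have := E 2.
  rewrite /P !coefD !coefZ !coefC !coefX !coefXn /= !mulr0 !mulr1 !addr0 !add0r.
  by move=> -> -> ->.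
have sP : (size P <= 3)%N.
  apply/leq_sizeP => i Hi; rewrite /P !coefD !coefZ coefC coefX coefXn.
  by case: i Hi => [|[|[|i]]] //= _; rewrite !mulr0 !addr0.
rewrite cardE -ltnS; apply: leq_trans sP; apply: max_poly_roots => //.
  by apply/allP => x; rewrite mem_enum => /HB H; rewrite /root /P !(hornerD, hornerZ, hornerXn, hornerX, hornerC) H eqxx.
exact: enum_uniq.
Qed.

(** The intercept gives d.1 = d.2 - l.2 d.2^2; the slope then leaves a quadratic equation for d.2,
    nontrivial since l.2 is nonzero off the diagonal. *)
Lemma hyp_line_fiber B l : 0 \notin B ->
  (#|[set d in off_diag B | hyp_line d == l]| <= 2)%N.
Proof.
move=> B0; set Z := [set d in _ | _].
have ZP d : d \in Z -> [/\ d.1 != d.2, d.1 != 0, d.2 != 0 & hyp_line d = l].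
  rewrite !inE => /andP[/andP[/andP[h1 h2] h3] /eqP h4]; split=> //.
    by apply: contraNneq B0 => <-.
  by apply: contraNneq B0 => <-.
have d1E d : d \in Z -> d.1 = d.2 - l.2 * d.2 ^+ 2.
  by move=> /ZP[_ _ h0 <-]; rewrite /=; field.
have inj : {in Z &, injective snd}.
  move=> d d' dZ dZ' E; rewrite [d]surjective_pairing [d']surjective_pairing E.
  by rewrite (d1E _ dZ) (d1E _ dZ') E.
rewrite -(card_in_imset inj).
have [Z0|[d0 d0Z]] := set_0Vmem Z; first by rewrite Z0 imset0 cards0.
have c0 : l.2 != 0.
  have [h1 _ h3 <-] := ZP _ d0Z.
  by rewrite /= mulf_neq0 ?invr_neq0 ?expf_neq0 // subr_eq0 eq_sym.
apply: (@card_roots_quadratic (l.2 ^+ 2) (- (2 * l.2)) (1 - l.1)).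
  by rewrite !xpair_eqE expf_eq0 (negPf c0).
move=> x /imsetP[d dZ ->]; have [_ _ h0 El] := ZP _ dZ.
have E1 := d1E _ dZ; have -> : l.1 = d.1 ^+ 2 / d.2 ^+ 2 by rewrite -El.
by rewrite E1; field.
Qed.

(** The relation means a common point or a common direction. For a fixed second parameter it is a
    nontrivial quadratic in the first. This bounds the collinear subsets in Rudnev's theorem. *)
Lemma hyp_line_concurrent B (al be ga : F) (Z : {set F * F}) : 0 \notin B ->
  (al, be) != (0, 0) -> Z \subset hyp_line @: off_diag B ->
  (forall l, l \in Z -> al * l.1 + be * l.2 = ga) -> (#|Z| <= 2 * #|B|)%N.
Proof.
move=> B0 nz ZL HZ.
pose D := [set d in off_diag B | hyp_line d \in Z].
have : (#|Z| <= #|D|)%N.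
  apply: leq_trans (leq_imset_card hyp_line D); apply: subset_leq_card.
  apply/subsetP => l lZ; have /imsetP[d dD El] := subsetP ZL l lZ.
  by apply/imsetP; exists d => //; rewrite inE dD -El.
move/leq_trans; apply.
have -> : #|D| = (\sum_(b in B) #|[set a in B | (a, b) \in D]|)%N.
  rewrite -sum1_card (eq_bigl (fun d : F * F => (d.2 \in B) && (d.1 \in [set a in B | (a, d.2) \in D]))); last first.
    move=> [a b] /=; rewrite !inE /=.
    by case: (a \in B); case: (b \in B); rewrite ?andbF.
  rewrite (reindex (fun d : F * F => (d.2, d.1))) /=; last first.
    by exists (fun d => (d.2, d.1)) => -[].
  rewrite -(pair_big_dep (fun b => b \in B) (fun b a => a \in [set a in B | (a, b) \in D]) (fun _ _ => 1%N)) /=.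
  by apply: eq_bigr => b _; rewrite sum1_card.
rewrite mulnC -sum_nat_const; apply: leq_sum => b bB.
have b0 : b != 0 by apply: contraNneq B0 => <-.
apply: (@card_roots_quadratic al (- be) (be * b - ga * b ^+ 2)).
  by apply: contraNneq nz => -[-> /eqP]; rewrite oppr_eq0 => /eqP ->.
move=> a; rewrite !inE => /andP[_ /andP[_ /HZ /=]] <-.
by field.
Qed.

End CartesianIncidences.

Lemma inv_add_inv (F : fieldType) (x y : F) :
  x != 0 -> y != 0 -> x + y != 0 -> (x^-1 + y^-1)^-1 = x * y / (x + y).
Proof. by move=> x0 y0 xy; field; rewrite ?(addrC y) ?xy ?x0 ?y0. Qed.

Lemma hyp_line_inv_sum (F : finFieldType) (x1 x2 y1 y2 : F) :
  x1 != 0 -> x2 != 0 -> y1 != 0 -> y2 != 0 -> x1 + y1 != 0 -> x1 + y1 = x2 + y2 ->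
  (hyp_line (y1^-1, y2^-1)).1 * (x1^-1 + y1^-1)^-1 + (hyp_line (y1^-1, y2^-1)).2
    = (x2^-1 + y2^-1)^-1.
Proof.
move=> x10 x20 y10 y20 xy e; rewrite !inv_add_inv // -?e //.
have -> : x2 = x1 + y1 - y2 by rewrite e addrK.
by rewrite /hyp_line /=; field; rewrite ?xy ?y10 ?y20 ?oner_neq0.
Qed.

Lemma invsetP (p : nat) (X : {set 'F_p}) (x : 'F_p) :
  reflect (x != 0 /\ x^-1 \in X) (x \in invset X).
Proof.
apply: (iffP imsetP) => [[y]|[x0 xX]].
  by rewrite inE => /andP[yX y0] ->; rewrite invr_eq0 invrK.
by exists x^-1; rewrite ?invrK // inE xX invr_eq0.
Qed.

Lemma card_invset (p : nat) (X : {set 'F_p}) : (#|invset X| <= #|X|)%N.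
Proof.
apply: leq_trans (leq_imset_card _ _) _; apply: subset_leq_card.
by apply/subsetP => x; rewrite inE => /andP[].
Qed.

(** |B|^2 covers the solutions with x1 + y1 = 0, where the y's determine the x's, and |A||B| those
    with y1 = y2, hence x1 = x2. The others inject into the incidences of [hyp_line]. *)
Lemma T2plus_invset_line_count (p : nat) (A B : {set 'F_p}) :
  (T2plus (invset A) (invset B) <= #|B| ^ 2 + #|A| * #|B|
     + \sum_(d in off_diag (B :\ 0%R)) line_count (invset (sumset A B)) (hyp_line d))%N.
Proof.
set X := invset A; set Y := invset B; set Sig := invset _; set D := off_diag _.
pose T := [set q : ('F_p * 'F_p) * ('F_p * 'F_p) |
      [&& q.1.1 \in X, q.1.2 \in X, q.2.1 \in Y, q.2.2 \in Y
        & q.1.1 + q.2.1 == q.1.2 + q.2.2]].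
pose T1 := [set q in T | q.1.1 + q.2.1 == 0].
pose T2 := [set q in T | q.2.1 == q.2.2].
pose T3 := [set q in T | (q.1.1 + q.2.1 != 0) && (q.2.1 != q.2.2)].
have T1E q : (q \in T1) = (q \in T) && (q.1.1 + q.2.1 == 0) by rewrite in_set.
have T2E q : (q \in T2) = (q \in T) && (q.2.1 == q.2.2) by rewrite in_set.
have T3E q : (q \in T3) = (q \in T) && ((q.1.1 + q.2.1 != 0) && (q.2.1 != q.2.2)).
  by rewrite in_set.
have cover : T \subset T1 :|: T2 :|: T3.
  apply/subsetP => q qT; rewrite !in_setU T1E T2E T3E qT /=.
  by case: (_ + _ == 0); case: (_ == q.2.2).
have TP q : q \in T -> [/\ q.1.1 \in X, q.1.2 \in X, q.2.1 \in Y, q.2.2 \in Y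
        & q.1.1 + q.2.1 = q.1.2 + q.2.2].
  by rewrite inE => /and5P[? ? ? ? /eqP ?].
have c1 : (#|T1| <= #|B| ^ 2)%N.
  have inj : {in T1 &, injective (fun q : ('F_p * 'F_p) * ('F_p * 'F_p) => q.2)}.
    move=> [[x1 x2] [y1 y2]] [[x1' x2'] [y1' y2']]; rewrite !T1E.
    move=> /andP[/TP[_ _ _ _ /= e1] /eqP /= e2] /andP[/TP[_ _ _ _ /= e1'] /eqP /= e2'] /= [E1 E2]; subst y1' y2'.
    have -> : x1 = x1' by apply: (addIr y1); rewrite e2 e2'.
    by have -> : x2 = x2' by apply: (addIr y2); rewrite -e1 -e1' e2 e2'.
  rewrite -(card_in_imset inj); apply: (@leq_trans #|setX Y Y|).
    apply: subset_leq_card; apply/subsetP => y /imsetP[q]; rewrite T1E.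
    by move=> /andP[/TP[_ _ y1 y2 _] _] ->; rewrite inE y1 y2.
  by rewrite cardsX expnS expn1 leq_mul ?card_invset.
have c2 : (#|T2| <= #|A| * #|B|)%N.
  have inj : {in T2 &, injective (fun q : ('F_p * 'F_p) * ('F_p * 'F_p) => (q.1.1, q.2.1))}.
    move=> [[x1 x2] [y1 y2]] [[x1' x2'] [y1' y2']]; rewrite !T2E.
    move=> /andP[/TP[_ _ _ _ /= e1] /eqP /= e2] /andP[/TP[_ _ _ _ /= e1'] /eqP /= e2'] /= [E1 E2].
    have F2 : x2 = x1 by apply: (addIr y2); rewrite -e1 e2.
    have F2' : x2' = x1' by apply: (addIr y2'); rewrite -e1' e2'.
    by rewrite F2 F2' -e2 -e2' E1 E2.
  rewrite -(card_in_imset inj); apply: (@leq_trans #|setX X Y|).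
    apply: subset_leq_card; apply/subsetP => y /imsetP[q]; rewrite T2E.
    by move=> /andP[/TP[x1 _ y1 _ _] _] ->; rewrite inE x1 y1.
  by rewrite cardsX leq_mul ?card_invset.
have c3 : (#|T3| <= \sum_(d in D) line_count Sig (hyp_line d))%N.
  pose f (q : ('F_p * 'F_p) * ('F_p * 'F_p)) :=
    ((q.2.1^-1, q.2.2^-1), (q.1.1^-1 + q.2.1^-1)^-1).
  rewrite sum_line_count_card.
  have nz q : q \in T3 -> [/\ q.1.1 != 0, q.1.2 != 0, q.2.1 != 0, q.2.2 != 0 & q.1.1 + q.2.1 != 0].
    rewrite T3E => /andP[/TP[/invsetP[? _] /invsetP[? _] /invsetP[? _] /invsetP[? _] _] /andP[? _]].
    by split.
  have inj : {in T3 &, injective f}.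
    move=> [[x1 x2] [y1 y2]] [[x1' x2'] [y1' y2']] q1 q2.
    have [/= n1 _ _ _ _] := nz _ q1; have [/= n1' _ _ _ _] := nz _ q2.
    move: q1 q2; rewrite !T3E.
    move=> /andP[/TP[_ _ _ _ /= e1] _] /andP[/TP[_ _ _ _ /= e1'] _] [] /= h1 h2 h3.
    have Ey1 := invr_inj h1; have Ey2 := invr_inj h2; move: h3; rewrite -Ey1.
    move=> /invr_inj/addIr/invr_inj Ex1; rewrite Ey1 Ey2 Ex1.
    by have -> : x2 = x2' by apply: (addIr y2); rewrite -e1 Ey1 Ex1 e1' Ey2.
  rewrite -(card_in_imset inj); apply: subset_leq_card; apply/subsetP => z /imsetP[q qT ->].
  have [n1 n2 n3 n4 n5] := nz _ qT; move: (qT); rewrite T3E.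
  move=> /andP[/TP[/invsetP[_ x1] /invsetP[_ x2] /invsetP[_ y1] /invsetP[_ y2] e] /andP[_ y12]].
  rewrite !inE /= !invr_eq0 n3 n4 y1 y2 /= (inj_eq invr_inj) y12 /=.
  have mem (x y : 'F_p) : x != 0 -> y != 0 -> x + y != 0 -> x^-1 \in A -> y^-1 \in B ->
      (x^-1 + y^-1)^-1 \in Sig.
    move=> x0 y0 xy xA yB; apply/invsetP; split; last by rewrite invrK; apply/imset2P; exists x^-1 y^-1.
    by rewrite inv_add_inv // !mulf_neq0 ?invr_eq0.
  rewrite mem //=; have := mem _ _ n2 n4 _ x2 y2; rewrite -e => /(_ n5).
  by rewrite -(hyp_line_inv_sum n1 n2 n3 n4 n5 e).
have := leq_trans (subset_leq_card cover) (leq_trans (leq_card_setU _ _) (leq_add (leq_card_setU _ _) (leqnn _))).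
rewrite /T2plus -/T => /leq_trans; apply.
by rewrite !leq_add.
Qed.

Lemma cauchy_schwarz_sum (R : realFieldType) (I : finType) (A : {set I}) (f g : I -> R) :
  (\sum_(i in A) f i * g i) ^+ 2 <= (\sum_(i in A) f i ^+ 2) * (\sum_(i in A) g i ^+ 2).
Proof.
set a := \sum_(i in A) f i ^+ 2; set b := \sum_(i in A) g i ^+ 2.
set c := \sum_(i in A) _.
have a0 : 0 <= a by apply: sumr_ge0 => i _; apply: sqr_ge0.
have H : 0 <= a * (a * b - c ^+ 2).
  have -> : a * (a * b - c ^+ 2) = \sum_(i in A) (a * g i - c * f i) ^+ 2.
    transitivity (\sum_(i in A) (a ^+ 2 * g i ^+ 2 - 2 * a * c * (f i * g i) + c ^+ 2 * f i ^+ 2)).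
      by rewrite big_split sumrB /= -!mulr_sumr -/a -/b -/c; ring.
    by apply: eq_bigr => i _; ring.
  by apply: sumr_ge0 => i _; apply: sqr_ge0.
have [a_gt0|a_le0] := ltP 0 a; first by rewrite pmulr_rge0 // subr_ge0 in H.
have a00 : a = 0 by apply/eqP; rewrite eq_le a_le0.
have -> : c = 0; last by rewrite a00 expr0n mul0r.
rewrite /c big1 // => i iA; suff -> : f i = 0 by rewrite mul0r.
move/eqP: a00; rewrite psumr_eq0 => [|j _]; last exact: sqr_ge0.
by move=> /allP/(_ i (mem_index_enum _)); rewrite iA sqrf_eq0 => /eqP.
Qed.

Lemma sum_sqr_le (R : realFieldType) (I : finType) (A : {set I}) (f : I -> R) :
  (\sum_(i in A) f i) ^+ 2 <= #|A|%:R * \sum_(i in A) f i ^+ 2.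
Proof.
have := cauchy_schwarz_sum A (fun=> 1) f; under eq_bigr do rewrite mul1r.
by under [X in _ <= X * _]eq_bigr do rewrite expr1n; rewrite sumr_const.
Qed.

Lemma sum_sqr_le_nat (I : finType) (A : {set I}) (f : I -> nat) :
  ((\sum_(i in A) f i) ^ 2 <= #|A| * \sum_(i in A) f i ^ 2)%N.
Proof.
have := sum_sqr_le A (fun i => (f i)%:R : rat).
under [X in _ <= _ * X]eq_bigr do rewrite -natrX.
by rewrite -!natr_sum -natrX -natrM ler_nat.
Qed.

Lemma sum_fiber_le (R : realFieldType) (I J : finType) (D : {set I}) (L : I -> J) (m : nat) (g : J -> R) :
  (forall j, (#|[set i in D | L i == j]| <= m)%N) -> (forall j, 0 <= g j) ->
  \sum_(i in D) g (L i) <= m%:R * \sum_(j in L @: D) g j.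
Proof.
move=> Hm g0; rewrite (partition_big_imset L) /= mulr_sumr; apply: ler_sum => j _.
rewrite (eq_bigr (fun=> g j)); last by move=> i /andP[_ /eqP ->].
rewrite (eq_bigl (fun i => i \in [set i in D | L i == j])); last by move=> i; rewrite inE.
by rewrite sumr_const -[g j *+ _]mulr_natl; apply: ler_wpM2r => //; rewrite ler_nat.
Qed.

(** Variance over all lines: the second moment exceeds the square of the mean only by the
    contribution of the diagonal. *)
Lemma line_count_deviation (R : realFieldType) (F : finFieldType) (S : {set F}) :
  \sum_l ((line_count S l)%:R - #|S|%:R ^+ 2 / #|F|%:R) ^+ 2
    <= #|S|%:R ^+ 2 * #|F|%:R :> R.
Proof.
set e := _ / _; have F0 : #|F|%:R != 0 :> R.
  by rewrite pnatr_eq0 -lt0n; apply/card_gt0P; exists 0.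
have H1 : \sum_l (line_count S l)%:R = #|S|%:R ^+ 2 * #|F|%:R :> R.
  by rewrite -natr_sum sum_line_count natrM natrX.
have H2 : \sum_l (line_count S l)%:R ^+ 2 <= #|S|%:R ^+ 2 * #|F|%:R + #|S|%:R ^+ 4 :> R.
  under eq_bigr do rewrite -natrX; rewrite -natr_sum.
  apply: (@le_trans _ _ (#|S| ^ 2 * #|F| + #|S| ^ 4)%:R); last first.
    by rewrite natrD natrM !natrX.
  rewrite ler_nat; apply: leq_trans (sum_line_count2 S) _.
  by rewrite leq_add2l [(_ ^ 4)%N]expnSr leq_mul2l leq_subr orbT.
have -> : \sum_l ((line_count S l)%:R - e) ^+ 2 =
   \sum_l (line_count S l)%:R ^+ 2 - 2 * e * \sum_l (line_count S l)%:R + e ^+ 2 * #|F|%:R ^+ 2.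
  have -> : e ^+ 2 * #|F|%:R ^+ 2 = \sum_(l : F * F) e ^+ 2.
    by rewrite sumr_const card_prod -[_ *+ (_ * _)]mulr_natr natrM [#|F|%:R ^+ 2]expr2.
  rewrite mulr_sumr -sumrB -big_split /=.
  by apply: eq_bigr => l _; ring.
have -> : e ^+ 2 * #|F|%:R ^+ 2 = #|S|%:R ^+ 4 by rewrite /e; field.
rewrite H1; have -> : 2 * e * (#|S|%:R ^+ 2 * #|F|%:R) = 2 * #|S|%:R ^+ 4 by rewrite /e; field.
by lra.
Qed.

Lemma hyp_line_count_deviation (R : realFieldType) (F : finFieldType) (S B : {set F}) :
  0 \notin B ->
  (\sum_(d in off_diag B) ((line_count S (hyp_line d))%:R - #|S|%:R ^+ 2 / #|F|%:R)) ^+ 2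
  <= 2 * #|B|%:R ^+ 2 * (#|S|%:R ^+ 2 * #|F|%:R) :> R.
Proof.
move=> B0; apply: le_trans (sum_sqr_le _ _) _.
rewrite [2 * _]mulrC -[_ * 2 * _]mulrA; apply: ler_pM => //.
- by apply: sumr_ge0 => d _; apply: sqr_ge0.
- rewrite -natrX ler_nat -[(_ ^ 2)%N]mulnn -cardsX; apply: subset_leq_card.
  by apply/subsetP => d; rewrite inE => /andP[].
pose g l : R := ((line_count S l)%:R - #|S|%:R ^+ 2 / #|F|%:R) ^+ 2.
have g0 l : 0 <= g l by apply: sqr_ge0.
apply: le_trans (sum_fiber_le (g := g) (fun l => hyp_line_fiber l B0) g0) _.
rewrite ler_pM2l //; apply: le_trans (line_count_deviation _ _).
by rewrite big_mkcond; apply: ler_sum => l _; case: ifP => // _; apply: sqr_ge0.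
Qed.

(** * Small sumsets, through Rudnev's theorem *)

Section SmallRange.

Variables (p : nat) (pp : prime p) (S B : {set 'F_p}) (n : nat).
Hypotheses (S0 : 0 \notin S) (B0 : 0 \notin B) (Sn : (#|S| <= n)%N) (Bn : (#|B| <= n)%N).
Let L := @hyp_line _ @: off_diag B.
(** The lines are exchanged: (x, c', m') and (x', c, m) are incident exactly when m x + c = m' x' +
    c'. *)
Let P : {set 'F_p * 'F_p * 'F_p} := [set e | (e.1.1 \in S) && ((e.2, e.1.2) \in L)].

Lemma card_hyp_lines : (#|L| <= #|B| ^ 2)%N.
Proof.
apply: leq_trans (leq_imset_card _ _) _; rewrite -mulnn -cardsX.
by apply: subset_leq_card; apply/subsetP => d; rewrite inE => /andP[].
Qed.

Let card_P : (#|P| = #|S| * #|L|)%N.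
Proof.
rewrite -cardsX -(card_imset _ (f := fun e : 'F_p * 'F_p * 'F_p => (e.1.1, (e.2, e.1.2)))).
  apply: eq_card => -[s [m c]]; rewrite inE /=; apply/imsetP/andP => [[e]|[sS lL]].
    by rewrite inE => /andP[h1 h2] [-> -> ->].
  by exists (s, c, m); rewrite ?inE ?sS.
by move=> [[s c] m] [[s' c'] m'] [] /= -> -> ->.
Qed.

Let collinear_P (T : {set 'F_p * 'F_p * 'F_p}) : T \subset P ->
  (forall e1 e2 e3, e1 \in T -> e2 \in T -> e3 \in T -> collinear e1 e2 e3) ->
  (#|T| <= 2 * n)%N.
Proof.
move=> TP Hcol.
have [/forall_inP/(_ _ _)/forall_inP same|] := boolP [forall e1 in T, forall e2 in T, e1.1.1 == e2.1.1]; last first.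
  rewrite negb_forall_in => /exists_inP[e1 e1T]; rewrite negb_forall_in.
  move=> /exists_inP[e2 e2T d12]; rewrite eq_sym -subr_eq0 in d12.
  apply: (@leq_trans n); last by rewrite mul2n -addnn leq_addr.
  apply: leq_trans Sn; rewrite -(card_in_imset (f := fun e : 'F_p * 'F_p * 'F_p => e.1.1)).
    by apply: subset_leq_card; apply/subsetP => s /imsetP[e /(subsetP TP)]; rewrite inE => /andP[h _] ->.
  move=> e e' eT eT' E; have [h1 h2 _] := Hcol _ _ _ e1T e2T eT.
  have [h1' h2' _] := Hcol _ _ _ e1T e2T eT'; rewrite -E in h1' h2'.
  have := mulfI d12 (etrans h1 (esym h1')); have := mulfI d12 (etrans h2 (esym h2')).
  move=> /addIr E2 /addIr E12; move: E E12 E2.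
  by case: (e) => [[? ?] ?]; case: (e') => [[? ?] ?] /= -> -> ->.
have [T0|[e1 e1T]] := set_0Vmem T; first by rewrite T0 cards0.
have n_gt0 : (0 < n)%N.
  by apply: leq_trans Sn; apply/card_gt0P; exists e1.1.1; have := subsetP TP _ e1T; rewrite inE => /andP[].
have [/forall_inP one|] := boolP [forall e2 in T, e1 == e2].
  apply: (@leq_trans 1); last by lia.
  by rewrite -(cards1 e1); apply: subset_leq_card; apply/subsetP => e /one; rewrite inE eq_sym.
rewrite negb_forall_in => /exists_inP[e2 e2T d12].
pose h (e : 'F_p * 'F_p * 'F_p) := (e.2, e.1.2).
have h_inj : {in T &, injective h}.
  move=> e e' eT eT' []; move: (same _ eT _ eT') => /eqP.
  by case: (e) => [[? ?] ?]; case: (e') => [[? ?] ?] /= -> -> ->.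
rewrite -(card_in_imset h_inj).
apply: (@leq_trans (2 * #|B|)%N); last by rewrite leq_mul2l.
apply: (@hyp_line_concurrent _ B (- (e2.1.2 - e1.1.2)) (e2.2 - e1.2)
   ((e2.2 - e1.2) * e1.1.2 - (e2.1.2 - e1.1.2) * e1.2)) => //.
- apply: contraNneq d12 => /eqP; rewrite xpair_eqE oppr_eq0 !subr_eq0 => /andP[/eqP E1 /eqP E2].
  move: (same _ e1T _ e2T) E1 E2 => /eqP.
  by case: (e1) => [[? ?] ?]; case: (e2) => [[? ?] ?] /= -> -> ->.
- by apply/subsetP => l /imsetP[e /(subsetP TP)]; rewrite inE => /andP[_ hl] ->.
- move=> l /imsetP[e eT ->] /=; have [_ _ h3] := Hcol _ _ _ e1T e2T eT.
  apply/eqP; rewrite -subr_eq0; apply/eqP.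
  transitivity ((e.1.2 - e1.1.2) * (e2.2 - e1.2) - (e2.1.2 - e1.1.2) * (e.2 - e1.2)); first by ring.
  by rewrite h3 subrr.
Qed.

Let rich (s : 'F_p) : {set 'F_p * ('F_p * 'F_p)} :=
  [set z | [&& z.1 \in S, z.2 \in L & z.2.1 * z.1 + z.2.2 == s]].

Let sum_rich2 : (\sum_(s in S) #|rich s| ^ 2 <=
   #|[set e | [&& e.1 \in P, e.2 \in P & incid e.1 e.2]]|)%N.
Proof.
under eq_bigr do rewrite -mulnn -cardsX; rewrite sum_card_dep.
pose f (u : 'F_p * (('F_p * ('F_p * 'F_p)) * ('F_p * ('F_p * 'F_p)))) :
   ('F_p * 'F_p * 'F_p) * ('F_p * 'F_p * 'F_p) :=
  ((u.2.1.1, u.2.2.2.2, u.2.2.2.1), (u.2.2.1, u.2.1.2.2, u.2.1.2.1)).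
rewrite -(card_in_imset (f := f)).
  apply: subset_leq_card; apply/subsetP => _ /imsetP[[s [[x [m c]] [x' [m' c']]]] + ->].
  rewrite !inE /= => /and5P[_ /and3P[h1 h2 /eqP h3] h4 h5 /eqP h6].
  by rewrite h1 h2 h4 h5 /incid /=; rewrite (addrC c') (mulrC x') h6 (addrC c) (mulrC x) h3.
move=> [s [[x [m c]] [x' [m' c']]]] [s1 [[x1 [m1 c1]] [x1' [m1' c1']]]].
rewrite !inE /= => /and3P[_ /and3P[_ _ /eqP <-] _] /and3P[_ /and3P[_ _ /eqP <-] _].
by move=> [] -> -> -> -> -> ->.
Qed.

Let sum_rich : (\sum_(l in L) line_count S l <= \sum_(s in S) #|rich s|)%N.
Proof.
rewrite /line_count !sum_card_dep.
pose f (u : 'F_p * 'F_p * 'F_p) := (u.1.1 * u.2 + u.1.2, (u.2, u.1)).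
have f_inj : injective f by move=> [[m c] x] [[m' c'] x'] [_ -> -> ->].
rewrite -(card_imset _ f_inj); apply: subset_leq_card.
by apply/subsetP => _ /imsetP[[[m c] x] + ->]; rewrite !inE /= eqxx andbT => /and3P[-> -> ->].
Qed.

(** Cauchy-Schwarz over the common value passes to coincidences m x + c = m' x' + c', which are
    incidences in P. In Q = 64 r (t + n) the term t dominates the square root of |P|, and n the
    collinear subsets. *)
Lemma line_count_small_range (r t : nat) :
  (864 * 32 <= r)%N -> (#|S| * #|L| <= p ^ 2)%N -> (n * #|B| ^ 2 <= t ^ 2)%N ->
  ((\sum_(l in L) line_count S l) ^ 2 <= 128 * r * n ^ 2 * #|B| ^ 2 * (t + n))%N.
Proof.
move=> Hr Hp Ht.
apply: (@leq_trans (n * \sum_(s in S) #|rich s| ^ 2)%N).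
  apply: (@leq_trans ((\sum_(s in S) #|rich s|) ^ 2)%N); first by rewrite leq_exp2r // sum_rich.
  by apply: leq_trans (sum_sqr_le_nat _ _) _; rewrite leq_mul2r Sn orbT.
have [->|n_gt0] := posnP n; first by rewrite mul0n.
have PN : (#|P| <= n * #|B| ^ 2)%N by rewrite card_P leq_mul ?card_hyp_lines.
have Q_gt : (432 * r * (2 * #|P|) < (64 * r * (t + n)) ^ 2)%N.
  have Pt := leq_trans PN Ht; have r0 : (0 < r)%N by apply: leq_trans Hr.
  rewrite (expnMn _ (t + n)); apply: (@leq_ltn_trans (864 * r ^ 2 * t ^ 2)).
    by rewrite -mulnn; nia.
  by rewrite !expnMn; clear -r0 n_gt0; nia.
have S_neq0 e : e \in P -> e.1.1 != 0.
  by rewrite inE => /andP[h _]; apply: contraNneq S0 => <-.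
have Pp : (#|P| <= p ^ 2)%N by rewrite card_P.
have Q1 : (64 * r <= 64 * r * (t + n))%N by rewrite leq_pmulr ?addn_gt0 ?n_gt0 ?orbT.
have Q2 : (4 * (2 * n) <= 64 * r * (t + n))%N.
  by clear -Hr; nia.
have Hinc := leq_trans sum_rich2 (rudnev pp S_neq0 collinear_P Pp Hr Q_gt Q1 Q2).
apply: (@leq_trans (n * (2 * (64 * r * (t + n)) * (n * #|B| ^ 2)))%N).
  by rewrite leq_mul2l (leq_trans Hinc) ?orbT // leq_mul2l PN orbT.
by apply: eq_leq; clear; lia.
Qed.

End SmallRange.

Lemma ceil_sqrt (m : nat) : exists t : nat, (m <= t ^ 2)%N /\ (t = 0 \/ (t.-1 ^ 2 <= m)%N)%N.
Proof.
have ex : exists t, (m <= t ^ 2)%N by exists m; rewrite expnS expn1; nia.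
exists (ex_minn ex); case: ex_minnP => t Ht Hmin; split=> //.
case: t Ht Hmin => [|t] Ht Hmin; [by left|right=> /=].
by rewrite ltnW // ltnNge; apply/negP => /Hmin; rewrite ltnn.
Qed.

(* When n |B|^2 >= p^2 the second moment over all lines suffices, otherwise Rudnev's
   theorem applies; u and v avoid the roots n^(1/4) and |B|^(1/2). *)
Lemma hyp_line_count_bound (R : realFieldType) (p : nat) (S B : {set 'F_p}) (n r : nat) (u v : R) :
  prime p -> (864 * 32 <= r)%N -> 0 \notin S -> 0 \notin B ->
  (#|S| <= n)%N -> (#|B| <= n)%N -> 1 <= u -> 0 <= v ->
  n%:R = u ^+ 4 -> #|B|%:R <= v ^+ 2 ->
  \sum_(d in off_diag B) (line_count S (hyp_line d))%:R <=
    n%:R ^+ 2 * (v ^+ 2) ^+ 2 / p%:R + 2 * r%:R * (u ^+ 5 * v ^+ 3 + u ^+ 8).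
Proof.
move=> pp Hr S0 B0 Sn Bn u1 v0 nu bv.
have p_gt0 : 0 < p%:R :> R by rewrite ltr0n prime_gt0.
have u0 : 0 < u by apply: lt_le_trans u1.
have r1 : 1 <= r%:R :> R by rewrite ler1n (leq_trans _ Hr).
have r384 : 384 <= r%:R :> R by rewrite ler_nat; apply: leq_trans Hr; lia.
set W := \sum_(d in _) _.
have bound0 : 0 <= n%:R ^+ 2 * (v ^+ 2) ^+ 2 / p%:R :> R.
  by rewrite !mulr_ge0 ?exprn_ge0 ?invr_ge0 ?ler0n.
have uv0 : 0 <= u ^+ 5 * v ^+ 3 by rewrite mulr_ge0 ?exprn_ge0 // ltW.
have u80 : 0 <= u ^+ 8 by rewrite exprn_ge0 // ltW.
have [big|small] := leP (p%:R ^+ 2) (n%:R * (v ^+ 2) ^+ 2).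
  have puv : p%:R <= u ^+ 2 * v ^+ 2.
    rewrite -ler_sqr ?nnegrE ?mulr_ge0 ?exprn_ge0 ?(ltW u0) ?ler0n //.
    by apply: le_trans big _; rewrite nu [leRHS](_ : _ = u ^+ 4 * (v ^+ 2) ^+ 2) //; ring.
  have := @hyp_line_count_deviation R _ S B B0.
  rewrite card_Fp // sumrB -/W sumr_const -[_ *+ _]mulr_natl.
  set e := _ / _; set y := W - _ => Hy.
  have De : #|off_diag B|%:R * e <= n%:R ^+ 2 * (v ^+ 2) ^+ 2 / p%:R.
    rewrite /e mulrA ler_pM2r ?invr_gt0 // (mulrC (n%:R ^+ 2)); apply: ler_pM => //.
      by rewrite exprn_ge0.
      apply: (@le_trans _ _ (#|B|%:R ^+ 2)); last by rewrite ler_pXn2r ?nnegrE ?exprn_ge0.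
      rewrite -natrX ler_nat -mulnn -cardsX; apply: subset_leq_card.
      by apply/subsetP => d; rewrite inE => /andP[].
    by rewrite ler_pXn2r ?nnegrE ?ler0n // ler_nat.
  have y_le : y <= 2 * (u ^+ 5 * v ^+ 3).
    have [y_le0|y_gt0] := leP y 0; first by apply: le_trans y_le0 _; lra.
    rewrite -ler_sqr ?nnegrE ?(ltW y_gt0) //; last by lra.
    apply: le_trans Hy _.
    apply: (@le_trans _ _ (2 * (v ^+ 2) ^+ 2 * ((u ^+ 4) ^+ 2 * (u ^+ 2 * v ^+ 2)))).
      have v20 : 0 <= v ^+ 2 by rewrite exprn_ge0.
      apply: ler_pM; rewrite ?mulr_ge0 ?exprn_ge0 ?ler0n //.
        by rewrite ler_pM2l // ler_pXn2r ?nnegrE ?ler0n.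
      apply: ler_pM; rewrite ?exprn_ge0 ?ler0n //.
      by rewrite ler_pXn2r ?nnegrE ?ler0n ?exprn_ge0 ?(ltW u0) // -nu ler_nat.
    rewrite -subr_ge0.
    have -> : (2 * (u ^+ 5 * v ^+ 3)) ^+ 2 - 2 * (v ^+ 2) ^+ 2 * ((u ^+ 4) ^+ 2 * (u ^+ 2 * v ^+ 2))
      = 2 * (u ^+ 5 * v ^+ 3) ^+ 2 by ring.
    by rewrite mulr_ge0 ?sqr_ge0.
  have : W = #|off_diag B|%:R * e + y by rewrite /y; ring.
  have H1 : 1 * (u ^+ 5 * v ^+ 3 + u ^+ 8) <= r%:R * (u ^+ 5 * v ^+ 3 + u ^+ 8).
    by rewrite ler_wpM2r // addr_ge0.
  move=> ->; rewrite -mulrA; lra.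
set L := @hyp_line _ @: off_diag B.
have [t [Ht1 Ht2]] := ceil_sqrt (n * #|B| ^ 2).
have Hp : (#|S| * #|L| <= p ^ 2)%N.
  have H : (n * #|B| ^ 2 <= p ^ 2)%N.
    rewrite -(ler_nat R) natrM !natrX; apply: le_trans (ltW small).
    by rewrite ler_wpM2l // ler_pXn2r ?nnegrE ?ler0n ?exprn_ge0.
  by apply: leq_trans (leq_mul Sn (card_hyp_lines B)) H.
have := line_count_small_range pp S0 B0 Sn Bn Hr Hp Ht1; rewrite -/L.
rewrite -(ler_nat R) natrX natr_sum !natrM natrD -!expr2.
set V := \sum_(l in L) _ => HV.
have WV : W <= 2 * V.
  exact: (sum_fiber_le (g := fun l => (line_count S l)%:R) (fun l => hyp_line_fiber l B0)).
have V0 : 0 <= V by apply: sumr_ge0.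
have t_le : t%:R <= u ^+ 2 * v ^+ 2 + 1.
  have uv20 : 0 <= u ^+ 2 * v ^+ 2 by rewrite mulr_ge0 ?exprn_ge0 // ltW.
  case: Ht2 => [->|]; first by rewrite addr_ge0.
  case: t {Ht1 HV} => [|t] /= Ht; first by rewrite addr_ge0.
  rewrite -natr1 lerD2r -ler_sqr ?nnegrE //.
  move: Ht; rewrite -(ler_nat R) natrM !natrX nu => /le_trans; apply.
  have -> : (u ^+ 2 * v ^+ 2) ^+ 2 = u ^+ 4 * (v ^+ 2) ^+ 2 by ring.
  by rewrite ler_wpM2l ?exprn_ge0 ?(ltW u0) // ler_pXn2r ?nnegrE ?ler0n ?exprn_ge0.
have V2 : V ^+ 2 <= (r%:R * (u ^+ 5 * v ^+ 3 + u ^+ 8)) ^+ 2.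
  apply: le_trans HV _; rewrite nu.
  have u41 : 1 <= u ^+ 4 by rewrite exprn_ege1.
  apply: (@le_trans _ _ (128 * r%:R * (u ^+ 4) ^+ 2 * (v ^+ 2) ^+ 2 * (u ^+ 2 * v ^+ 2 + 2 * u ^+ 4))).
    apply: ler_pM; rewrite ?mulr_ge0 ?exprn_ge0 ?ler0n ?(ltW u0) //.
    - by rewrite addr_ge0 ?exprn_ge0 ?(ltW u0).
    - rewrite ler_wpM2l ?mulr_ge0 ?exprn_ge0 ?ler0n ?(ltW u0) //.
      by rewrite ler_pXn2r ?nnegrE ?ler0n ?exprn_ge0.
    - by lra.
  (* The mixed term is at most (u^5 v^3)^2 when u <= v, and at most (u^8)^2 otherwise. *)
  have H : u ^+ 12 * v ^+ 4 <= (u ^+ 5 * v ^+ 3 + u ^+ 8) ^+ 2.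
    have e2 : (u ^+ 5 * v ^+ 3 + u ^+ 8) ^+ 2 =
       u ^+ 10 * v ^+ 6 + 2 * (u ^+ 5 * v ^+ 3) * u ^+ 8 + u ^+ 16 by ring.
    have m0 : 0 <= 2 * (u ^+ 5 * v ^+ 3) * u ^+ 8 by rewrite mulr_ge0 // mulr_ge0.
    have p0 : 0 <= u ^+ 10 * v ^+ 6 by rewrite mulr_ge0 ?exprn_ge0 // ltW.
    have q0 : 0 <= u ^+ 16 by rewrite exprn_ge0 // ltW.
    rewrite e2; have [uv|vu] := leP u v.
      apply: (@le_trans _ _ (u ^+ 10 * v ^+ 6)); last by lra.
      have -> : u ^+ 12 * v ^+ 4 = u ^+ 10 * v ^+ 4 * u ^+ 2 by ring.
      have -> : u ^+ 10 * v ^+ 6 = u ^+ 10 * v ^+ 4 * v ^+ 2 by ring.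
      by rewrite ler_wpM2l ?mulr_ge0 ?exprn_ge0 ?(ltW u0) // ler_pXn2r ?nnegrE ?(ltW u0).
    apply: (@le_trans _ _ (u ^+ 16)); last by lra.
    have -> : u ^+ 16 = u ^+ 12 * u ^+ 4 by ring.
    by rewrite ler_wpM2l ?exprn_ge0 ?(ltW u0) // ler_pXn2r ?nnegrE ?(ltW u0) // ltW.
  have H' : u ^+ 10 * v ^+ 6 <= (u ^+ 5 * v ^+ 3 + u ^+ 8) ^+ 2.
    have -> : u ^+ 10 * v ^+ 6 = (u ^+ 5 * v ^+ 3) ^+ 2 by ring.
    by rewrite ler_pXn2r ?nnegrE ?addr_ge0 // lerDl.
  have -> : 128 * r%:R * (u ^+ 4) ^+ 2 * (v ^+ 2) ^+ 2 * (u ^+ 2 * v ^+ 2 + 2 * u ^+ 4) =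
    r%:R * (128 * (u ^+ 10 * v ^+ 6) + 256 * (u ^+ 12 * v ^+ 4)) by ring.
  set Y := (_ + u ^+ 8) in H H' *.
  apply: (@le_trans _ _ (r%:R * (384 * Y ^+ 2))); first by rewrite ler_wpM2l //; lra.
  have -> : (r%:R * Y) ^+ 2 = r%:R * (r%:R * Y ^+ 2) by ring.
  by rewrite ler_wpM2l // ler_wpM2r ?sqr_ge0.
rewrite ler_sqr ?nnegrE // in V2; last by rewrite mulr_ge0 // addr_ge0.
lra.
Qed.

(** With n = |A + B|, u^5 v^3 is n^(5/4) |B|^(3/2) and u^8 is n^2. The trivial solutions number at
    most 2 n^2, since A and B both embed into A + B. *)
Lemma T2plus_invset_bound (R : realType) (p : nat) (A B : {set 'F_p}) (K : R) (r : nat) :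
  prime p -> (864 * 32 <= r)%N -> B != set0 -> 1 <= K -> #|sumset A B|%:R <= K * #|A|%:R ->
  (T2plus (invset A) (invset B))%:R - K ^+ 2 * #|A|%:R ^+ 2 * #|B|%:R ^+ 2 / p%:R
    <= (2 * r%:R + 2) *
       (K `^ (5 / 4) * #|A|%:R `^ (5 / 4) * #|B|%:R `^ (3 / 2) + K ^+ 2 * #|A|%:R ^+ 2).
Proof.
move=> pp Hr /set0Pn[b0 b0B] K1 Kn.
have p_gt0 : 0 < p%:R :> R by rewrite ltr0n prime_gt0.
have r1 : 1 <= r%:R :> R by rewrite ler1n (leq_trans _ Hr).
have c0 : 0 <= 2 * r%:R + 2 :> R by rewrite addr_ge0 // mulr_ge0 // (le_trans _ r1).
have K0 : 0 <= K by rewrite (le_trans _ K1).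
have [A0|[a0 a0A]] := set_0Vmem A.
  have -> : T2plus (invset A) (invset B) = 0%N.
    apply/eqP; rewrite cards_eq0; apply/eqP/setP => q; rewrite !inE; apply/negP => /andP[/invsetP[_]].
    by rewrite A0 inE.
  rewrite sub0r; apply: (@le_trans _ _ 0).
    by rewrite oppr_le0 !mulr_ge0 ?exprn_ge0 ?invr_ge0 ?ler0n.
  by rewrite mulr_ge0 // addr_ge0 ?mulr_ge0 ?powR_ge0 ?exprn_ge0.
have An : (#|A| <= #|sumset A B|)%N.
  rewrite -(card_imset _ (addIr b0)); apply: subset_leq_card.
  by apply/subsetP => _ /imsetP[a aA ->]; apply/imset2P; exists a b0.
have Bn : (#|B| <= #|sumset A B|)%N.
  rewrite -(card_imset _ (addrI a0)); apply: subset_leq_card.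
  by apply/subsetP => _ /imsetP[b bB ->]; apply/imset2P; exists a0 b.
set n := #|sumset A B| in Kn An Bn.
have n1 : 1 <= n%:R :> R by rewrite ler1n (leq_trans _ An) // card_gt0; apply/set0Pn; exists a0.
pose u := n%:R `^ (1 / 4) : R; pose v := #|B|%:R `^ (1 / 2) : R.
have n0 : 0 <= n%:R :> R by [].
have pX (x y z : R) (k : nat) : y * k%:R = z -> x `^ y ^+ k = x `^ z.
  by move=> <-; rewrite powRrM powR_mulrn ?powR_ge0.
have nu : n%:R = u ^+ 4 by rewrite (pX _ _ 1) ?powRr1 //; field.
have bv : #|B|%:R = v ^+ 2 by rewrite (pX _ _ 1) ?powRr1 //; field.
have u1 : 1 <= u by rewrite /u -[leLHS](powRr0 n%:R); apply: ler_powR => //; rewrite divr_ge0.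
have v0 : 0 <= v by apply: powR_ge0.
have Bv' : #|B :\ 0|%:R <= v ^+ 2 by rewrite -bv ler_nat subset_leq_card ?subD1set.
have Bn' : (#|B :\ 0%R| <= n)%N by rewrite (leq_trans _ Bn) ?subset_leq_card ?subD1set.
have Sn : (#|invset (sumset A B)| <= n)%N by apply: card_invset.
have S0 : 0 \notin invset (sumset A B) by apply/negP => /invsetP[]; rewrite eqxx.
have B0 : 0 \notin B :\ 0 by rewrite !inE eqxx.
have HW := hyp_line_count_bound pp Hr S0 B0 Sn Bn' u1 v0 nu Bv'.
have := T2plus_invset_line_count A B; rewrite -(ler_nat R) natrD natr_sum => HT.
have e8 : n%:R ^+ 2 = u ^+ 8 by rewrite nu -exprM.
have HBA : (#|B| ^ 2 + #|A| * #|B|)%:R <= 2 * u ^+ 8 :> R.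
  rewrite -e8 -natrX -natrM ler_nat mul2n -addnn -mulnn.
  by rewrite leq_add // leq_mul.
have u5 : u ^+ 5 <= K `^ (5 / 4) * #|A|%:R `^ (5 / 4).
  rewrite -powRM // (pX _ _ (5 / 4)); last by field.
  apply: ge0_ler_powR; rewrite ?nnegrE ?mulr_ge0 ?invr_ge0 //.
have v3 : v ^+ 3 = #|B|%:R `^ (3 / 2) by rewrite (pX _ _ (3 / 2)) //; field.
have KA : n%:R ^+ 2 <= K ^+ 2 * #|A|%:R ^+ 2.
  by rewrite -exprMn ler_pXn2r ?nnegrE ?mulr_ge0.
have main : n%:R ^+ 2 * (v ^+ 2) ^+ 2 / p%:R <= K ^+ 2 * #|A|%:R ^+ 2 * #|B|%:R ^+ 2 / p%:R.
  by rewrite -bv ler_pM2r ?invr_gt0 // ler_wpM2r ?exprn_ge0.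
rewrite -v3; set X := K ^+ 2 * #|A|%:R ^+ 2 in KA main *.
have uv : u ^+ 5 * v ^+ 3 <= K `^ (5 / 4) * #|A|%:R `^ (5 / 4) * v ^+ 3.
  by rewrite ler_wpM2r ?exprn_ge0.
set Y := K `^ _ * _ * v ^+ 3 in uv *.
have Y0 : 0 <= Y by rewrite !mulr_ge0 ?powR_ge0 ?exprn_ge0.
rewrite e8 in KA.
have : 2 * r%:R * (u ^+ 5 * v ^+ 3 + u ^+ 8) <= 2 * r%:R * (Y + X).
  by rewrite ler_wpM2l ?lerD // mulr_ge0.
move: HT HW HBA main KA Y0; set T := (T2plus _ _)%:R; set W := \sum_(d in _) _.
lra.
Qed.

(** * Approximate groups *)

Definition quotset (gT : finGroupType) (A : {set gT}) : {set gT} :=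
  [set (x * y^-1)%g | x in A, y in A].

(** * The Balog-Szemeredi-Gowers theorem *)

Section BalogSzemerediGowers.

Local Open Scope group_scope.

Variables (gT : finGroupType) (Y Z : {set gT}) (K : nat).
Hypothesis Zsym : forall x, (x^-1 \in Z) = (x \in Z).
Hypothesis Y_gt0 : (0 < #|Y|)%N.
Hypothesis Zsmall : (#|Z| <= K * #|Y|)%N.

Let adj x := [set y in Y | x * y^-1 \in Z].
Hypothesis dense : (#|Y| ^ 2 <= K * \sum_(x in Y) #|adj x|)%N.

Let n := #|Y|.
Let adj_sym x y : x \in Y -> y \in Y -> (x \in adj y) = (y \in adj x).
Proof. by move=> xY yY; rewrite !inE xY yY -Zsym invMg invgK. Qed.

Let codeg x x' := #|adj x :&: adj x'|.
Let bad x x' := (32 * K ^ 2 * codeg x x' < n)%N.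
Let badin v x := [set x' in adj v | bad x x'].

Let sum_bad : (32 * K ^ 2 * \sum_(v in Y) \sum_(x in adj v) #|badin v x| <= n ^ 3)%N.
Proof.
have -> : (\sum_(v in Y) \sum_(x in adj v) #|badin v x| =
   \sum_(x in Y) \sum_(x' in Y | bad x x') codeg x x')%N.
  transitivity (\sum_(v in Y) \sum_(x in Y) \sum_(x' in Y | bad x x')
       ((v \in adj x) && (v \in adj x')))%N.
    apply: eq_bigr => v vY.
    rewrite (eq_bigl (fun x => (x \in Y) && (v \in adj x))); last first.
      move=> x; case xY: (x \in Y); first by rewrite adj_sym.
      by rewrite !inE xY.
    rewrite big_mkcondr; apply: eq_bigr => x xY; case vx: (v \in adj x); last by rewrite big1.
    rewrite -sum1_card big_mkcond [RHS]big_mkcond; apply: eq_bigr => x' _; rewrite inE /=.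
    case x'Y: (x' \in Y); last by rewrite inE x'Y.
    by rewrite adj_sym //; case: (v \in adj x'); case: (bad x x').
  rewrite exchange_big; apply: eq_bigr => x xY; rewrite exchange_big; apply: eq_bigr => x' _.
  rewrite /codeg -sum1_card [LHS]big_mkcond [RHS]big_mkcond; apply: eq_bigr => v _.
  by rewrite !inE; case: (v \in Y); case: (_ \in Z); case: (_ \in Z).
have -> : (n ^ 3 = n * (n * n))%N by rewrite !expnS expn0 muln1.
rewrite /n -sum_nat_const big_distrr; apply: leq_sum => x xY /=.
rewrite -sum_nat_const big_distrr [X in (X <= _)%N]big_mkcondr.
by apply: leq_sum => x' x'Y /=; case: ifP => // h; apply: ltnW h.
Qed.

(* Averaging: some neighbourhood is large and contains few pairs of small codegree. *)
Let pivot : exists2 v, v \in Y &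
  (n ^ 2 + 32 * K ^ 2 * \sum_(x in adj v) #|badin v x| <= 2 * K ^ 2 * #|adj v| ^ 2)%N.
Proof.
apply/exists_inP; apply: contraT; rewrite negb_exists_in => /forall_inP H.
have S2 : (n ^ 3 <= K ^ 2 * \sum_(v in Y) #|adj v| ^ 2)%N.
  rewrite -(leq_pmul2l Y_gt0) -expnS.
  apply: (@leq_trans ((K * \sum_(v in Y) #|adj v|) ^ 2)%N).
    by rewrite -[(n ^ _)%N]/(n ^ (2 * 2))%N expnM leq_exp2r.
  by rewrite expnMn mulnCA leq_mul2l sum_sqr_le_nat orbT.
have : (\sum_(v in Y) (2 * K ^ 2 * #|adj v| ^ 2).+1 <=
    \sum_(v in Y) (n ^ 2 + 32 * K ^ 2 * \sum_(x in adj v) #|badin v x|))%N.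
  by apply: leq_sum => v vY; rewrite ltnNge H.
rewrite big_split /= -!big_distrr /=.
under eq_bigr do rewrite -addn1.
rewrite big_split /= -!big_distrr /= !sum_nat_const muln1 -/n mulnn -expnS.
move: sum_bad S2 Y_gt0; rewrite -/n; move: (_ * _)%N => a.
move: (\sum_(v in Y) #|adj v| ^ 2)%N => b.
by move: (n ^ 3)%N => c; rewrite -mulnA; move: (K ^ 2 * b)%N => d; lia.
Qed.

(** X collects the elements of one neighbourhood that lie in few bad pairs. For x, x' in X at least
    half of the w in that neighbourhood have many common neighbours a with x and c with x', so x
    x'^-1 = (x a^-1)(a w^-1)(w c^-1)(c x'^-1) is in many ways a product of four elements of Z. *)
Theorem bsg : exists X : {set gT}, [/\ X \subset Y, (#|Y| <= 4 * K * #|X|)%N &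
  (#|quotset X| <= 2 ^ 12 * K ^ 9 * #|Y|)%N].
Proof.
have [v vY Hv] := pivot.
set N := adj v in Hv.
pose X := [set x in N | (4 * #|badin v x| <= #|N|)%N].
have XN : X \subset N by apply/subsetP => x; rewrite inE => /andP[].
have NY : N \subset Y by apply/subsetP => x; rewrite inE => /andP[].
have K_gt0 : (0 < K)%N.
  by rewrite lt0n; apply: contraTneq dense => ->; rewrite mul0n -ltnNge expn_gt0 Y_gt0.
have bad16 : (16 * \sum_(x in N) #|badin v x| <= #|N| ^ 2)%N.
  have K2 : (0 < 2 * K ^ 2)%N by rewrite muln_gt0 expn_gt0 K_gt0.
  rewrite -(leq_pmul2l K2); apply: leq_trans Hv; apply: leq_trans (leq_addl _ _).
  by rewrite mulnA; apply: eq_leq; congr (_ * _)%N; lia.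
have nN : (n <= 2 * K * #|N|)%N.
  rewrite -(@leq_exp2r _ _ 2) // !expnMn; apply: leq_trans (leq_addr _ _) (leq_trans Hv _).
  by rewrite leq_mul2r leq_mul2r; apply/orP; right; apply/orP; right.
have N_gt0 : (0 < #|N|)%N by move: nN Y_gt0; rewrite -/n; case: #|N| => //; rewrite muln0; case: n.
have NX : (#|N| <= 2 * #|X|)%N.
  have : (#|N :\: X| * #|N| <= 4 * \sum_(x in N) #|badin v x|)%N.
    apply: (@leq_trans (\sum_(x in N :\: X) 4 * #|badin v x|)%N); last first.
      rewrite -big_distrr leq_mul2l /=.
      rewrite [X in (_ <= X)%N](big_setID X) /= leq_addl //.
    rewrite -sum_nat_const; apply: leq_sum => x; rewrite !inE => /andP[h /andP[h1 h2]].
    by move: h; rewrite h1 h2 /= -ltnNge => /ltnW.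
  have := cardsID X N; rewrite (setIidPr XN); move: bad16 N_gt0.
  move: (\sum_(x in N) _)%N => a; move: #|N :\: X| #|X| #|N| => b c e h1 h2 h3 h4.
  have : (4 * b * e <= e * e)%N by nia.
  rewrite leq_pmul2r //; lia.
exists X; split; first exact: subset_trans XN NY.
  by apply: leq_trans nN _; nia.
pose M : {set gT * (gT * (gT * gT))} := [set z | [&& z.1 \in quotset X,
   z.2.1 \in Z, z.2.2.1 \in Z, z.2.2.2 \in Z & (z.2.1 * z.2.2.1 * z.2.2.2)^-1 * z.1 \in Z]].
have M_le : (#|M| <= #|Z| ^ 4)%N.
  have inj : injective (fun z : gT * (gT * (gT * gT)) =>
     (((z.2.1, z.2.2.1), z.2.2.2), (z.2.1 * z.2.2.1 * z.2.2.2)^-1 * z.1)).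
    by move=> [g [z1 [z2 z3]]] [g' [z1' [z2' z3']]] [] /= -> -> -> /mulgI ->.
  rewrite -(card_imset _ inj) !expnS expn0 muln1 !mulnA -!cardsX; apply: subset_leq_card.
  by apply/subsetP => _ /imsetP[z + ->]; rewrite !inE /= => /and5P[_ -> -> -> ->].
have paths g : g \in quotset X ->
   (#|N| * n ^ 2 <= 2 * (32 * K ^ 2) ^ 2 * #|[set z | (g, z) \in M]|)%N.
  move=> gX; have /imset2P[x x' xX x'X Eg] := gX.
  have xY := subsetP (subset_trans XN NY) _ xX; have x'Y := subsetP (subset_trans XN NY) _ x'X.
  pose Wg := [set w in N | ~~ bad x w && ~~ bad x' w].
  have Wg_big : (#|N| <= 2 * #|Wg|)%N.
    have cov : N \subset Wg :|: (badin v x :|: badin v x').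
      by apply/subsetP => w; rewrite !inE => /andP[-> ->] /=; case: (bad x w); case: (bad x' w); rewrite ?orbT.
    have := leq_trans (subset_leq_card cov) (leq_trans (leq_card_setU _ _) (leq_add (leqnn _) (leq_card_setU _ _))).
    by move: xX x'X; rewrite !inE => /andP[_ h1] /andP[_ h2]; lia.
  pose P : {set gT * (gT * gT)} :=
    [set z | (z.1 \in Wg) && (z.2 \in setX (adj x :&: adj z.1) (adj x' :&: adj z.1))].
  have P_le : (#|P| <= #|[set z | (g, z) \in M]|)%N.
    pose h (z : gT * (gT * gT)) := (x * z.2.1^-1, (z.2.1 * z.1^-1, z.1 * z.2.2^-1)).
    have h_inj : injective h.
      move=> [w [a c]] [w' [a' c']] [] /= /mulgI/invg_inj -> /mulgI/invg_inj -> /mulgI/invg_inj ->.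
      by [].
    rewrite -(card_imset P h_inj); apply: subset_leq_card; apply/subsetP => y /imsetP. move=> [[w [a c]] + ->].
    rewrite !inE /= gX Eg => /and3P[_ /andP[/andP[_ h1] /andP[aY h2]] /andP[/andP[cY h3] /andP[_ h4]]].
    rewrite h1 h4 -Zsym invMg invgK h2 /= !invMg !invgK !mulgA mulgKV mulgKV mulgKV.
    by rewrite -Zsym invMg invgK.
  apply: (@leq_trans (2 * (32 * K ^ 2) ^ 2 * #|P|)%N); last by rewrite leq_mul2l P_le orbT.
  rewrite -(sum_card_dep Wg (fun w => setX (adj x :&: adj w) (adj x' :&: adj w))).
  have : (\sum_(w in Wg) n ^ 2 <= (32 * K ^ 2) ^ 2 * \sum_(w in Wg) #|setX (adj x :&: adj w) (adj x' :&: adj w)|)%N.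
    rewrite big_distrr /=; apply: leq_sum => w; rewrite inE /bad -!leqNgt => /and3P[_ h1 h2].
    rewrite cardsX -[((32 * _) ^ 2)%N]mulnn mulnACA -[(n ^ 2)%N]mulnn.
    exact: leq_mul.
  by rewrite sum_nat_const -mulnA; move: Wg_big; nia.
have : (\sum_(g in quotset X) #|N| * n ^ 2 <= 2 * (32 * K ^ 2) ^ 2 * #|Z| ^ 4)%N.
  apply: leq_trans (leq_mul (leqnn _) M_le).
  have -> : (#|M| = \sum_(g in quotset X) #|[set z | (g, z) \in M]|)%N.
    rewrite sum_card_dep; apply: eq_card => -[g z]; rewrite [RHS]inE /= [in RHS]inE.
    by rewrite [LHS]inE [in RHS]inE /=; case: (g \in _).
  by rewrite big_distrr /=; apply: leq_sum => g /paths.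
rewrite sum_nat_const; move: #|quotset X| => w Hw.
have Z4 : (#|Z| ^ 4 <= K ^ 4 * n ^ 4)%N by rewrite -expnMn leq_exp2r.
have n_gt0 : (0 < n)%N := Y_gt0.
have n3 : (0 < n ^ 3)%N by rewrite expn_gt0 n_gt0.
rewrite -(leq_pmul2r n3) -/n.
apply: (@leq_trans (2 * K * (w * (#|N| * n ^ 2)))%N).
  by rewrite (expnS n 2) mulnA mulnCA mulnA !mulnA leq_mul2r; apply/orP; right; nia.
apply: (@leq_trans (2 * K * (2 * (32 * K ^ 2) ^ 2 * (K ^ 4 * n ^ 4)))%N).
  by rewrite leq_mul2l (leq_trans Hw) ?orbT // leq_mul2l Z4 orbT.
have -> : ((32 * K ^ 2) ^ 2 = 2 ^ 10 * K ^ 4)%N by rewrite expnMn -expnM.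
have -> : (K ^ 9 = K * K ^ 4 * K ^ 4)%N by rewrite -expnS -expnD.
have -> : (2 ^ 12 = 2 * 2 * 2 ^ 10)%N by [].
by rewrite [(n ^ 4)%N]expnS; move: (2 ^ 10)%N (K ^ 4)%N (n ^ 3)%N => a b c; apply: eq_leq; lia.
Qed.

End BalogSzemerediGowers.

(** * From a small quotient set to an approximate group *)

Section ApproximateGroup.

Local Open Scope group_scope.

Variables (gT : finGroupType) (A : {set gT}) (K : nat).
Hypotheses (A_gt0 : (0 < #|A|)%N) (small : (#|quotset A| <= K * #|A|)%N).

Let stay x := [set a in A | a * x \in A].
(** The almost symmetries of A. Unlike A, this set contains 1 and is closed under inverses. *)
Let S := [set x | (#|A| <= 2 * K * #|stay x|)%N].

Let sum_stay : (\sum_x #|stay x| = #|A| ^ 2)%N.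
Proof.
rewrite -mulnn -cardsX (eq_bigl (fun x => x \in [set: gT])) => [|x]; last by rewrite inE.
rewrite sum_card_dep; pose h (z : gT * gT) := (z.2, z.2 * z.1).
have h_inj : injective h by move=> [x a] [x' a'] [/= -> /mulgI ->].
rewrite -(card_imset _ h_inj); apply: eq_card => -[a c]; rewrite inE /=.
apply/imsetP/andP => [[z]|[aA cA]]; first by rewrite !inE /= => /andP[h1 h2] [-> ->].
by exists (a^-1 * c, a); rewrite ?inE /h /= ?mulKVg ?aA.
Qed.

(* The energy of the quotients a b^-1 equals that of the quotients a^-1 c. *)
Let energy : (#|A| ^ 3 <= K * \sum_x #|stay x| ^ 2)%N.
Proof.
pose R g := [set z : gT * gT | [&& z.1 \in A, z.2 \in A & z.1 * z.2^-1 == g]].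
have sumR : (\sum_(g in quotset A) #|R g| = #|A| ^ 2)%N.
  rewrite -mulnn -cardsX sum_card_dep.
  have h_inj : injective (fun z : gT * gT => (z.1 * z.2^-1, z)) by move=> z z' [].
  rewrite -(card_imset _ h_inj); apply: eq_card => -[g [a b]]; rewrite !inE /=.
  apply/andP/imsetP => [[_ /and3P[h1 h2 /eqP <-]]|[[a' b']]].
    by exists (a, b); rewrite ?inE /= ?h1.
  by rewrite inE /= => /andP[h1 h2] [-> -> ->]; rewrite h1 h2 eqxx; split=> //; apply/imset2P; exists a' b'.
have sumR2 : (\sum_(g in quotset A) #|R g| ^ 2 <= \sum_x #|stay x| ^ 2)%N.
  rewrite [X in (_ <= X)%N](eq_bigl (fun x => x \in [set: gT])) => [|x]; last by rewrite inE.
  under eq_bigr do rewrite -mulnn -cardsX.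
  under [X in (_ <= X)%N]eq_bigr do rewrite -mulnn -cardsX.
  rewrite !sum_card_dep.
  pose h (u : gT * ((gT * gT) * (gT * gT))) := (u.2.1.1^-1 * u.2.2.1, (u.2.1.1, u.2.1.2)).
  rewrite -(card_in_imset (f := h)).
    apply: subset_leq_card; apply/subsetP => y /imsetP; move=> [[g [[a b] [c d]]] + ->].
    rewrite !inE /= => /andP[_ /andP[/and3P[aA bA /eqP e1] /and3P[cA dA /eqP e2]]].
    rewrite aA bA mulKVg cA /=; suff -> : b * (a^-1 * c) = d by [].
    have -> : c = a * b^-1 * d by rewrite e1 -e2 mulgKV.
    by rewrite -!mulgA mulKg mulKVg.
  move=> [g [[a b] [c d]]] [g' [[a' b'] [c' d']]]; rewrite !inE /=.
  move=> /andP[_ /andP[/and3P[_ _ /eqP e1] /and3P[_ _ /eqP e2]]].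
  move=> /andP[_ /andP[/and3P[_ _ /eqP e1'] /and3P[_ _ /eqP e2']]] [] /= h1 h2 h3.
  move: e1 e2 e1' e2' h1; rewrite h2 h3 => e1 e2 e1' e2' /mulgI ec; rewrite ec in e2 *.
  have eg : g = g' by rewrite -e1 -e1'.
  by rewrite eg in e2 *; move: e2; rewrite -e2' => /mulgI/invg_inj ->.
rewrite -(leq_pmul2l A_gt0) -expnS -[(#|A| ^ _)%N]/(#|A| ^ (2 * 2))%N expnM -sumR.
apply: leq_trans (sum_sqr_le_nat _ _) _; rewrite mulnA.
by apply: leq_mul sumR2; rewrite (leq_trans small) // mulnC.
Qed.

(** By definition the elements outside S carry at most half of the energy, and each element of S
    carries at most |A|^2. *)
Let A_le_S : (#|A| <= 2 * K * #|S|)%N.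
Proof.
have Sc : (2 * K * \sum_(x | x \notin S) #|stay x| ^ 2 <= #|A| ^ 3)%N.
  rewrite (expnS _ 2) -sum_stay !big_distrr /= [X in (X <= _)%N]big_mkcond.
  apply: leq_sum => x _; case: ifP => //; rewrite inE -ltnNge => /ltnW h.
  by rewrite -mulnn mulnA leq_mul2r h orbT.
have Ss : (\sum_(x in S) #|stay x| ^ 2 <= #|S| * #|A| ^ 2)%N.
  rewrite -sum_nat_const; apply: leq_sum => x _; rewrite leq_exp2r //.
  by apply: subset_leq_card; apply/subsetP => a; rewrite inE => /andP[].
have A2 : (0 < #|A| ^ 2)%N by rewrite expn_gt0 A_gt0.
rewrite -(leq_pmul2r A2) -expnS.
have E : (#|A| ^ 3 <= K * (\sum_(x in S) #|stay x| ^ 2 + \sum_(x | x \notin S) #|stay x| ^ 2))%N.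
  by apply: leq_trans energy _; rewrite (bigID (mem S)).
have {Ss} := leq_mul (leqnn (2 * K)%N) Ss; move: E Sc; rewrite -!mulnA mulnDr.
move: (K * \sum_(x in S) _)%N (K * \sum_(x | x \notin S) _)%N => a b.
by move: (K * (#|S| * _))%N (#|A| ^ 3)%N => c d; lia.
Qed.

(** If g = a s x, each b in [stay s] gives g = (a b^-1)(b s x), with the first factor in [quotset A]
    and the second in AX: at least |A| / (2K) representations. *)
Let step (X : {set gT}) : (#|(A * (S * X))%g| <= 2 * K ^ 2 * #|(A * X)%g|)%N.
Proof.
pose M : {set gT * gT} := [set z | [&& z.1 \in A * (S * X), z.2 \in quotset A & z.2^-1 * z.1 \in A * X]].
have M_le : (#|M| <= #|quotset A| * #|(A * X)%g|)%N.
  have inj : injective (fun z : gT * gT => (z.2, z.2^-1 * z.1)).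
    by move=> [g u] [g' u'] [/= -> /mulgI ->].
  rewrite -(card_imset M inj) -cardsX; apply: subset_leq_card; apply/subsetP => y /imsetP.
  by move=> [[g u] + ->]; rewrite !inE /= => /and3P[_ -> ->].
have : (\sum_(g in (A * (S * X))%g) #|A| <= 2 * K * #|M|)%N.
  have -> : (#|M| = \sum_(g in (A * (S * X))%g) #|[set u | (g, u) \in M]|)%N.
    rewrite sum_card_dep; apply: eq_card => -[g u]; rewrite [RHS]inE /= [in RHS]inE.
    by rewrite [LHS]inE [in RHS]inE /=; case: (g \in _).
  rewrite big_distrr /=; apply: leq_sum => g gX.
  have /mulsgP[a _ aA /mulsgP[s x sS xX ->] Eg] := gX.
  move: sS; rewrite inE => /leq_trans; apply; rewrite leq_mul2l; apply/orP; right.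
  have inj : injective (fun a1 => a * a1^-1) by move=> ? ? /mulgI/invg_inj.
  rewrite -(card_imset (stay s) inj); apply: subset_leq_card; apply/subsetP => y /imsetP.
  move=> [a1 + ->]; rewrite !inE /= => /andP[a1A a1s]; rewrite gX /=; apply/andP; split.
    by apply/imset2P; exists a a1.
  by apply/mulsgP; exists (a1 * s) x => //; rewrite Eg invMg invgK !mulgA mulgKV.
rewrite sum_nat_const => H; rewrite -(leq_pmul2r A_gt0); apply: (leq_trans H).
apply: (@leq_trans (2 * K * (K * #|A| * #|(A * X)%g|))%N).
  by rewrite leq_mul2l (leq_trans M_le) ?orbT // leq_mul2r small orbT.
by rewrite -mulnn; apply: eq_leq; move: #|(A * X)%g| #|A|; lia.
Qed.

Let S1 : 1 \in S.
Proof.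
have K_gt0 : (0 < K)%N.
  have /card_gt0P[a aA] := A_gt0; rewrite lt0n; apply: contraTneq small => ->.
  by rewrite mul0n -ltnNge; apply/card_gt0P; exists (a * a^-1); apply/imset2P; exists a a.
rewrite inE; have -> : stay 1 = A by apply/setP => a; rewrite inE mulg1 andbb.
by rewrite leq_pmull // muln_gt0 K_gt0.
Qed.

Let Sinv x : x \in S -> x^-1 \in S.
Proof.
rewrite !inE => /leq_trans; apply; rewrite leq_mul2l; apply/orP; right.
rewrite -(card_imset (stay x) (mulIg x)); apply: subset_leq_card; apply/subsetP => y /imsetP.
by move=> [a + ->]; rewrite !inE mulgK => /andP[-> ->].
Qed.

Let growth n : (#|(A * S ^+ n)%g| <= (2 * K ^ 2) ^ n * #|A|)%N.
Proof.
elim: n => [|n IH]; first by rewrite expg0 mulg1 mul1n.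
by rewrite expgS (leq_trans (step _)) // (expnS (2 * _)) -[X in (_ <= X)%N]mulnA leq_mul2l IH orbT.
Qed.

(** Ruzsa's covering argument: for a maximal T in A with disjoint translates tS, |T||S| <= |AS|, and
    every aS meets some tS. *)
Let cover : exists T : {set gT}, (#|T| <= 4 * K ^ 3)%N /\ A \subset T * (S * S).
Proof.
pose sep (T : {set gT}) := (T \subset A) && [forall t in T, forall t' in T, (t != t') ==> [disjoint t *: S & t' *: S]].
have sep0 : sep set0 by rewrite /sep sub0set; apply/forall_inP => t; rewrite inE.
case: (@arg_maxnP _ set0 sep (fun T => #|T|) sep0) => T /andP[TA /forall_inP Tdis] Tmax.
have dis t t' : t \in T -> t' \in T -> t != t' -> [disjoint t *: S & t' *: S].
  by move=> tT t'T; have /forall_inP/(_ _ t'T)/implyP := Tdis _ tT.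
exists T; split.
  have /card_gt0P S0 : exists s, s \in S by exists 1.
  rewrite -(leq_pmul2r S0).
  apply: (@leq_trans #|(A * S)%g|).
    rewrite -cardsX -(card_in_imset (f := fun z : gT * gT => z.1 * z.2)).
      apply: subset_leq_card; apply/subsetP => y /imsetP[[t s] + ->]; rewrite in_setX => /andP[/= tT sS].
      by apply/mulsgP; exists t s => //; apply: (subsetP TA).
    move=> [t s] [t' s']; rewrite !in_setX /= => /andP[tT sS] /andP[t'T s'S] e.
    have [ett|ne] := eqVneq t t'; first by move: e; rewrite ett => /mulgI ->.
    have /pred0P/(_ (t * s)) := dis _ _ tT t'T ne.
    by rewrite /= mem_lcoset mulKg sS e mem_lcoset mulKg s'S.
  have := growth 1; rewrite expg1 expn1 => /leq_trans; apply.
  apply: (@leq_trans (2 * K ^ 2 * (2 * K * #|S|))%N); first by rewrite leq_mul2l A_le_S orbT.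
  by apply: eq_leq; rewrite (expnS K 2); move: (K ^ 2)%N #|S|; lia.
apply/subsetP => a aA; have [aT|aT] := boolP (a \in T).
  by apply/mulsgP; exists a 1; rewrite ?mulg1 //; apply/mulsgP; exists 1 1; rewrite ?mulg1.
have : ~~ sep (a |: T).
  by apply/negP => /Tmax /=; rewrite cardsU1 aT add1n /geq /= ltnn.
rewrite /sep subUset sub1set aA TA /= negb_forall_in => /exists_inP[t tT].
rewrite negb_forall_in => /exists_inP[t' t'T]; rewrite negb_imply => /andP[ne nd].
have [t0 t0T nd0] : exists2 t0, t0 \in T & ~~ [disjoint a *: S & t0 *: S].
  move: tT t'T; rewrite !inE => /orP[/eqP et|tT] /orP[/eqP et'|t'T].
  - by rewrite et et' eqxx in ne.
  - by exists t' => //; rewrite -et.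
  - by exists t => //; rewrite -et' disjoint_sym.
  - by rewrite dis in nd.
move: nd0; rewrite -setI_eq0 => /set0Pn[y]; rewrite inE => /andP[/lcosetP[s sS ->] /lcosetP[s' s'S e]].
apply/mulsgP; exists t0 (s' * s^-1) => //; first by apply/mulsgP; exists s' s^-1; rewrite ?Sinv.
by apply: (mulIg s); rewrite e mulgA mulgKV.
Qed.

Theorem approximate_group : exists S T : {set gT},
  [/\ 1 \in S, (forall x, x \in S -> x^-1 \in S),
      (forall x, x \in S -> exists a b, [/\ a \in A, b \in A & x = a^-1 * b]),
      ((#|T| <= 4 * K ^ 3)%N /\ A \subset T * (S * S)) &
      ((#|A| <= 2 * K * #|S|)%N /\ forall n, (#|(S ^+ n)%g| <= (2 * K ^ 2) ^ n * #|A|)%N)].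
Proof.
have [T [T1 T2]] := cover; exists S, T; split=> //.
  move=> x; rewrite inE => xS; have /card_gt0P[a] : (0 < #|stay x|)%N.
    by move: xS A_gt0; case: #|stay x| => //; rewrite muln0; case: #|A|.
  by rewrite inE => /andP[aA bA]; exists a, (a * x); rewrite mulKg.
split=> // n; apply: leq_trans (growth n).
have /card_gt0P[a aA] := A_gt0; rewrite -(card_lcoset _ a); apply: subset_leq_card.
by apply/subsetP => y /lcosetP[s sS ->]; apply/mulsgP; exists a s.
Qed.

End ApproximateGroup.

(** * Growth in SL2 *)

Section SL2.

Variable F : finFieldType.
Implicit Types (v w : F * F).

Definition det2 v w : F := v.1 * w.2 - v.2 * w.1.

Definition sl2 := {z : (F * F) * (F * F) | det2 z.1 z.2 == 1}.
HB.instance Definition _ := Finite.on sl2.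

Implicit Types g h : sl2.

Definition row1 g : F * F := (val g).1.
Definition row2 g : F * F := (val g).2.

Definition vact v g : F * F :=
  (v.1 * (row1 g).1 + v.2 * (row2 g).1, v.1 * (row1 g).2 + v.2 * (row2 g).2).

Lemma det_rows g : det2 (row1 g) (row2 g) = 1.
Proof. exact/eqP/(valP g). Qed.

Lemma sl2_ext g h : row1 g = row1 h -> row2 g = row2 h -> g = h.
Proof.
by move=> e1 e2; apply: val_inj; rewrite [LHS]surjective_pairing [RHS]surjective_pairing; congr pair.
Qed.

Lemma det2_vact v w g : det2 (vact v g) (vact w g) = det2 v w.
Proof.
rewrite -[RHS]mulr1 -(det_rows g) /det2 /vact /=.
by move: (row1 g) (row2 g) => [a b] [c d] /=; ring.
Qed.

Definition sl2_of v w (H : det2 v w = 1) : sl2 := exist _ (v, w) (introT eqP H).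

Fact sl2_mul_subproof g h : det2 (vact (row1 g) h) (vact (row2 g) h) = 1.
Proof. by rewrite det2_vact det_rows. Qed.
Definition sl2_mul g h := sl2_of (sl2_mul_subproof g h).

Fact sl2_one_subproof : det2 (1, 0) (0, 1) = 1.
Proof. by rewrite /det2 /= mulr1 mul0r subr0. Qed.
Definition sl2_one := sl2_of sl2_one_subproof.

Fact sl2_inv_subproof g :
  det2 ((row2 g).2, - (row1 g).2) (- (row2 g).1, (row1 g).1) = 1.
Proof. by rewrite -(det_rows g) /det2 /=; ring. Qed.
Definition sl2_inv g := sl2_of (sl2_inv_subproof g).

Lemma vact_mul v g h : vact v (sl2_mul g h) = vact (vact v g) h.
Proof. by rewrite /vact /row1 /row2 /=; congr pair; ring. Qed.

Fact sl2_mulA : associative sl2_mul.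
Proof. by move=> g h k; apply: sl2_ext; rewrite /row1 /row2 /= -vact_mul. Qed.

Fact sl2_mul1 : left_id sl2_one sl2_mul.
Proof.
move=> g; apply: sl2_ext; rewrite /row1 /row2 /= /vact /=.
  by rewrite !(mul1r, mul0r, addr0) -surjective_pairing.
by rewrite !(mul1r, mul0r, add0r) -surjective_pairing.
Qed.

Fact sl2_mulV : left_inverse sl2_one sl2_inv sl2_mul.
Proof.
move=> g; have := det_rows g; rewrite /det2 => e.
by apply: sl2_ext; rewrite /row1 /row2 /= /vact /=; congr pair; rewrite -?e /row1 /row2; ring.
Qed.

HB.instance Definition _ := Finite_isGroup.Build sl2 sl2_mulA sl2_mul1 sl2_mulV.

Lemma vactM v g h : vact v (g * h)%g = vact (vact v g) h.
Proof. exact: vact_mul. Qed.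

Lemma row1M g h : row1 (g * h)%g = vact (row1 g) h. Proof. by []. Qed.
Lemma row2M g h : row2 (g * h)%g = vact (row2 g) h. Proof. by []. Qed.
Lemma row1V g : row1 (g^-1)%g = ((row2 g).2, - (row1 g).2). Proof. by []. Qed.
Lemma row2V g : row2 (g^-1)%g = (- (row2 g).1, (row1 g).1). Proof. by []. Qed.
Lemma row1_1 : row1 1%g = (1, 0). Proof. by []. Qed.
Lemma row2_1 : row2 1%g = (0, 1). Proof. by []. Qed.

Lemma vact1 v : vact v 1%g = v.
Proof.
by rewrite /vact row1_1 row2_1 /= !(mulr1, mulr0, addr0, add0r) -surjective_pairing.
Qed.

Lemma vactK g : cancel (vact^~ g) (vact^~ (g^-1)%g).
Proof. by move=> v; rewrite -vactM mulgV vact1. Qed.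

Lemma vact_eq0 v g : (vact v g == (0, 0)) = (v == (0, 0)).
Proof.
have E : vact (0, 0) g = (0, 0) by rewrite /vact /= !mul0r addr0.
by rewrite -{1}E (inj_eq (can_inj (vactK g))).
Qed.

Fact lower_subproof (x : F) : det2 (1, 0) (x, 1) = 1.
Proof. by rewrite /det2 /= mulr1 mul0r subr0. Qed.
Definition lower x := sl2_of (lower_subproof x).

Lemma vact_lower v x : vact v (lower x) = (v.1 + v.2 * x, v.2).
Proof. by rewrite /vact /row1 /row2 /= !(mulr1, mulr0, add0r). Qed.

Lemma lowerD x y : lower (x + y) = (lower x * lower y)%g.
Proof.
apply: sl2_ext; rewrite ?row1M ?row2M vact_lower /row1 /row2 /=.
  by rewrite mul0r addr0.
by rewrite mul1r addrC.
Qed.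

Lemma lowerN x : lower (- x) = ((lower x)^-1)%g.
Proof. by apply: sl2_ext; rewrite ?row1V ?row2V /row1 /row2 /= ?oppr0. Qed.

Lemma lower_inj : injective lower.
Proof. by move=> x y /(congr1 row2); rewrite /row2 /= => -[]. Qed.

(** The matrices [lower x] form the stabiliser of (1, 0). *)
Lemma row1_mulV_eq g h : row1 g = row1 h -> (g * h^-1)%g = lower (row2 (g * h^-1)%g).1.
Proof.
move=> e; have [e1 e2] : (row1 (g * h^-1)%g).1 = 1 /\ (row1 (g * h^-1)%g).2 = 0.
  rewrite row1M /vact row1V row2V e /=; split; last by ring.
  by rewrite -(det_rows h) /det2; ring.
have := det_rows (g * h^-1)%g; rewrite /det2 e1 e2 mul1r mul0r subr0 => e3.
apply: sl2_ext; first by rewrite [LHS]surjective_pairing e1 e2.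
by rewrite [LHS]surjective_pairing e3.
Qed.

Lemma row1_mulV g h : row1 (g * h^-1)%g =
  (det2 (row1 g) (row2 h), - det2 (row1 g) (row1 h)).
Proof. by rewrite row1M /vact row1V row2V /det2 /=; congr pair; ring. Qed.

Lemma conj_lower (h : sl2) (x : F) : (row1 h).2 = 0 ->
  (h^-1 * lower x * h)%g = lower ((row1 h).1 ^+ 2 * x).
Proof.
move=> b0; have := det_rows h; rewrite /det2 b0 mul0r subr0 => ad.
apply: sl2_ext; rewrite ?row1M ?row2M vact_lower ?row1V ?row2V /vact /= b0.
  rewrite oppr0 !(mul0r, mulr0, addr0, add0r) (mulrC _ (row1 h).1) ad /row1 /row2 /=.
  by congr pair; rewrite oppr0 mul0r.
rewrite /row2 /= -/(row2 h); congr pair; last by rewrite mulr0 add0r.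
by rewrite -/(row1 h); ring.
Qed.

End SL2.

(** Rudnev's conclusion as a property of the field, so that growth can be proved over any finite
    field having it. *)
Definition incidence_bound (F : finFieldType) (r : nat) :=
  forall (P : {set F * F * F}) (k Q : nat),
  (forall e, e \in P -> e.1.1 != 0) ->
  (forall S : {set F * F * F}, S \subset P ->
    (forall e1 e2 e3, e1 \in S -> e2 \in S -> e3 \in S -> collinear e1 e2 e3) -> (#|S| <= k)%N) ->
  (#|P| <= #|F| ^ 2)%N -> (432 * r * (2 * #|P|) < Q ^ 2)%N ->
  (64 * r <= Q)%N -> (4 * k <= Q)%N ->
  (#|[set e | [&& e.1 \in P, e.2 \in P & incid e.1 e.2]]| <= 2 * Q * #|P|)%N.

(** Collinear points are parametrised by the first coordinate that is not constant on them. *)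
Lemma collinear_inj (F : finFieldType) (S : {set F * F * F}) :
  (forall e1 e2 e3, e1 \in S -> e2 \in S -> e3 \in S -> collinear e1 e2 e3) ->
  [\/ {in S &, injective (fun e => e.1.1)}, {in S &, injective (fun e => e.1.2)} |
      {in S &, injective (fun e => e.2)}].
Proof.
move=> Hcol.
have ext (e e' : F * F * F) : e.1.1 = e'.1.1 -> e.1.2 = e'.1.2 -> e.2 = e'.2 -> e = e'.
  by case: e e' => [[? ?] ?] [[? ?] ?] /= -> -> ->.
have [/forall_inP same1|] := boolP [forall e1 in S, forall e2 in S, e1.1.1 == e2.1.1]; last first.
  rewrite negb_forall_in => /exists_inP[e1 e1T]; rewrite negb_forall_in.
  move=> /exists_inP[e2 e2T d12]; rewrite eq_sym -subr_eq0 in d12.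
  constructor 1 => e e' eT eT' E; have [h1 h2 _] := Hcol _ _ _ e1T e2T eT.
  have [h1' h2' _] := Hcol _ _ _ e1T e2T eT'; rewrite -E in h1' h2'.
  have := mulfI d12 (etrans h1 (esym h1')); have := mulfI d12 (etrans h2 (esym h2')).
  by move=> /addIr E2 /addIr E12; apply: ext.
have [/forall_inP same2|] := boolP [forall e1 in S, forall e2 in S, e1.1.2 == e2.1.2]; last first.
  rewrite negb_forall_in => /exists_inP[e1 e1T]; rewrite negb_forall_in.
  move=> /exists_inP[e2 e2T d12]; rewrite eq_sym -subr_eq0 in d12.
  constructor 2 => e e' eT eT' E; have [_ _ h] := Hcol _ _ _ e1T e2T eT.
  have [_ _ h'] := Hcol _ _ _ e1T e2T eT'; rewrite -E in h'.
  have := mulfI d12 (etrans h (esym h')) => /addIr E2.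
  by apply: ext => //; have /forall_inP/(_ _ eT')/eqP := same1 _ eT.
constructor 3 => e e' eT eT' E; apply: ext => //.
  by have /forall_inP/(_ _ eT')/eqP := same1 _ eT.
by have /forall_inP/(_ _ eT')/eqP := same2 _ eT.
Qed.

Section SetEnergy.

Variables (T : finType) (U : finType) (f : T -> U) (A : {set T}).

Lemma card_sum_fibers : #|A| = (\sum_(u in f @: A) #|[set x in A | f x == u]|)%N.
Proof.
rewrite sum_card_dep; have inj : injective (fun x => (f x, x)) by move=> x y [].
rewrite -(card_imset A inj); apply: eq_card => -[u x]; rewrite inE /= inE.
apply/imsetP/and3P => [[y yA [-> ->]]|[_ xA /eqP <-]]; last by exists x.
by split=> //; apply: imset_f.
Qed.

Lemma card_le_fibers m : (forall u, (#|[set x in A | f x == u]| <= m)%N) ->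
  (#|A| <= m * #|f @: A|)%N.
Proof.
by move=> Hm; rewrite card_sum_fibers mulnC -sum_nat_const; apply: leq_sum => u _.
Qed.

Lemma energy_ge_image :
  (#|A| ^ 2 <= #|f @: A| * #|[set z : T * T | [&& z.1 \in A, z.2 \in A & f z.1 == f z.2]]|)%N.
Proof.
pose C u := [set x in A | f x == u].
rewrite {1}card_sum_fibers; apply: leq_trans (sum_sqr_le_nat _ _) _; rewrite leq_mul2l; apply/orP; right.
under eq_bigr do rewrite -mulnn -cardsX.
rewrite sum_card_dep; rewrite -(card_in_imset (f := fun z : U * (T * T) => z.2)).
  apply: subset_leq_card; apply/subsetP => z /imsetP[[u [x y]] + ->]; rewrite !inE /=.
  by move=> /and3P[_ /andP[-> /eqP ->] /andP[-> /eqP ->]] /=.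
move=> [u [x y]] [u' [x' y']]; rewrite !inE /=.
by move=> /and3P[_ /andP[_ /eqP <-] _] /and3P[_ /andP[_ /eqP <-] _] [-> ->].
Qed.

End SetEnergy.

(** * Growth of sets with two unipotent directions *)

Section SL2Growth.

Variables (F : finFieldType) (r : nat).
Hypotheses (rud : incidence_bound F r) (r_gt0 : (0 < r)%N).
Variables (H : {set sl2 F}) (Lam s W : nat).
Hypotheses (H1 : 1%g \in H) (HV : forall g, g \in H -> (g^-1)%g \in H).
Hypothesis grow : forall j, (j <= 10)%N -> (#|(H ^+ j)%g| <= Lam * #|H|)%N.

Definition lower_part (A : {set sl2 F}) : {set F} := [set x | lower x \in A].
Definition directions (A : {set sl2 F}) : {set F} :=
  [set v.2 / v.1 | v in (@row1 F) @: A & v.1 != 0].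

(** [V j] and [R j] stand for stabiliser and orbit of (1, 0). [orbit_le] and [H_le] are the
    orbit-stabiliser theorem for the approximate group H; they keep both from growing with j. *)
Let V j := lower_part (H ^+ j)%g.
Let R j := (@row1 F) @: (H ^+ j)%g.
Let Dir := directions H.
Hypotheses (V_W : (W <= #|V 2|)%N) (Dir_W : (W <= #|Dir|)%N).
Hypotheses (s_big : (128 * r * Lam < s)%N) (W_big : (1024 * r * Lam * s ^ 2 < W)%N).

Let memM i j g h : g \in (H ^+ i)%g -> h \in (H ^+ j)%g -> (g * h)%g \in (H ^+ (i + j))%g.
Proof. by move=> gH hH; rewrite expgD mem_mulg. Qed.

Let memV i g : g \in (H ^+ i)%g -> (g^-1)%g \in (H ^+ i)%g.
Proof.
elim: i g => [|i IH] g; first by rewrite expg0 !inE => /eqP ->; rewrite invg1.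
rewrite expgS => /mulsgP[h k hH kH ->]; rewrite invMg -expgS expgSr mem_mulg ?IH //.
exact: HV.
Qed.

Let mem1 j : 1%g \in (H ^+ j)%g.
Proof. by elim: j => [|j IH]; rewrite ?expg0 ?inE // expgS -[1%g]mulg1 mem_mulg. Qed.

Let Hpow1 : (H ^+ 1)%g = H. Proof. exact: expg1. Qed.

Let Lam_gt0 : (0 < Lam)%N.
Proof.
rewrite lt0n; apply: contraTneq (grow (isT : (1 <= 10)%N)) => ->.
by rewrite mul0n -ltnNge Hpow1; apply/card_gt0P; exists 1%g.
Qed.

Let rep j (v : F * F) : sl2 F := odflt 1%g [pick g in (H ^+ j)%g | row1 g == v].

Let repP j v : v \in R j -> rep j v \in (H ^+ j)%g /\ row1 (rep j v) = v.
Proof.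
move=> /imsetP[g gH ->]; rewrite /rep; case: pickP => [h /andP[hH /eqP]|/(_ g)] //=.
by rewrite gH eqxx.
Qed.

Let orbit_le i j : (#|R i| * #|V j| <= #|(H ^+ (j + i))%g|)%N.
Proof.
rewrite -cardsX -(card_in_imset (f := fun z => (lower z.2 * rep i z.1)%g)).
  apply: subset_leq_card; apply/subsetP => g /imsetP[[v x] + ->]; rewrite in_setX /=.
  by move=> /andP[/repP[h1 _] h2]; apply: memM => //; move: h2; rewrite inE.
move=> [v x] [v' x']; rewrite !in_setX /= => /andP[/repP[_ h1] _] /andP[/repP[_ h1'] _] e.
have lrow y (g : sl2 F) : row1 (lower y * g)%g = row1 g.
  by rewrite row1M /row1 /= -/(row1 g) /vact /= !(mul1r, mul0r, addr0) -surjective_pairing.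
have ev : v = v' by rewrite -h1 -h1' -(lrow x) e lrow.
by move: e; rewrite ev => /mulIg/lower_inj ->.
Qed.

Let H_le : (#|H| <= #|R 1| * #|V 2|)%N.
Proof.
rewrite -cardsX -(card_in_imset (f := fun g => (row1 g, (row2 (g * (rep 1 (row1 g))^-1)%g).1))).
  apply: subset_leq_card; apply/subsetP => z /imsetP[g gH ->]; rewrite in_setX /=.
  have gR : row1 g \in R 1 by apply: imset_f; rewrite Hpow1.
  have [h1 h2] := repP gR.
  rewrite gR /= in_set -row1_mulV_eq //.
  by apply: (@memM 1 1); [rewrite Hpow1|apply: memV].
move=> g g' gH g'H /eqP; rewrite xpair_eqE => /andP[/eqP e1 /eqP]; rewrite e1.
have [_ h2] : rep 1 (row1 g') \in (H ^+ 1)%g /\ row1 (rep 1 (row1 g')) = row1 g'.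
  by apply: repP; apply: imset_f; rewrite Hpow1.
move: (rep 1 (row1 g')) h2 => k h2 e2; apply: (mulIg k^-1%g).
by rewrite (row1_mulV_eq (esym h2)) (row1_mulV_eq (etrans e1 (esym h2))) e2.
Qed.

Let R1_gt0 : (0 < #|R 1|)%N.
Proof. by apply/card_gt0P; exists (row1 (1%g : sl2 F)); apply: imset_f; apply: mem1. Qed.

Let V0 j : 0 \in V j.
Proof.
rewrite inE; suff -> : lower (0 : F) = 1%g by apply: mem1.
by apply: (mulgI (lower 0)); rewrite -lowerD addr0 mulg1.
Qed.

Let V_le j : (j <= 9)%N -> (#|V j| <= Lam * #|V 2|)%N.
Proof.
move=> j9; rewrite -(leq_pmul2l R1_gt0); apply: leq_trans (orbit_le 1 j) _.
apply: leq_trans (grow _) _; first by lia.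
by rewrite mulnCA leq_mul2l H_le orbT.
Qed.

Let R_le j : (j <= 8)%N -> (#|R j| <= Lam * #|R 1|)%N.
Proof.
move=> j8; have V20 : (0 < #|V 2|)%N by apply/card_gt0P; exists 0.
rewrite -(leq_pmul2r V20); apply: leq_trans (orbit_le j 2) _.
apply: leq_trans (grow _) _; first by lia.
by rewrite -mulnA leq_mul2l H_le orbT.
Qed.

Let v := #|V 2|.

Let s_gt0 : (0 < s)%N. Proof. exact: leq_trans s_big. Qed.
Let ss_W : (s ^ 2 < W)%N.
Proof.
apply: leq_ltn_trans W_big; rewrite leq_pmull // !muln_gt0 r_gt0 Lam_gt0.
by [].
Qed.

(** Two elements of H with parallel first rows have a lower triangular quotient; these are the
    diagonal entries that arise. *)
Let torus : {set F} := [set (row1 g).1 | g in (H ^+ 2)%g & (row1 g).2 == 0].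

Let torusP t : t \in torus -> exists g, [/\ g \in (H ^+ 2)%g, (row1 g).1 = t & (row1 g).2 = 0].
Proof. by move=> /imsetP[g]; rewrite inE => /andP[gH /eqP g0] ->; exists g. Qed.

Let torus_neq0 t : t \in torus -> t != 0.
Proof.
move=> /torusP[g [_ <- e]]; have := det_rows g; rewrite /det2 e mul0r subr0 => h.
by apply: contra_eq_neq h => ->; rewrite mul0r eq_sym oner_eq0.
Qed.

(* [conj_lower] gives t^2 x + y in V 8 for t in the torus and x, y in V 2: a
   sum-product configuration that Rudnev's theorem excludes for small V 2. *)
Lemma unipotent_large : (s ^ 2 <= #|[set t ^+ 2 | t in torus]|)%N -> (#|F| < s * v)%N.
Proof.
(* Exactly s^2 squares are kept, so that the point set has (s v)^2 <= |F|^2 elements. *)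
move=> sT; have [Sq [SqT cS]] : exists Sq : {set F}, Sq \subset [set t ^+ 2 | t in torus] /\ #|Sq| = (s ^ 2)%N.
  have := sT; rewrite -bin_gt0 -cards_draws => /card_gt0P[Sq]; rewrite !inE => /andP[h1 /eqP h2].
  by exists Sq.
have v_gt0 : (0 < v)%N by apply: leq_ltn_trans (leq0n _) (leq_trans ss_W V_W).
have sv : (s ^ 2 <= v)%N by apply: ltnW (leq_trans ss_W V_W).
rewrite ltnNge; apply/negP => sp.
pose P : {set F * F * F} := [set e | [&& e.1.1 \in Sq, e.1.2 \in V 2 & e.2 \in V 2]].
have cP : #|P| = (s ^ 2 * v ^ 2)%N.
  by rewrite -cS -mulnn mulnA -!cardsX; apply: eq_card => e; rewrite !inE andbA.
have nz e : e \in P -> e.1.1 != 0.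
  rewrite inE => /andP[/(subsetP SqT)/imsetP[t /torus_neq0 t0 ->] _].
  by rewrite expf_neq0.
have col (S : {set F * F * F}) : S \subset P ->
    (forall e1 e2 e3, e1 \in S -> e2 \in S -> e3 \in S -> collinear e1 e2 e3) -> (#|S| <= v)%N.
  move=> SP /collinear_inj[] inj; rewrite -(card_in_imset inj).
  - apply: leq_trans sv; rewrite -cS; apply: subset_leq_card.
    by apply/subsetP => x /imsetP[e /(subsetP SP)]; rewrite inE => /and3P[h _ _] ->.
  - apply: subset_leq_card.
    by apply/subsetP => x /imsetP[e /(subsetP SP)]; rewrite inE => /and3P[_ h _] ->.
  - apply: subset_leq_card.
    by apply/subsetP => x /imsetP[e /(subsetP SP)]; rewrite inE => /and3P[_ _ h] ->.
have Pp : (#|P| <= #|F| ^ 2)%N by rewrite cP -expnMn leq_exp2r.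
have sv_gt0 : (0 < s * v)%N by rewrite muln_gt0 s_gt0.
have Q1 : (432 * r * (2 * #|P|) < (64 * r * (s * v)) ^ 2)%N.
  rewrite cP -expnMn (expnMn (64 * r)); move: sv_gt0 r_gt0; clear.
  move=> sv0; have : (0 < (s * v) ^ 2)%N by rewrite expn_gt0 sv0.
  by move: ((s * v) ^ 2)%N => x x0 r0; rewrite -mulnn; nia.
have Q2 : (64 * r <= 64 * r * (s * v))%N by rewrite leq_pmulr.
have Q3 : (4 * v <= 64 * r * (s * v))%N.
  by rewrite mulnA leq_mul2r; apply/orP; right; move: s_gt0 r_gt0; clear; nia.
have Inc := rud nz col Pp Q1 Q2 Q3.
pose f (e : F * F * F) := e.1.1 * e.2 + e.1.2.
have := energy_ge_image f P.
(* Six factors of H for the conjugate and two for the translate: all values lie in [V 8]. *)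
have Im : (#|f @: P| <= Lam * v)%N.
  apply: leq_trans (V_le (isT : (8 <= 9)%N)); apply: subset_leq_card; apply/subsetP => z.
  move=> /imsetP[[[sg y] x] + ->]; rewrite !inE /= => /and3P[/(subsetP SqT)/imsetP[t tT ->] yV xV].
  have [g [gH <- g0]] := torusP tT.
  rewrite /f /= lowerD -(conj_lower x g0).
  apply: (@memM 6 2) => //; apply: (@memM 4 2) => //; apply: (@memM 2 2) => //.
  exact: memV.
have En : (#|[set z : (F * F * F) * (F * F * F) | [&& z.1 \in P, z.2 \in P & f z.1 == f z.2]]|
   <= #|[set e | [&& e.1 \in P, e.2 \in P & incid e.1 e.2]]|)%N.
  pose h (z : (F * F * F) * (F * F * F)) :=
    ((z.2.1.1, z.1.1.2, z.1.2), (z.1.1.1, z.2.1.2, z.2.2)).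
  have h_inj : injective h.
    by move=> [[[a b] c] [[a' b'] c']] [[[x y] z] [[x' y'] z']] [] -> -> -> -> -> ->.
  rewrite -(card_imset _ h_inj); apply: subset_leq_card; apply/subsetP => u /imsetP.
  move=> [[[[a b] c] [[a' b'] c']] + ->]; rewrite !inE /=.
  move=> /and3P[/and3P[-> -> ->] /and3P[-> -> ->] /eqP]; rewrite /f /incid /= => e.
  by rewrite (addrC b) e addrC.
move=> H2; have := leq_trans H2 (leq_mul Im (leq_trans En Inc)).
rewrite cP; have sb := s_big; have v2 : (0 < v ^ 2)%N by rewrite expn_gt0 v_gt0.
have -> : (Lam * v * (2 * (64 * r * (s * v)) * (s ^ 2 * v ^ 2)) =
   (128 * r * Lam * s * v ^ 2) * (s ^ 2 * v ^ 2))%N.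
  by rewrite -[in LHS](mulnn v) -[in RHS](mulnn v); lia.
rewrite -[((s ^ 2 * _) ^ 2)%N]mulnn leq_pmul2r ?muln_gt0 ?expn_gt0 ?s_gt0 ?v_gt0 //.
by rewrite leq_pmul2r // -mulnn leq_pmul2r // leqNgt sb.
Qed.

(* If the torus were small, H would have about as many first rows as directions, and
   Rudnev's theorem applied to quadruples of rows with det (r_1, r_2) = det (r_1', r_2')
   would give H ^+ 2 so many upper right entries that H ^+ 4 has too many first rows. *)
Lemma torus_large : (s ^ 2 <= #|[set t ^+ 2 | t in torus]|)%N.
Proof.
rewrite leqNgt; apply/negP => small.
have torus_le : (#|torus| <= 2 * s ^ 2)%N.
  apply: leq_trans (card_le_fibers (f := fun t => t ^+ 2) (m := 2) _) _; last by rewrite leq_mul2l (ltnW small).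
  move=> u; apply: (@card_roots_quadratic _ 1 0 (- u)).
    by rewrite !xpair_eqE oner_eq0.
  by move=> t; rewrite inE => /andP[_ /eqP <-]; ring.
have [M0 EM0] : {M0 | M0 = #|Dir|} by exists #|Dir|.
(* One representative in H per direction; [None] is the direction with vanishing first
   coordinate. *)
pose rp (o : option F) : sl2 F := odflt 1%g
  (if o is Some de then [pick g in H | ((row1 g).1 != 0) && ((row1 g).2 / (row1 g).1 == de)]
   else [pick g in H | (row1 g).1 == 0]).
have rpS de : de \in Dir ->
    [/\ rp (Some de) \in H, (row1 (rp (Some de))).1 != 0 & (row1 (rp (Some de))).2 = de * (row1 (rp (Some de))).1].
  move=> /imsetP[u]; rewrite inE => /andP[/imsetP[g gH ->] g0] ->.
  rewrite /rp; case: pickP => [h /and3P[h1 h2 /eqP <-]|/(_ g)] /=; last by rewrite gH g0 eqxx.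
  by rewrite divfK.
have rpN g : g \in H -> (row1 g).1 = 0 -> rp None \in H /\ (row1 (rp None)).1 = 0.
  move=> gH g0; rewrite /rp; case: pickP => [h /andP[h1 /eqP h2]|/(_ g)] //=.
  by rewrite gH g0 eqxx.
pose cl (w : F * F) : option F := if w.1 == 0 then None else Some (w.2 / w.1).
have rp_cl g : g \in H -> rp (cl (row1 g)) \in H /\ det2 (row1 g) (row1 (rp (cl (row1 g)))) = 0.
  move=> gH; rewrite /cl; case: eqP => [g0|/eqP g0].
    by have [h1 h2] := rpN g gH g0; split=> //; rewrite /det2 g0 h2 mul0r mulr0 subr0.
  have dD : (row1 g).2 / (row1 g).1 \in Dir.
    by apply/imsetP; exists (row1 g) => //; rewrite inE g0 andbT; apply: imset_f.
  by have [h1 h2 h3] := rpS _ dD; split=> //; rewrite /det2 h3; field.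
(* A row is determined by its direction and the torus entry that compares it with the
   representative. *)
have R1_le : (#|R 1| <= 2 * s ^ 2 * (M0 + 1))%N.
  have -> : (M0 + 1)%N = #|None |: (Some @: Dir)|.
    rewrite cardsU1 (card_imset _ (@Some_inj _)) -EM0 addnC.
    by case: imsetP => // -[].
  apply: (@leq_trans (#|torus| * #|None |: (Some @: Dir)|)%N); last by rewrite leq_mul2r torus_le orbT.
  rewrite -cardsX; pose f (w : F * F) := ((row1 (rep 1 w * (rp (cl w))^-1)%g).1, cl w).
  rewrite -(card_in_imset (f := f)).
    apply: subset_leq_card; apply/subsetP => z /imsetP[w wR ->]; rewrite in_setX /=.
    have [h1 h2] := repP wR; rewrite Hpow1 in h1; have [h3 h4] := rp_cl _ h1; rewrite h2 in h3 h4.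
    apply/andP; split.
      apply/imsetP; exists (rep 1 w * (rp (cl w))^-1)%g => //.
      rewrite inE row1_mulV h2 h4 oppr0 eqxx andbT.
      by apply: (@memM 1 1); rewrite Hpow1 ?HV.
    rewrite /cl; case: eqP => [_|/eqP w0]; first by rewrite !inE.
    rewrite !inE; apply/orP; right; apply: imset_f; apply/imsetP; exists w => //.
    by rewrite inE w0 andbT -h2; apply: imset_f.
  move=> w w' wR wR' /eqP; rewrite xpair_eqE => /andP[/eqP e1 /eqP e2].
  have [h1 h2] := repP wR; rewrite Hpow1 in h1; have [h3 h4] := rp_cl _ h1; rewrite h2 in h3 h4.
  have [h1' h2'] := repP wR'; rewrite Hpow1 in h1'; have [h3' h4'] := rp_cl _ h1'; rewrite h2' in h3' h4'.
  have E : row1 (rep 1 w * (rp (cl w))^-1)%g = row1 (rep 1 w' * (rp (cl w'))^-1)%g.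
    rewrite [LHS]surjective_pairing [RHS]surjective_pairing e1.
    by rewrite (row1_mulV (rep 1 w)) (row1_mulV (rep 1 w')) h2 h2' h4 h4'.
  by rewrite -h2 -h2' -(mulgKV (rp (cl w)) (rep 1 w)) row1M E e2 -row1M mulgKV.
pose X de := (row1 (rp (Some de))).1.
have X0 de : de \in Dir -> X de != 0 by move=> /rpS[].
pose f (z : F * F) := det2 (row1 (rp (Some z.1))) (row1 (rp (Some z.2))).
have fE z : z.1 \in Dir -> z.2 \in Dir -> f z = X z.1 * X z.2 * (z.2 - z.1).
  by move=> /rpS[_ _ h1] /rpS[_ _ h2]; rewrite /f /det2 h1 h2 -/(X _) -/(X _); ring.
(* The equation [f (a, b) = f (a', b')] becomes an incidence of [e (a, a')] with [e (b, b')]. *)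
pose e (z : F * F) : F * F * F := (- (X z.2 / X z.1), z.1, z.2 * X z.2 / X z.1).
have e_inj : {in setX Dir Dir &, injective e}.
  move=> [a b] [a' b']; rewrite !in_setX /= => /andP[aD bD] /andP[aD' bD'] /eqP.
  rewrite /e !xpair_eqE /= => /andP[/andP[/eqP h1 /eqP h2] /eqP h3]; rewrite -h2 in h1 h3 *.
  have iX : (X a)^-1 != 0 by rewrite invr_eq0 X0.
  have Xb := mulIf iX (oppr_inj h1); rewrite -Xb in h3.
  by have := mulIf (X0 _ bD) (mulIf iX h3) => ->.
pose P := e @: setX Dir Dir.
have cP : #|P| = (M0 ^ 2)%N by rewrite card_in_imset // cardsX -EM0 mulnn.
have eP u : u \in P -> exists a b, [/\ a \in Dir, b \in Dir & u = e (a, b)].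
  by move=> /imsetP[[a b]]; rewrite in_setX => /andP[aD bD] ->; exists a, b.
have nz u : u \in P -> u.1.1 != 0.
  by move=> /eP[a [b [aD bD ->]]] /=; rewrite oppr_eq0 mulf_neq0 ?invr_eq0 ?X0.
have M0_gt0 : (0 < M0)%N by rewrite EM0; apply: leq_trans Dir_W; apply: leq_ltn_trans ss_W.
have col (S : {set F * F * F}) : S \subset P ->
    (forall e1 e2 e3, e1 \in S -> e2 \in S -> e3 \in S -> collinear e1 e2 e3) -> (#|S| <= M0)%N.
  move=> SP Hcol.
  have [/forall_inP same|] := boolP [forall e1 in S, forall e2 in S, e1.1.2 == e2.1.2].
    have [S0|[u uS]] := set_0Vmem S; first by rewrite S0 cards0.
    have [a [b [aD bD Eu]]] := eP _ (subsetP SP _ uS).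
    rewrite EM0; apply: leq_trans (leq_imset_card (fun b' => e (a, b')) Dir); apply: subset_leq_card.
    apply/subsetP => u' u'S; have [a' [b' [aD' bD' Eu']]] := eP _ (subsetP SP _ u'S).
    have /forall_inP/(_ _ u'S) := same _ uS; rewrite Eu Eu' /= => /eqP <-.
    exact: imset_f.
  rewrite negb_forall_in => /exists_inP[e1 e1T]; rewrite negb_forall_in.
  move=> /exists_inP[e2 e2T d12]; rewrite eq_sym -subr_eq0 in d12.
  rewrite EM0 -(card_in_imset (f := fun u : F * F * F => u.1.2)).
    by apply: subset_leq_card; apply/subsetP => x /imsetP[u /(subsetP SP)/eP[a [b [aD _ ->]]] ->].
  move=> u u' uT uT' E; have [h1 _ h2] := Hcol _ _ _ e1T e2T uT.
  have [h1' _ h2'] := Hcol _ _ _ e1T e2T uT'; rewrite -E in h1' h2'.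
  have := mulIf d12 (etrans (esym h1) h1'); have := mulfI d12 (etrans h2 (esym h2')).
  move=> /addIr E2 /addIr E1; move: E E1 E2.
  by case: (u) => [[? ?] ?]; case: (u') => [[? ?] ?] /= -> -> ->.
have Pp : (#|P| <= #|F| ^ 2)%N by rewrite cP leq_exp2r // EM0 max_card.
have Q1 : (432 * r * (2 * #|P|) < (64 * r * M0) ^ 2)%N.
  rewrite cP (expnMn (64 * r)); have : (0 < M0 ^ 2)%N by rewrite expn_gt0 M0_gt0.
  by move: r_gt0; clear; move: (M0 ^ 2)%N => x r0 x0; rewrite -mulnn; nia.
have Q2 : (64 * r <= 64 * r * M0)%N by rewrite leq_pmulr.
have Q3 : (4 * M0 <= 64 * r * M0)%N.
  by rewrite leq_mul2r; apply/orP; right; move: r_gt0; clear; lia.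
have Inc := rud nz col Pp Q1 Q2 Q3.
have En : (#|[set z : (F * F) * (F * F) | [&& z.1 \in setX Dir Dir, z.2 \in setX Dir Dir & f z.1 == f z.2]]|
   <= #|[set u | [&& u.1 \in P, u.2 \in P & incid u.1 u.2]]|)%N.
  pose h (z : (F * F) * (F * F)) := (e (z.1.1, z.2.1), e (z.1.2, z.2.2)).
  rewrite -(card_in_imset (f := h)).
    apply: subset_leq_card; apply/subsetP => u /imsetP; move=> [[[a b] [a' b']] + ->].
    rewrite inE !in_setX /= => /and3P[/andP[aD bD] /andP[aD' bD'] /eqP].
    rewrite !fE //= => E; rewrite inE /= !imset_f ?in_setX ?aD ?bD ?aD' ?bD' //=.
    rewrite /incid /= -subr_eq0; apply/eqP.
    transitivity ((X a' * X b' * (b' - a') - X a * X b * (b - a)) / (X a * X b)).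
      by field; rewrite !X0.
    by rewrite E subrr mul0r.
  move=> [[a b] [a' b']] [[c d] [c' d']]; rewrite !inE /=.
  move=> /and3P[/andP[aD bD] /andP[aD' bD'] _] /and3P[/andP[cD dD] /andP[cD' dD'] _].
  move=> /eqP; rewrite xpair_eqE => /andP[/eqP h1 /eqP h2].
  have := e_inj _ _ _ _ h1; have := e_inj _ _ _ _ h2; rewrite !in_setX /=.
  by rewrite bD bD' dD dD' aD aD' cD cD' => /(_ isT isT)[-> ->] /(_ isT isT)[-> ->].
pose T := f @: setX Dir Dir.
have T_le : (M0 <= 128 * r * #|T|)%N.
  have := leq_trans (energy_ge_image f (setX Dir Dir)) (leq_mul (leqnn _) (leq_trans En Inc)).
  rewrite cardsX -EM0 cP -/T mulnn => h.
  have M3 : (0 < M0 ^ 3)%N by rewrite expn_gt0 M0_gt0.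
  rewrite -(leq_pmul2r M3) -expnS -[(M0 ^ _)%N]/(M0 ^ (2 * 2))%N expnM; apply: leq_trans h _.
  by rewrite (expnS M0 2); move: (M0 ^ 2)%N #|T|; clear; lia.
(* An upper right entry -t is kept under multiplication by [lower x] on the right, and for t nonzero
   the other entry of the row then determines x. *)
have R4 : ((#|T| - 1) * v <= #|R 4|)%N.
  pose gt (t : F) := odflt 1%g [pick g in (H ^+ 2)%g | (row1 g).2 == - t].
  have gtP t : t \in T -> gt t \in (H ^+ 2)%g /\ (row1 (gt t)).2 = - t.
    move=> /imsetP[[a b]]; rewrite in_setX => /andP[/= aD bD] ->.
    rewrite /gt; case: pickP => [g /andP[gH /eqP ge]|/(_ (rp (Some a) * (rp (Some b))^-1)%g)]; first by split.
    rewrite row1_mulV eqxx andbT (@memM 1 1) // Hpow1; first by have [] := rpS _ aD.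
    by apply: HV; have [] := rpS _ bD.
  have cT : (#|T| - 1 <= #|T :\ 0%R|)%N by rewrite leq_subLR (cardsD1 0 T) leq_add2r leq_b1.
  apply: (@leq_trans (#|T :\ 0%R| * v)); first by rewrite leq_mul2r cT orbT.
  rewrite -cardsX -(card_in_imset (f := fun z => row1 (gt z.1 * lower z.2)%g)).
    apply: subset_leq_card; apply/subsetP => z /imsetP[[t x] + ->]; rewrite in_setX /=.
    rewrite in_setD1 => /andP[/andP[_ tT]]; rewrite inE => xV; apply: imset_f.
    by have [h1 _] := gtP _ tT; apply: (@memM 2 2).
  move=> [t x] [t' x']; rewrite !in_setX !in_setD1 /=.
  move=> /andP[/andP[t0 /gtP[_ h1]] _] /andP[/andP[_ /gtP[_ h1']] _].
  rewrite !row1M !vact_lower => /eqP; rewrite xpair_eqE h1 h1' => /andP[/eqP e1 /eqP/oppr_inj et].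
  rewrite -et in e1 *; move/addrI: e1; have t0' : - t != 0 by rewrite oppr_eq0.
  by move=> /(mulfI t0') ->.
have := leq_trans R4 (leq_trans (R_le (isT : (4 <= 8)%N)) (leq_mul (leqnn Lam) R1_le)).
move: T_le W_big V_W Dir_W M0_gt0; rewrite -EM0 -/v.
have ss0 : (0 < s ^ 2)%N by rewrite expn_gt0 s_gt0.
move: (s ^ 2)%N Lam_gt0 r_gt0 ss0 => ss L0 r0 ss0 hT hW hV hD hM hR.
have T8 : (2 <= #|T|)%N.
  rewrite leqNgt ltnS; apply/negP => T1.
  have h1 : (M0 <= 128 * r)%N by apply: leq_trans hT _; rewrite -[X in (_ <= X)%N]muln1 leq_mul2l T1 orbT.
  have h2 : (128 * r <= 1024 * r * Lam * ss)%N.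
    by rewrite -!mulnA; apply: leq_mul => //; rewrite leq_pmulr // muln_gt0 L0.
  by have := leq_trans hD (leq_trans h1 h2); rewrite leqNgt hW.
have h1 : (M0 <= 256 * r * (#|T| - 1))%N.
  apply: leq_trans hT _; move: T8; clear; nia.
have : (M0 * v <= 1024 * r * Lam * ss * M0)%N.
  apply: (@leq_trans (256 * r * ((#|T| - 1) * v))%N); first by rewrite mulnA leq_mul2r h1 orbT.
  apply: (@leq_trans (256 * r * (Lam * (2 * ss * (M0 + 1))))%N); first by rewrite leq_mul2l hR orbT.
  apply: (@leq_trans (256 * r * (Lam * (2 * ss * (M0 + M0))))%N).
    by rewrite !leq_mul2l leq_add2l hM !orbT.
  by apply: eq_leq; clear; lia.
by rewrite mulnC leq_pmul2r // leqNgt (leq_trans hW hV).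
Qed.

(** The big cell: if h is not lower triangular and z is nonzero, the product of [lower x], the
    conjugate of [lower z] by h, and [lower y] determines x, y and z. It uses 2 + 1 + 2 + 1 + 2
    factors of H. *)
Lemma product_large : (v ^ 2 * (v - 1) <= #|(H ^+ 8)%g|)%N.
Proof.
have [h hH h0] : exists2 h, h \in H & (row1 h).2 != 0.
  have D2 : (1 < #|Dir|)%N.
    apply: leq_trans Dir_W; apply: leq_trans ss_W; rewrite ltnS expn_gt0 s_gt0.
    by [].
  have [w] : exists2 w, w \in Dir & w != 0.
    apply/exists_inP; apply: contraTT D2; rewrite negb_exists_in -leqNgt => /forall_inP D0.
    rewrite -(cards1 (0 : F)); apply: subset_leq_card; apply/subsetP => w /D0.
    by rewrite inE negbK.
  move=> /imsetP[u]; rewrite inE => /andP[/imsetP[h hH ->] _] ->; rewrite mulf_eq0 negb_or.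
  by move=> /andP[h0 _]; exists h.
have c0 : #|[set z in V 2 | z != 0]| = (v - 1)%N.
  rewrite /v (cardsD1 0 (V 2)) V0 add1n subn1 /=; apply: eq_card => z.
  by rewrite !inE andbC.
have det := det_rows h; rewrite /det2 in det.
move: det h0; set a := (row1 h).1; set b := (row1 h).2; set c := (row2 h).1; set d := (row2 h).2 => det b0.
pose f (z : (F * F) * F) : sl2 F :=
  (lower z.1.1 * (h * lower z.2 * h^-1 * lower z.1.2))%g.
have rowE z : row1 (f z) = (1 + z.2 * b * d - z.2 * b ^+ 2 * z.1.2, - (z.2 * b ^+ 2)).
  have lrow y (g : sl2 F) : row1 (lower y * g)%g = row1 g.
    by rewrite row1M /row1 /= -/(row1 g) /vact /= !(mul1r, mul0r, addr0) -surjective_pairing.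
  rewrite /f lrow !row1M !vact_lower /vact row1V row2V /= -/a -/b -/c -/d.
  by congr pair; rewrite -?det; ring.
have f_inj : {in setX (setX (V 2) (V 2)) [set z in V 2 | z != 0] &, injective f}.
  move=> [[x y] z] [[x' y'] z']; rewrite !in_setX !(in_set (fun z => (z \in V 2) && (z != 0))) /=.
  move=> /andP[_ /andP[_ z0]] /andP[_ /andP[_ z'0]] e.
  have := rowE (x, y, z); have := rowE (x', y', z'); rewrite -e => -> [] /=.
  move=> e1 /oppr_inj /(mulIf (expf_neq0 2 b0)) ez; rewrite ez in e1 *.
  have ey : y' = y.
    have nz : z * b ^+ 2 != 0 by rewrite mulf_neq0 // expf_neq0.
    by apply: (mulfI nz); apply: oppr_inj; apply: (addrI (1 + z * b * d)); rewrite -ez in e1 *.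
  move: e; rewrite /f /= ey ez => /mulIg/lower_inj -> //.
rewrite -c0 -mulnn -!cardsX -(card_in_imset f_inj); apply: subset_leq_card.
apply/subsetP => g /imsetP[[[x y] z] + ->]; rewrite !in_setX (in_set (fun z => (z \in V 2) && (z != 0))) /=.
move=> /andP[/andP[xV yV] /andP[zV _]]; rewrite !inE in xV yV zV.
have hH1 : h \in (H ^+ 1)%g by rewrite Hpow1.
apply: (@memM 2 6) => //; apply: (@memM 4 2) => //; apply: (@memM 3 1); last exact: memV.
exact: (@memM 1 2).
Qed.

Theorem sl2_growth : (#|F| ^ 3 <= 2 * s ^ 3 * Lam * #|H|)%N.
Proof.
have Hv := unipotent_large torus_large.
have v2 : (2 <= v)%N by apply: leq_trans V_W; apply: leq_trans ss_W; rewrite ltnS expn_gt0 s_gt0.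
have := leq_trans product_large (grow (isT : (8 <= 10)%N)).
have : (#|F| ^ 3 <= (s * v) ^ 3)%N by rewrite leq_exp2r // ltnW.
rewrite expnMn => h1 h2; apply: (leq_trans h1).
have : (v ^ 3 <= 2 * (v ^ 2 * (v - 1)))%N.
  by rewrite (expnSr v 2) mulnCA leq_mul2l; apply/orP; right; lia.
move=> h3; apply: (@leq_trans (s ^ 3 * (2 * (Lam * #|H|)))%N).
  by rewrite leq_mul2l (leq_trans h3) ?orbT // leq_mul2l.
by move: (s ^ 3)%N #|H|; clear; lia.
Qed.

End SL2Growth.

(** * The spectral gap *)

Lemma cauchy_schwarz_fin (R : realFieldType) (I : finType) (f g : I -> R) :
  (\sum_i f i * g i) ^+ 2 <= (\sum_i f i ^+ 2) * (\sum_i g i ^+ 2).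
Proof.
have := cauchy_schwarz_sum [set: I] f g.
have E (k : I -> R) : \sum_(i in [set: I]) k i = \sum_i k i.
  by apply: eq_bigl => i; rewrite inE.
by rewrite !E.
Qed.

(** * Almost extremal functions and their correlations *)

Section Extremal.

Variables (R : realType) (G : finGroupType) (Om : finType) (act : Om -> G -> Om).
Hypotheses (actM : forall v g h, act v (g * h)%g = act (act v g) h)
  (act1 : forall v, act v 1%g = v).
Variable E : (Om -> R) -> Prop.
Hypothesis E_comb : forall (J : finType) (f : Om -> R) (k : J -> Om -> R) (a b : R),
  E f -> (forall j, E (k j)) -> E (fun v => a * f v + b * \sum_j k j v).
Hypothesis E_act : forall f g, E f -> E (fun v => f (act v g)).

Implicit Types (f h : Om -> R).

Definition ip f h : R := \sum_v f v * h v.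
Definition corr f (g : G) : R := ip f (fun v => f (act v g)).

Lemma ipE f : ip f f = \sum_v f v ^+ 2.
Proof. by apply: eq_bigr => v _; rewrite expr2. Qed.

Lemma ip_ge0 f : 0 <= ip f f.
Proof. by apply: sumr_ge0 => v _; rewrite -expr2 sqr_ge0. Qed.

Lemma act_inj g : injective (act^~ g).
Proof. by apply: (can_inj (g := act^~ (g^-1)%g)) => v; rewrite -actM mulgV act1. Qed.

Lemma sum_act (k : Om -> R) g : \sum_v k (act v g) = \sum_v k v.
Proof. by rewrite [RHS](reindex_inj (@act_inj g)). Qed.

Lemma ip_act f h g : ip (fun v => f (act v g)) h = ip f (fun v => h (act v (g^-1)%g)).
Proof.
rewrite /ip -[RHS](sum_act _ g); apply: eq_bigr => v _.
by rewrite -actM mulgV act1.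
Qed.

Lemma corr1 f : corr f 1%g = ip f f.
Proof. by apply: eq_bigr => v _; rewrite act1. Qed.

Lemma corrV f g : corr f (g^-1)%g = corr f g.
Proof. by rewrite /corr -ip_act /ip; apply: eq_bigr => v _; rewrite mulrC. Qed.

Lemma ip_le (f h : Om -> R) (x : R) : 0 < x -> ip f h <= (x * ip f f + x^-1 * ip h h) / 2.
Proof.
move=> x0; rewrite ler_pdivlMr //.
have : 0 <= \sum_v x^-1 * (x * f v - h v) ^+ 2.
  by apply: sumr_ge0 => v _; rewrite mulr_ge0 ?sqr_ge0 // invr_ge0 ltW.
have -> : \sum_v x^-1 * (x * f v - h v) ^+ 2 = x * ip f f + x^-1 * ip h h - ip f h * 2.
  rewrite /ip mulr_suml !mulr_sumr -big_split -sumrB /=; apply: eq_bigr => v _.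
  by field; rewrite gt_eqF.
by rewrite subr_ge0.
Qed.

Lemma corr_le f g : corr f g <= ip f f.
Proof.
have := ip_le f (fun v => f (act v g)) ltr01; rewrite invr1 !mul1r.
have -> : ip (fun v => f (act v g)) (fun v => f (act v g)) = ip f f.
  exact: (sum_act (fun v => f v * f v)).
by rewrite /corr; lra.
Qed.

(** Cauchy-Schwarz for f against the sum of its translates by the inverses of the elements of Y. *)
Lemma corr_pos_def f (Y : {set G}) : 0 < ip f f ->
  (\sum_(y in Y) corr f y) ^+ 2 <= ip f f * \sum_(y in Y) \sum_(z in Y) corr f (y * z^-1)%g.
Proof.
move=> f0; pose k v := \sum_(y in Y) f (act v (y^-1)%g).
have e1 : \sum_(y in Y) corr f y = ip f k.
  under eq_bigr do rewrite -corrV.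
  by rewrite exchange_big /=; apply: eq_bigr => v _; rewrite mulr_sumr.
have e2 : \sum_(y in Y) \sum_(z in Y) corr f (y * z^-1)%g = ip k k.
  transitivity (\sum_(y in Y) \sum_(z in Y) ip (fun v => f (act v (y^-1)%g)) (fun v => f (act v (z^-1)%g))).
    apply: eq_bigr => y _; apply: eq_bigr => z _; rewrite ip_act invgK.
    by apply: eq_bigr => v _; rewrite actM.
  rewrite /ip; under eq_bigr do rewrite exchange_big /=.
  rewrite exchange_big /=; apply: eq_bigr => v _; rewrite mulr_suml.
  by apply: eq_bigr => y _; rewrite mulr_sumr.
rewrite e1 e2; have := cauchy_schwarz_fin f k.
by rewrite -!ipE.
Qed.

Section Averaging.

Variables (I : finType) (t : I -> G).
Hypothesis I_gt0 : (0 < #|I|)%N.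
Let n : R := #|I|%:R.
Let n_neq0 : n != 0. Proof. by rewrite pnatr_eq0 -lt0n. Qed.

Definition avg f v : R := n^-1 * \sum_i f (act v (t i)).
(** The adjoint of [avg] applied after [avg]; this is why the words below are quotients of two
    moves. *)
Definition gram f v : R := (n ^+ 2)^-1 * \sum_(i : I * I) f (act v ((t i.1)^-1 * t i.2)%g).

Lemma ip_avg f h : ip (avg f) (avg h) = ip (gram f) h.
Proof.
rewrite /ip /avg /gram.
transitivity ((n ^+ 2)^-1 * \sum_(i : I * I) \sum_v f (act v (t i.2)) * h (act v (t i.1))).
  rewrite exchange_big mulr_sumr; apply: eq_bigr => v _ /=.
  rewrite -(pair_big xpredT xpredT (fun i j => f (act v (t j)) * h (act v (t i)))) /=.
  under [in RHS]eq_bigr do rewrite -mulr_suml.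
  by rewrite -mulr_sumr; field.
rewrite (eq_bigr (fun i : I * I => \sum_v f (act v ((t i.1)^-1 * t i.2)%g) * h v)).
  rewrite exchange_big mulr_sumr; apply: eq_bigr => v _ /=.
  by rewrite -mulr_suml mulrA.
move=> i _; rewrite -[RHS](sum_act _ (t i.1)); apply: eq_bigr => v _.
by rewrite -!actM mulKVg.
Qed.

Lemma avg_le f : ip (avg f) (avg f) <= ip f f.
Proof.
have H v : avg f v * avg f v <= n^-1 * \sum_i f (act v (t i)) * f (act v (t i)).
  rewrite /avg; have := cauchy_schwarz_fin (fun i => f (act v (t i))) (fun=> 1).
  under eq_bigr do rewrite mulr1.
  under [X in _ <= _ * X]eq_bigr do rewrite expr1n.
  rewrite sumr_const -/n mulrC => Hs.
  have n0 : 0 < n by rewrite ltr0n.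
  have -> : n^-1 * (\sum_i f (act v (t i))) * (n^-1 * (\sum_i f (act v (t i)))) =
    (n ^+ 2)^-1 * (\sum_i f (act v (t i))) ^+ 2 by field.
  rewrite ler_pdivrMl ?exprn_gt0 //; apply: le_trans Hs _.
  rewrite mulrA; have -> : n ^+ 2 / n = n by field.
  by under [in leRHS]eq_bigr do rewrite -expr2.
apply: le_trans (ler_sum _ (fun v _ => H v)) _.
rewrite -mulr_sumr exchange_big /=.
under eq_bigr do rewrite (sum_act (fun v => f v * f v)).
by rewrite sumr_const -/(ip f f) -[_ *+ _]mulr_natl mulrA mulVf // mul1r.
Qed.

(* The function nearly maximises the Rayleigh quotient of [gram], so it is almost an
   eigenfunction and its autocorrelation is almost harmonic. *)
Lemma extremal (f0 : Om -> R) (ka tau : R) : 0 < ka -> 0 < tau -> E f0 ->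
  ka * ip f0 f0 < ip (avg f0) (avg f0) ->
  exists f, [/\ E f, 0 < ip f f & forall g, 0 <= corr f g ->
    ka * corr f g - tau * ip f f <=
      (n ^+ 2)^-1 * \sum_(i : I * I) corr f (g * ((t i.1)^-1 * t i.2))%g].
Proof.
move=> ka0 tau0 Ef0 Hf0.
(* The Rayleigh quotients. Their supremum c need not be shown to be attained, since a function
   within tau^2 of it suffices. *)
pose S : classical_sets.set R := fun x : R =>
  exists2 f, E f & 0 < ip f f /\ x * ip f f = ip (avg f) (avg f).
have f00 : 0 < ip f0 f0.
  rewrite lt_def ip_ge0 andbT; apply: contraTneq Hf0 => h.
  by have := avg_le f0; rewrite h mulr0 -leNgt.
have S0 : S (ip (avg f0) (avg f0) / ip f0 f0).
  by exists f0 => //; split=> //; rewrite divfK // gt_eqF.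
have Sub : classical_sets.ubound S 1.
  by move=> x [f Ef [f1 e]]; rewrite -(ler_pM2r f1) e mul1r avg_le.
have Ssup : classical_sets.has_sup S by split; [exists (ip (avg f0) (avg f0) / ip f0 f0)|exists 1].
set c := sup S.
have c1 : c <= 1 by apply: ge_sup => //; exists (ip (avg f0) (avg f0) / ip f0 f0).
have cka : ka <= c.
  apply: le_trans (sup_upper_bound Ssup S0); rewrite ler_pdivlMr //; exact: ltW.
have c_max f : E f -> ip (avg f) (avg f) <= c * ip f f.
  move=> Ef; have [f1|f1] := ltP 0 (ip f f).
    rewrite -ler_pdivrMr //; apply: sup_upper_bound => //.
    by exists f => //; split=> //; rewrite divfK // gt_eqF.
  have f2 : ip f f = 0 by apply/eqP; rewrite eq_le f1 ip_ge0.
  by have := avg_le f; rewrite f2 mulr0.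
have [x [f Ef [f1 ex]] xc] := sup_adherent (exprn_gt0 2 tau0) Ssup.
exists f; split=> // g g0; rewrite -/c in xc.
pose h v := c * f v - gram f v.
have Eu : E (fun v => (1 - c) * f v + (n ^+ 2)^-1 * \sum_(i : I * I) f (act v ((t i.1)^-1 * t i.2)%g)).
  by apply: E_comb => // i; apply: E_act.
(* Maximality of c tested on u = f - h gives (2 - c) <h, h> <= c <f, f> - <gram f, f>, and c <=
   1. *)
have hE : ip h h <= tau ^+ 2 * ip f f.
  have := c_max _ Eu; set u := (fun v => _).
  have uE v : u v = f v - h v by rewrite /u /h /gram; ring.
  have -> : ip u u = ip f f - 2 * ip f h + ip h h.
    rewrite /ip mulr_sumr -sumrB -big_split /=; apply: eq_bigr => v _; rewrite uE; ring.
  have -> : ip (avg u) (avg u) = ip (avg f) (avg f) - 2 * ip (avg f) (avg h) + ip (avg h) (avg h).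
    have auE v : avg u v = avg f v - avg h v.
      by rewrite /avg -mulrBr -sumrB; congr (_ * _); apply: eq_bigr => i _; rewrite uE.
    rewrite /ip mulr_sumr -sumrB -big_split /=; apply: eq_bigr => v _; rewrite auE; ring.
  rewrite (ip_avg f h); have a1 := ip_ge0 (avg h).
  have -> : ip (gram f) h = c * ip f h - ip h h.
    have gE v : gram f v = c * f v - h v by rewrite /h; ring.
    by rewrite /ip mulr_sumr -sumrB; apply: eq_bigr => v _; rewrite gE; ring.
  have b1 : c * ip h h <= 1 * ip h h by rewrite ler_wpM2r ?ip_ge0.
  have b2 : (c - tau ^+ 2) * ip f f < ip (avg f) (avg f) by rewrite -ex ltr_pM2r.
  by nra.
have -> : (n ^+ 2)^-1 * \sum_(i : I * I) corr f (g * ((t i.1)^-1 * t i.2))%g =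
    c * corr f g - ip f (fun v => h (act v g)).
  rewrite /corr /ip exchange_big /= mulr_sumr mulr_sumr -sumrB; apply: eq_bigr => v _.
  rewrite /h /gram -mulr_sumr.
  under eq_bigr do rewrite actM.
  ring.
have := ip_le f (fun v => h (act v g)) tau0.
have -> : ip (fun v => h (act v g)) (fun v => h (act v g)) = ip h h.
  exact: (sum_act (fun v => h v * h v)).
have h2 : tau^-1 * ip h h <= tau * ip f f.
  by rewrite ler_pdivrMl // mulrA -expr2.
have h3 : ka * corr f g <= c * corr f g by rewrite ler_wpM2r.
by lra.
Qed.

End Averaging.

End Extremal.

(** * Square-summability of the correlations *)

Section Balanced.

Variables (R : realType) (F : finFieldType).
Implicit Types (v w : F * F) (f : F * F -> R) (g : sl2 F).

Definition scale (t : F) v : F * F := (t * v.1, t * v.2).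

(** Mean-zero functions on the projective line, lifted to the plane by homogeneity so that [vact]
    acts on them linearly. *)
Definition balanced f : Prop :=
  [/\ f (0, 0) = 0, \sum_v f v = 0 & forall t v, t != 0 -> f (scale t v) = f v].

Lemma vact_scale t v g : vact (scale t v) g = scale t (vact v g).
Proof. by rewrite /vact /scale /=; congr pair; ring. Qed.

Lemma balanced_comb (J : finType) f (k : J -> F * F -> R) (a b : R) :
  balanced f -> (forall j, balanced (k j)) -> balanced (fun v => a * f v + b * \sum_j k j v).
Proof.
move=> [f0 fs fh] Hk; split.
- by rewrite f0 big1 => [|j _]; [rewrite !mulr0 addr0|have [] := Hk j].
- rewrite big_split /= -!mulr_sumr fs mulr0 add0r exchange_big /= big1 ?mulr0 // => j _.
  by have [] := Hk j.
- move=> t v t0; rewrite fh //; congr (_ + _ * _); apply: eq_bigr => j _.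
  by have [_ _ ->] := Hk j.
Qed.

Lemma balanced_act f g : balanced f -> balanced (fun v => f (vact v g)).
Proof.
move=> [f0 fs fh]; split.
- by rewrite /vact /= !mul0r addr0.
- by rewrite (sum_act (@vactM F) (@vact1 F)).
- by move=> t v t0; rewrite vact_scale fh.
Qed.

Lemma card_row1_fiber v : (#|[set g : sl2 F | row1 g == v]| <= #|F|)%N.
Proof.
set X := [set g | _]; have [X0|[k kX]] := set_0Vmem X; first by rewrite X0 cards0.
have inj : {in X &, injective (fun g => (row2 (g * k^-1)%g).1)}.
  move: kX; rewrite inE => /eqP ek g h; rewrite !inE => /eqP eg /eqP eh e.
  by apply: (mulIg k^-1%g); rewrite (row1_mulV_eq (etrans eg (esym ek))) (row1_mulV_eq (etrans eh (esym ek))) e.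
by rewrite -(card_in_imset inj) max_card.
Qed.

Lemma row1_surj v : v != (0, 0) -> exists g, row1 g = v.
Proof.
case: v => a b; rewrite xpair_eqE negb_and; have [->|a0] /= := eqVneq a 0.
  move=> b0; have H : det2 (0, b) (- b^-1, 0) = 1 by rewrite /det2 /=; field.
  by exists (sl2_of H).
move=> _; have H : det2 (a, b) (0, a^-1) = 1 by rewrite /det2 /=; field.
by exists (sl2_of H).
Qed.

Lemma parallelP v w : v != (0, 0) -> det2 v w = 0 -> exists t, w = scale t v.
Proof.
case: v w => [a b] [c d]; rewrite xpair_eqE negb_and /det2 /scale /=.
have [->|a0] /= := eqVneq a 0.
  move=> b0; rewrite mul0r sub0r => /eqP; rewrite oppr_eq0 mulf_eq0 (negPf b0) /= => /eqP ->.
  by exists (d / b); rewrite mulr0 divfK.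
move=> _ /eqP; rewrite subr_eq0 => /eqP e; exists (c / a); rewrite divfK //; congr pair.
by apply: (mulfI a0); rewrite e; field.
Qed.

Lemma card_parallel v : v != (0, 0) -> (#|[set w | det2 v w == 0%R]| <= #|F|)%N.
Proof.
move=> v0; rewrite -cardsT; apply: leq_trans (leq_imset_card (fun t => scale t v) [set: F]).
apply: subset_leq_card; apply/subsetP => w; rewrite inE => /eqP /(parallelP v0)[t ->].
by apply: imset_f; rewrite inE.
Qed.

(* SL2 is simply transitive on pairs of vectors of determinant 1, so by homogeneity
   all non-parallel pairs (v, w) contribute the same amount. *)
Lemma sum_corr2 f : balanced f ->
  \sum_g corr (@vact F) f g ^+ 2 <= 2 * #|F|%:R ^+ 2 * ip f f ^+ 2.
Proof.
move=> [f0 fs fh].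
pose P0 := \sum_(g : sl2 F) f (row1 g) ^+ 2; pose S := \sum_(g : sl2 F) f (row1 g) * f (row2 g).
pose Phi v w := \sum_(g : sl2 F) f (vact v g) * f (vact w g).
have PhiN v w : det2 v w != 0 -> Phi v w = S.
  move=> D0; have H : det2 v (scale (det2 v w)^-1 w) = 1.
    by move: D0; rewrite /det2 /scale /= => D0; field.
  rewrite /S (reindex_inj (mulgI (sl2_of H))); apply: eq_bigr => g _.
  by rewrite row1M row2M /= [row2 _]/(scale _ w) vact_scale fh ?invr_eq0.
have PhiP v t : v != (0, 0) -> t != 0 -> Phi v (scale t v) = P0.
  move=> /row1_surj[h <-] t0; rewrite /P0 (reindex_inj (mulgI h)); apply: eq_bigr => g _.
  by rewrite row1M vact_scale fh // expr2.
have E1 : \sum_g corr (@vact F) f g ^+ 2 = \sum_v \sum_w f v * f w * Phi v w.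
  rewrite /corr /ip; under eq_bigr do rewrite expr2 mulr_suml.
  rewrite exchange_big; apply: eq_bigr => v _ /=; under eq_bigr do rewrite mulr_sumr.
  rewrite exchange_big; apply: eq_bigr => w _ /=; rewrite mulr_sumr.
  by apply: eq_bigr => g _; ring.
pose N1 := \sum_v \sum_(w | det2 v w == 0) f v * f w.
(* Since f has sum zero, the products over non-parallel pairs add up to -N1. *)
have E2 : \sum_v \sum_w f v * f w * Phi v w = (P0 - S) * N1.
  have Z : \sum_v \sum_w f v * f w = 0.
    by rewrite big1 // => v _; rewrite -mulr_sumr fs mulr0.
  have -> : (P0 - S) * N1 = P0 * N1 + S * (\sum_v \sum_w f v * f w - N1).
    by rewrite Z; ring.
  rewrite /N1 -sumrB !mulr_sumr -big_split; apply: eq_bigr => v _ /=.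
  rewrite (bigID (fun w => det2 v w == 0)) [in X in _ = _ + S * (X - _)](bigID (fun w => det2 v w == 0)) /=.
  rewrite addrAC subrr add0r !mulr_sumr; congr (_ + _); apply: eq_bigr => w; last first.
    by move=> D0; rewrite PhiN // mulrC.
  have [->|v0] := eqVneq v (0, 0); first by rewrite f0 !mul0r mulr0.
  move=> /eqP/(parallelP v0)[t ->]; have [->|t0] := eqVneq t 0.
    by rewrite /scale !mul0r f0 mulr0 !mul0r mulr0.
  by rewrite PhiP // mulrC.
have term v w : det2 v w = 0 -> 0 <= f v * f w <= f v ^+ 2.
  have [->|v0] := eqVneq v (0, 0); first by rewrite f0 !mul0r expr0n lexx.
  move=> /(parallelP v0)[t ->]; have [->|t0] := eqVneq t 0.
    by rewrite /scale !mul0r f0 mulr0 lexx sqr_ge0.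
  by rewrite fh // -expr2 sqr_ge0 lexx.
have N10 : 0 <= N1.
  by apply: sumr_ge0 => v _; apply: sumr_ge0 => w /eqP/term/andP[].
have N1_le : N1 <= #|F|%:R * ip f f.
  rewrite ipE mulr_sumr; apply: ler_sum => v _.
  have [->|v0] := eqVneq v (0, 0).
    by rewrite f0 expr0n mulr0 big1 // => w _; rewrite mul0r.
  apply: (@le_trans _ _ (\sum_(w | det2 v w == 0) f v ^+ 2)).
    by apply: ler_sum => w /eqP/term/andP[].
  rewrite (eq_bigl (fun w => w \in [set w | det2 v w == 0])) => [|w]; last by rewrite inE.
  rewrite sumr_const -[_ *+ _]mulr_natl ler_wpM2r ?sqr_ge0 // ler_nat.
  exact: card_parallel.
have P0_le : P0 <= #|F|%:R * ip f f.
  have h := @sum_fiber_le R (sl2 F) (F * F)%type [set: sl2 F] (@row1 F) #|F| (fun v => f v ^+ 2).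
  have -> : P0 = \sum_(g in [set: sl2 F]) f (row1 g) ^+ 2 by apply: eq_bigl => g; rewrite inE.
  apply: le_trans (h _ _) _.
  - move=> v; apply: leq_trans (card_row1_fiber v); apply: subset_leq_card.
    by apply/subsetP => g; rewrite !inE.
  - by move=> v; apply: sqr_ge0.
  - rewrite ler_wpM2l // ipE big_mkcond; apply: ler_sum => v _; case: ifP => // _.
    exact: sqr_ge0.
have S_ge : - S <= P0.
  have P2 : \sum_(g : sl2 F) f (row2 g) ^+ 2 = P0.
    have H : det2 (0, 1) (- 1, 0) = 1 :> F by rewrite /det2 /=; ring.
    rewrite /P0 [RHS](reindex_inj (mulgI (sl2_of H))); apply: eq_bigr => g _.
    have r1 : row1 (sl2_of H) = (0, 1) by [].
    by rewrite row1M r1 /vact /= !(mul0r, mul1r, add0r) -surjective_pairing.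
  have : 0 <= \sum_(g : sl2 F) (f (row1 g) + f (row2 g)) ^+ 2.
    by apply: sumr_ge0 => g _; apply: sqr_ge0.
  have -> : \sum_(g : sl2 F) (f (row1 g) + f (row2 g)) ^+ 2 = P0 + 2 * S + P0.
    rewrite -[X in _ = _ + X]P2 /P0 /S mulr_sumr -!big_split /=; apply: eq_bigr => g _; ring.
  lra.
rewrite E1 E2; have P00 : 0 <= P0 by apply: sumr_ge0 => g _; apply: sqr_ge0.
apply: (@le_trans _ _ (2 * P0 * N1)); first by rewrite ler_wpM2r //; lra.
have -> : 2 * #|F|%:R ^+ 2 * ip f f ^+ 2 = 2 * (#|F|%:R * ip f f) * (#|F|%:R * ip f f) by ring.
by rewrite ler_pM // ?mulr_ge0 // ler_wpM2l.
Qed.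

End Balanced.

(** * From the spectral gap to a count *)

Section Cone.

Variables (R : realType) (F : finFieldType) (S : {set F}).
Implicit Types (v : F * F) (g : sl2 F).

Definition cone v : bool := (v.2 != 0) && (v.1 / v.2 \in S).

Definition cone_count g : nat := #|[set s in S | cone (vact (s, 1) g)]|.

Lemma cone_scale t v : t != 0 -> cone (scale t v) = cone v.
Proof.
move=> t0; rewrite /cone /scale /= mulf_eq0 (negPf t0) /=.
by have [->|v0] //= := eqVneq v.2 0; congr (_ \in S); field; rewrite v0 t0.
Qed.

Lemma card_cone_pairs g :
  #|[set v | cone v && cone (vact v g)]| = ((#|F| - 1) * cone_count g)%N.
Proof.
rewrite mulnC /cone_count; have -> : (#|F| - 1 = #|[set~ (0%R : F)]|)%N by rewrite cardsC1 subn1.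
rewrite -cardsX -[RHS](card_in_imset (f := fun z : F * F => scale z.2 (z.1, 1))).
  apply: eq_card => v; rewrite inE; apply/andP/imsetP => [[vS vgS]|[[s t] + ->]].
    have /andP[v0 sS] := vS.
    have Ev : v = scale v.2 (v.1 / v.2, 1).
      by rewrite /scale /= mulr1 mulrC divfK //; apply: surjective_pairing.
    exists (v.1 / v.2, v.2) => //; rewrite in_setX !inE /= sS v0 andbT.
    by rewrite -(cone_scale _ v0) -vact_scale -Ev.
  rewrite in_setX !inE /= => /andP[/andP[sS h] t0]; rewrite vact_scale !cone_scale //.
  by rewrite h /cone /= oner_eq0 divr1 sS.
move=> [s t] [s' t']; rewrite !in_setX !inE /= => /andP[_ t0] _.
by rewrite /scale /= !mulr1 => -[] + et; rewrite -et => /(mulfI t0) ->.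
Qed.

Lemma cone_count1 : cone_count 1%g = #|S|.
Proof.
rewrite /cone_count; apply: eq_card => s; rewrite inE vact1 /cone /= oner_eq0 divr1.
by rewrite andbb.
Qed.

Let q : R := #|F|%:R.
Let q1 : 1 < q.
Proof.
rewrite /q ltr1n; have : (0 < #|[set~ (0%R : F)]|)%N.
  by apply/card_gt0P; exists 1; rewrite !inE oner_eq0.
by rewrite cardsC1; case: #|F| => [|[]].
Qed.
Let m : R := #|S|%:R / (q + 1).

Definition centered_cone v : R := (cone v)%:R - m * (v != (0, 0))%:R.

Let cone_nz v : cone v -> v != (0, 0).
Proof. by move=> /andP[h _]; apply: contraNneq h => ->. Qed.

Let sum_cone g : \sum_v (cone v)%:R * (cone (vact v g))%:R = (q - 1) * (cone_count g)%:R :> R.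
Proof.
transitivity (#|[set v | cone v && cone (vact v g)]|%:R : R).
  rewrite -sum1_card natr_sum [RHS]big_mkcond; apply: eq_bigr => v _; rewrite inE.
  by case: (cone v); case: (cone (vact v g)); rewrite ?mulr0 ?mul0r ?mulr1.
by rewrite card_cone_pairs natrM natrB // -ltnS; move: q1; rewrite /q ltr1n => /ltnW.
Qed.

Let sum_cone1 : \sum_v (cone v)%:R = (q - 1) * #|S|%:R :> R.
Proof.
rewrite -cone_count1 -sum_cone; apply: eq_bigr => v _; rewrite vact1.
by case: (cone v); rewrite ?mulr0 ?mulr1.
Qed.

Let sum_nz : \sum_v (v != (0, 0) :> F * F)%:R = q ^+ 2 - 1 :> R.
Proof.
transitivity (#|[set~ ((0, 0) : F * F)]|%:R : R).
  rewrite -sum1_card natr_sum [RHS]big_mkcond; apply: eq_bigr => v _; rewrite !inE.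
  by case: (v == _).
rewrite cardsC1 card_prod -subn1 natrB ?natrM ?expr2 //.
by rewrite muln_gt0 andbb; apply/card_gt0P; exists 0.
Qed.

Lemma corr_centered_cone g :
  corr (@vact F) centered_cone g = (q - 1) * ((cone_count g)%:R - #|S|%:R ^+ 2 / (q + 1)).
Proof.
have q0 : q + 1 != 0 by rewrite gt_eqF //; move: q1; lra.
transitivity ((q - 1) * (cone_count g)%:R - m * ((q - 1) * #|S|%:R)
   - m * ((q - 1) * #|S|%:R) + m ^+ 2 * (q ^+ 2 - 1)); last by rewrite /m; field.
rewrite -{1}sum_cone1 -[in X in _ - m * X + _]sum_cone1 -sum_nz -sum_cone.
rewrite -[in X in _ - m * X + _](sum_act (@vactM F) (@vact1 F) (fun v => (cone v)%:R) g).
rewrite !mulr_sumr -!sumrB -big_split; apply: eq_bigr => v _ /=.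
rewrite /centered_cone vact_eq0.
have := @cone_nz v; have := @cone_nz (vact v g); rewrite vact_eq0.
case: (cone v); case: (cone _); case: (v != _) => /= h1 h2; try by [|have := h1 isT|have := h2 isT].
all: ring.
Qed.

Lemma balanced_centered_cone : balanced centered_cone.
Proof.
split.
- by rewrite /centered_cone (eqxx (0, 0)) mulr0 subr0 /cone /= eqxx.
- rewrite /centered_cone sumrB -mulr_sumr sum_cone1 sum_nz /m.
  by field; rewrite gt_eqF //; move: q1; lra.
- move=> t v t0; rewrite /centered_cone cone_scale // /scale !xpair_eqE.
  by rewrite !mulf_eq0 (negPf t0).
Qed.

(** Expander mixing. The correlations of the centred cone, averaged over the t_i, are its inner
    product with its own average, hence at most x times its squared norm; the factor q - 1 for the
    vectors over each projective point cancels. *)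
Lemma cone_count_bound (I : finType) (t : I -> sl2 F) (x : R) (N : nat) :
  (0 < #|I|)%N -> 0 < x ->
  (forall f, balanced f -> ip (avg (@vact F) t f) (avg (@vact F) t f) <= x ^+ 2 * ip f f) ->
  (forall i, (N <= cone_count (t i))%N) ->
  N%:R <= #|S|%:R ^+ 2 / (q + 1) + x * #|S|%:R.
Proof.
move=> I0 x0 gap HN; set f := centered_cone; have I1 : 0 < #|I|%:R :> R by rewrite ltr0n.
have qm : 0 < q - 1 by move: q1; lra.
have qp : 0 < q + 1 by move: q1; lra.
have e : \sum_i corr (@vact F) f (t i) = #|I|%:R * ip f (avg (@vact F) t f).
  rewrite /corr /ip /avg exchange_big mulr_sumr; apply: eq_bigr => v _ /=.
  by rewrite -mulr_sumr; field; rewrite gt_eqF.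
have h1 : ip f (avg (@vact F) t f) <= x * ip f f.
  apply: le_trans (ip_le _ _ x0) _.
  have : x^-1 * ip (avg (@vact F) t f) (avg (@vact F) t f) <= x * ip f f.
    by rewrite ler_pdivrMl // mulrA -expr2 gap //; apply: balanced_centered_cone.
  lra.
have h2 : ip f f <= (q - 1) * #|S|%:R.
  rewrite -(corr1 (@vact1 F)) corr_centered_cone cone_count1 ler_pM2l // gerBl.
  by rewrite divr_ge0 ?exprn_ge0 // ltW.
have h3 : #|I|%:R * ((q - 1) * (N%:R - #|S|%:R ^+ 2 / (q + 1))) <= \sum_i corr (@vact F) f (t i).
  rewrite [leLHS]mulr_natl -sumr_const (eq_bigl xpredT) //; apply: ler_sum => i _.
  by rewrite corr_centered_cone ler_pM2l // lerD2r ler_nat.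
move: h3; rewrite e ler_pM2l // => h3.
have := le_trans h3 (le_trans h1 (ler_wpM2l (ltW x0) h2)).
by rewrite [leRHS]mulrCA ler_pM2l // lerBlDl.
Qed.

End Cone.

Fact upper_subproof (F : finFieldType) (x : F) : det2 (1, x) (0, 1) = 1.
Proof. by rewrite /det2 /= mulr1 mulr0 subr0. Qed.
Definition upper (F : finFieldType) (x : F) : sl2 F := sl2_of (upper_subproof x).

(** On the affine line the three factors send a2 + b2 to a2, then to a2 / (1 + la a2) = a1, then to
    a1 + b1. *)
Lemma inv_diff_pairs_le (p : nat) (A B : {set 'F_p}) (la b1 b2 : 'F_p) :
  b1 \in B -> b2 \in B ->
  (#|inv_diff_pairs A la| <=
     cone_count (sumset A B) (lower (- b2) * upper la * lower b1)%g)%N.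
Proof.
move=> b1B b2B.
have inj : {in inv_diff_pairs A la &, injective (fun a : 'F_p * 'F_p => a.2 + b2)}.
  move=> [a1 a2] [c1 c2]; rewrite !inE /= => /and5P[_ _ _ _ /eqP h1] /and5P[_ _ _ _ /eqP h2].
  move=> /addIr e; rewrite e in h1 *; congr pair; apply: invr_inj.
  by apply: (addIr (- c2^-1)); rewrite h1 h2.
rewrite -(card_in_imset inj); apply: subset_leq_card; apply/subsetP => s /imsetP[[a1 a2] + ->].
rewrite !inE /= => /and5P[a1A a2A a10 a20 /eqP h]; apply/andP; split.
  by apply/imset2P; exists a2 b2.
rewrite !vactM !vact_lower /= mul1r addrK /vact /row1 /row2 /= !(mulr1, mulr0, mul1r, addr0).
have E : a2 * la + 1 = a2 / a1.
  by rewrite -h mulrBr mulfV // subrK.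
rewrite /cone /= E mulf_neq0 ?invr_eq0 //=; apply/imset2P; exists a1 b1 => //.
rewrite mulrDl mulrAC mulfV ?mulf_neq0 ?invr_eq0 // mul1r; congr (_ + _).
by rewrite invf_div mulrC divfK.
Qed.

Lemma growth_stops (u : nat -> nat) (q m N : nat) : (0 < u 0)%N -> (u m <= N)%N -> (N < q ^ m)%N ->
  exists2 j, (j < m)%N & (u j.+1 <= q * u j)%N.
Proof.
move=> u0 uN Nq; apply: NNPP => H.
suff : (q ^ m <= u m)%N by lia.
elim: m {uN Nq} H => [|m IH] H; first by rewrite expn0.
have H' : ~ exists2 j, (j < m)%N & (u j.+1 <= q * u j)%N.
  by move=> [j jm h]; apply: H; exists j => //; apply: ltnW.
rewrite expnS; apply: (@leq_trans (q * u m)%N); first by rewrite leq_mul2l IH ?orbT.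
by rewrite ltnW // ltnNge; apply/negP => h; apply: H; exists m.
Qed.

(** * Level sets of the correlation *)

Section Flattening.

Variables (R : realType) (G : finGroupType) (Om : finType) (act : Om -> G -> Om).
Hypotheses (actM : forall v g h, act v (g * h)%g = act (act v g) h)
  (act1 : forall v, act v 1%g = v).
Variables (f : Om -> R) (J : finType) (w : J -> G) (N q : nat).
Let D := ip f f.
Let M := #|J|.
Hypotheses (D_gt0 : 0 < D) (M_gt0 : (0 < M)%N) (N_gt0 : (0 < N)%N) (q_big : (2 ^ 14 <= q)%N).
(** On every level up to q the error term is at most half of the main term. *)
Hypothesis harmonic : forall g, 0 <= corr act f g ->
  N%:R^-1 * corr act f g - (2 * N * q)%:R^-1 * D <= M%:R^-1 * \sum_i corr act f (g * w i)%g.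

Definition level (a : nat) : {set G} := [set g | D <= a%:R * corr act f g].

Let q_gt0 : (0 < q)%N. Proof. by apply: leq_trans q_big. Qed.

Lemma level1 a : (0 < a)%N -> 1%g \in level a.
Proof.
by move=> a0; rewrite inE corr1 // -/D -[leLHS]mul1r ler_pM2r // ler1n.
Qed.

Lemma levelV a g : (g^-1%g \in level a) = (g \in level a).
Proof. by rewrite !inE corrV. Qed.

Lemma level_ge0 a g : g \in level a -> 0 <= corr act f g.
Proof.
rewrite inE => h; have := lt_le_trans D_gt0 h; rewrite leNgt; apply: contraTN => c0.
by rewrite -leNgt mulr_ge0_le0 // ltW.
Qed.

Lemma level_sub a b : (a <= b)%N -> level a \subset level b.
Proof.
move=> ab; apply/subsetP => g ga; have c0 := level_ge0 ga; move: ga; rewrite !inE.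
by move=> /le_trans; apply; rewrite ler_wpM2r // ler_nat.
Qed.

Variable a : nat.
Hypotheses (a_gt0 : (0 < a)%N) (a_le : (32 * N ^ 2 * a ^ 2 <= q)%N).
(** Harmonicity sends many translates of [level a] into [level a1]; positive definiteness sends many
    quotients of elements of [level a1] into [level (2 * a1 ^ 2)], which is the level in the
    stopping condition [stop]. *)
Let a1 := (4 * N * a)%N.
Let a1_gt0 : (0 < a1)%N. Proof. by rewrite /a1 !muln_gt0 N_gt0 a_gt0. Qed.
Let a1q : (2 * a1 ^ 2 <= q)%N.
Proof. by apply: leq_trans a_le; rewrite /a1 !expnMn; apply: eq_leq; lia. Qed.
Let a_q : (a <= q)%N.
Proof.
apply: leq_trans a_le; rewrite -[(a ^ 2)%N]mulnn mulnA leq_pmull //.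
by rewrite muln_gt0 a_gt0 muln_gt0 expn_gt0 N_gt0.
Qed.

Let hits g (X : {set G}) := #|[set i | (g * w i)%g \in X]|.

Let level_hits g : g \in level a -> (M <= a1 * hits g (level a1))%N.
Proof.
move=> ga; have c0 := level_ge0 ga; have := harmonic c0.
have M0 : 0 < M%:R :> R by rewrite ltr0n.
have N0 : 0 < N%:R :> R by rewrite ltr0n.
have a0 : 0 < a%:R :> R by rewrite ltr0n.
have q0 : 0 < q%:R :> R by rewrite ltr0n.
have a10 : 0 < a1%:R :> R by rewrite ltr0n.
rewrite -(ler_pM2l M0) mulrA mulfV ?gt_eqF // mul1r => Hh.
have low : M%:R * ((2 * N * a)%:R^-1 * D) <= \sum_i corr act f (g * w i)%g.
  apply: le_trans Hh; rewrite ler_pM2l //.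
  have h1 : a%:R^-1 * D <= corr act f g by rewrite ler_pdivrMl //; move: ga; rewrite inE.
  have h2 : N%:R^-1 * (a%:R^-1 * D) <= N%:R^-1 * corr act f g by rewrite ler_pM2l ?invr_gt0.
  have h3 : (2 * N * q)%:R^-1 * D <= (2 * N * a)%:R^-1 * D.
    rewrite ler_pM2r // lef_pV2 ?posrE ?ltr0n ?muln_gt0 ?N_gt0 ?a_gt0 ?q_gt0 // ler_nat.
    by rewrite leq_mul2l a_q orbT.
  have h4 : N%:R^-1 * (a%:R^-1 * D) = 2 * ((2 * N * a)%:R^-1 * D).
    by rewrite !natrM; field; rewrite !gt_eqF.
  lra.
have up : \sum_i corr act f (g * w i)%g <= (hits g (level a1))%:R * D + M%:R * (a1%:R^-1 * D).
  have -> : (hits g (level a1))%:R * D + M%:R * (a1%:R^-1 * D) =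
      \sum_i (((g * w i)%g \in level a1)%:R * D + a1%:R^-1 * D).
    rewrite big_split /= -mulr_suml sumr_const -[X in _ = _ + X]mulr_natl -natr_sum; congr (_%:R * _ + _).
    by rewrite /hits -sum1_card big_mkcond; apply: eq_bigr => i _; rewrite inE; case: (_ \in _).
  apply: ler_sum => i _; case: (boolP (_ \in level a1)) => [_|].
    by rewrite mul1r; apply: le_trans (corr_le actM act1 _ _) _; rewrite lerDl mulr_ge0 ?invr_ge0 ?ler0n ?(ltW D_gt0).
  by rewrite inE -ltNge mul0r add0r ler_pdivlMl // => /ltW.
rewrite -(ler_nat R) natrM -(ler_pM2r D_gt0).
have e1 : (2 * N * a)%:R^-1 = 2 * a1%:R^-1 :> R.
  by rewrite /a1 !natrM; field; rewrite !gt_eqF.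
have h := le_trans low up; rewrite e1 in h.
have : M%:R * (a1%:R^-1 * D) <= (hits g (level a1))%:R * D by lra.
rewrite mulrCA ler_pdivrMl // => h'; apply: le_trans h' _.
by rewrite mulrA.
Qed.

Hypothesis stop : (#|level (32 * N ^ 2 * a ^ 2)| <= q * #|level a|)%N.

Let Z := level (2 * a1 ^ 2).
Let Z_le : (#|Z| <= q * #|level a|)%N.
Proof. by apply: leq_trans stop; rewrite /Z /a1 !expnMn; apply: eq_leq; congr #|level _|; lia. Qed.

Let back y (X : {set G}) := #|[set i | (y * (w i)^-1)%g \in X]|.

Let double_count (X X' : {set G}) : (\sum_(g in X) hits g X' = \sum_(y in X') back y X)%N.
Proof.
rewrite !sum_card_dep; have inj : injective (fun z : G * J => ((z.1 * w z.2)%g, z.2)).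
  by move=> [g i] [g' i'] [/= e ei]; move: e; rewrite ei => /mulIg ->.
rewrite -(card_imset _ inj); apply: eq_card => -[y i]; rewrite inE /= inE; apply/imsetP/andP.
  by move=> [[g j]]; rewrite !inE /= => /andP[h1 h2] [-> ->]; rewrite mulgK.
by move=> [h1 h2]; exists ((y * (w i)^-1)%g, i); rewrite ?inE /= ?mulgKV ?h2.
Qed.

(* Unlike the whole level set, every subset of Y still meets many translates of the
   words w i; this lets the structure found in Y be transferred to the w i. *)
Let Y := [set y in level a1 | (M <= 2 * a1 * q * back y (level a))%N].

Let X0_le_Y : (#|level a| <= 2 * a1 * #|Y|)%N.
Proof.
have h1 : (#|level a| * M <= a1 * \sum_(y in level a1) back y (level a))%N.
  by rewrite -double_count big_distrr -sum_nat_const; apply: leq_sum => g; apply: level_hits.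
have h2 : (2 * a1 * q * \sum_(y in level a1 :\: Y) back y (level a) <= q * (#|level a| * M))%N.
  apply: (@leq_trans (#|level a1| * M)%N).
    rewrite big_distrr -sum_nat_const [X in (_ <= X)%N](big_setID Y) /= (setIidPr _).
      apply: leq_trans (leq_addl _ _); apply: leq_sum => y; rewrite !inE => /andP[+ h].
      by rewrite h /= -ltnNge => /ltnW.
    by apply/subsetP => y; rewrite inE => /andP[].
  rewrite mulnA leq_mul2r; apply/orP; right; apply: leq_trans Z_le.
  by apply: subset_leq_card; apply: level_sub; rewrite -mulnn; move: a1_gt0; clear; nia.
have h3 : (\sum_(y in Y) back y (level a) <= #|Y| * M)%N.
  by rewrite -sum_nat_const; apply: leq_sum => y _; apply: max_card.
have Ysub : Y \subset level a1 by apply/subsetP => y; rewrite inE => /andP[].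
move: h1; rewrite (big_setID Y) /= (setIidPr Ysub); move: h2 h3 q_gt0 M_gt0.
move: (\sum_(y in Y) _)%N (\sum_(y in _ :\: _) _)%N #|level a| #|Y| M => s1 s2 l y n.
generalize a1 => b; clear => h2 h3 q0 n0 h1; rewrite -(leq_pmul2r n0).
have {}h2 : (2 * (b * s2) <= l * n)%N.
  by rewrite -(leq_pmul2l q0); apply: leq_trans h2; apply: eq_leq; lia.
have h4 : (b * s1 <= b * (y * n))%N by rewrite leq_mul2l h3 orbT.
by rewrite mulnDr in h1; lia.
Qed.

Let Y_gt0 : (0 < #|Y|)%N.
Proof.
have : (0 < #|level a|)%N by apply/card_gt0P; exists 1%g; apply: level1.
by move/leq_trans/(_ X0_le_Y); rewrite muln_gt0 => /andP[].
Qed.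

Let Zsmall : (#|Z| <= q ^ 2 * #|Y|)%N.
Proof.
apply: leq_trans Z_le _; rewrite -mulnn -mulnA leq_mul2l; apply/orP; right.
apply: leq_trans X0_le_Y _; rewrite leq_mul2r; apply/orP; right.
by apply: leq_trans a1q; rewrite -mulnn leq_mul2l leq_pmulr ?orbT.
Qed.

(** On Y the correlations sum to at least |Y| D / a1, so by [corr_pos_def] those of the quotients
    sum to at least |Y|^2 D / a1^2. Quotients outside Z supply at most half of this. *)
Let dense : (#|Y| ^ 2 <= q ^ 2 * \sum_(x in Y) #|[set y in Y | (x * y^-1)%g \in Z]|)%N.
Proof.
apply: (@leq_trans (2 * a1 ^ 2 * \sum_(x in Y) #|[set y in Y | (x * y^-1)%g \in Z]|)%N); last first.
  by rewrite leq_mul2r (leq_trans a1q) ?orbT // -mulnn leq_pmulr.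
have a10 : 0 < a1%:R :> R by rewrite ltr0n.
have := corr_pos_def actM act1 Y D_gt0; rewrite -/D => pd.
have low : #|Y|%:R * (a1%:R^-1 * D) <= \sum_(y in Y) corr act f y.
  rewrite mulr_natl -sumr_const; apply: ler_sum => y; rewrite !inE => /andP[h _].
  by rewrite ler_pdivrMl.
set e := (\sum_(x in Y) _)%N.
have up : \sum_(y in Y) \sum_(z in Y) corr act f (y * z^-1)%g <=
    e%:R * D + #|Y|%:R ^+ 2 * ((2 * a1 ^ 2)%:R^-1 * D).
  have -> : e%:R * D + #|Y|%:R ^+ 2 * ((2 * a1 ^ 2)%:R^-1 * D) =
     \sum_(y in Y) \sum_(z in Y) (((y * z^-1)%g \in Z)%:R * D + (2 * a1 ^ 2)%:R^-1 * D).
    rewrite (eq_bigr (fun y => #|[set z in Y | (y * z^-1)%g \in Z]|%:R * D + #|Y|%:R * ((2 * a1 ^ 2)%:R^-1 * D))).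
      by rewrite big_split /= -mulr_suml sumr_const -[X in _ = _ + X]mulr_natl -natr_sum [X in _ = _ + X]mulrA -expr2.
    move=> y _; rewrite big_split /= -mulr_suml sumr_const -[X in _ + X = _]mulr_natl -natr_sum.
    congr (_%:R * _ + _); rewrite -sum1_card big_mkcond [RHS]big_mkcond; apply: eq_bigr => z _.
    by rewrite inE; case: (z \in Y); case: (_ \in Z).
  apply: ler_sum => y _; apply: ler_sum => z _; case: (boolP (_ \in Z)) => [_|].
    by rewrite mul1r; apply: le_trans (corr_le actM act1 _ _) _; rewrite lerDl mulr_ge0 ?invr_ge0 ?ler0n ?(ltW D_gt0).
  rewrite inE -ltNge mul0r add0r ler_pdivlMl; first by move/ltW.
  by rewrite ltr0n muln_gt0 expn_gt0 a1_gt0.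
have c0 : 0 <= #|Y|%:R * (a1%:R^-1 * D) by rewrite !mulr_ge0 ?invr_ge0 ?ler0n ?(ltW D_gt0).
have h : (#|Y|%:R * (a1%:R^-1 * D)) ^+ 2 <= D * (e%:R * D + #|Y|%:R ^+ 2 * ((2 * a1 ^ 2)%:R^-1 * D)).
  apply: (@le_trans _ _ ((\sum_(y in Y) corr act f y) ^+ 2)).
    by rewrite ler_pXn2r ?nnegrE // (le_trans c0).
  by apply: le_trans pd _; rewrite ler_pM2l.
have Eb : (2 * a1 ^ 2)%:R = 2 * a1%:R ^+ 2 :> R by rewrite (natrM _ 2 (a1 ^ 2)) natrX.
rewrite -(ler_nat R) natrX (natrM _ (2 * a1 ^ 2)) Eb; move: h; rewrite Eb.
move: (a1%:R : R) a10 (#|Y|%:R : R) (e%:R : R) => b b0 y x h.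
have D2 : 0 < D ^+ 2 / b ^+ 2 by rewrite divr_gt0 ?exprn_gt0.
rewrite -(ler_pM2r D2).
have e2 : (y * (b^-1 * D)) ^+ 2 = y ^+ 2 * (D ^+ 2 / b ^+ 2) by field; rewrite gt_eqF.
have e3 : D * (x * D + y ^+ 2 * ((2 * b ^+ 2)^-1 * D)) =
   (2 * b ^+ 2 * x * (D ^+ 2 / b ^+ 2) + y ^+ 2 * (D ^+ 2 / b ^+ 2)) / 2.
  by field; rewrite gt_eqF.
by rewrite e2 e3 in h; lra.
Qed.

(** [bsg] with constant q^2 gives X in Y with |[quotset X]| at most 2^14 q^20 |X|, and q absorbs
    2^14. By the choice of Y some g carries many words g w_i into X, hence many into one of the few
    translates t S S covering X; quotients of two such words lie in S^4. *)
Theorem flattening : exists (S : {set G}) (C : {set J}),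
  [/\ 1%g \in S, (forall x, x \in S -> (x^-1)%g \in S),
      (forall n, (#|(S ^+ n)%g| <= (2 * q ^ 42) ^ n * (2 * q ^ 21 * #|S|))%N),
      (#|S| <= 2 * q ^ 42 * #|level q|)%N &
      (M <= q ^ 69 * #|C|)%N /\
      (forall i j, i \in C -> j \in C -> ((w i)^-1 * w j)%g \in (S ^+ 4)%g)].
Proof.
have Zs x : (x^-1%g \in Z) = (x \in Z) := levelV _ x.
have [X [XY YX qX]] := bsg Zs Y_gt0 Zsmall dense.
have X_gt0 : (0 < #|X|)%N by move: YX Y_gt0; case: #|X| => //; rewrite muln0; case: #|Y|.
have qX' : (#|quotset X| <= q ^ 21 * #|X|)%N.
  apply: (leq_trans qX); apply: (@leq_trans (2 ^ 12 * (q ^ 2) ^ 9 * (4 * q ^ 2 * #|X|))%N).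
    by rewrite leq_mul2l YX orbT.
  rewrite -expnM; have -> : (q ^ 21 = q ^ (2 * 9) * q ^ 2 * q)%N by rewrite -!expnD -expnSr.
  apply: (@leq_trans (q ^ (2 * 9) * q ^ 2 * 2 ^ 14 * #|X|)%N); last first.
    by rewrite leq_mul2r leq_mul2l q_big !orbT.
  by apply: eq_leq; have -> : (2 ^ 14 = 2 ^ 12 * 4)%N by []; move: (2 ^ 12)%N (q ^ _)%N (q ^ 2)%N => ? ? ?; lia.
have [S [T [S1 SV _ [T_le XT] [X_le S_le]]]] := approximate_group X_gt0 qX'.
have e42 : ((q ^ 21) ^ 2 = q ^ 42)%N by rewrite -expnM.
rewrite e42 in S_le.
have [g gM] : exists g, (M <= q ^ 5 * hits g X)%N.
  apply: NNPP => H.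
  have h1 : (M * #|X| <= 2 * a1 * q * \sum_(g in level a) hits g X)%N.
    rewrite double_count mulnC big_distrr -sum_nat_const; apply: leq_sum => y /(subsetP XY).
    by rewrite inE => /andP[].
  have h2 : (q ^ 5 * \sum_(g in level a) hits g X < #|level a| * M)%N.
    rewrite big_distrr /= -sum_nat_const; apply: (@leq_trans (\sum_(g in level a) (q ^ 5 * hits g X).+1)%N).
      under [X in (_ <= X)%N]eq_bigr do rewrite -addn1.
      rewrite big_split /= sum_nat_const muln1 -addn1 leq_add2l.
      by apply/card_gt0P; exists 1%g; apply: level1.
    by apply: leq_sum => g _; rewrite ltnNge; apply/negP => h; apply: H; exists g.
  have h3 : (#|level a| <= 2 * a1 * (4 * q ^ 2 * #|X|))%N.
    by apply: leq_trans X0_le_Y _; rewrite leq_mul2l YX orbT.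
  have h4 : (2 * a1 * q * (#|level a| * M) <= q ^ 5 * (M * #|X|))%N.
    apply: (@leq_trans (2 * a1 * q * (2 * a1 * (4 * q ^ 2 * #|X|) * M))%N).
      by rewrite leq_mul2l leq_mul2r h3 !orbT.
    have -> : (2 * a1 * q * (2 * a1 * (4 * q ^ 2 * #|X|) * M) = 8 * (2 * (a1 * a1)) * (q * q ^ 2) * (M * #|X|))%N.
      by move: (q ^ 2)%N M #|X|; clear; lia.
    rewrite leq_mul2r; apply/orP; right; rewrite -expnS (expnD q 2 3) leq_mul2r; apply/orP; right.
    rewrite -[(q ^ 2)%N]mulnn; apply: leq_mul; last by rewrite mulnn.
    by apply: leq_trans q_big.
  have b0 : (0 < 2 * a1 * q)%N by rewrite (muln_gt0 _ q) q_gt0 andbT (muln_gt0 2 a1) a1_gt0.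
  have := leq_ltn_trans (leq_mul (leqnn (q ^ 5)%N) h1) _.
  move=> /(_ (2 * a1 * q * (#|level a| * M))%N); rewrite mulnCA ltn_pmul2l // => /(_ h2).
  by rewrite ltnNge h4.
pose Ct t := [set i | (g * w i)%g \in [set (t * s)%g | s in (S * S)%g]].
have cov : [set i | (g * w i)%g \in X] \subset \bigcup_(t in T) Ct t.
  apply/subsetP => i; rewrite inE => /(subsetP XT) /mulsgP[t u tT uS e].
  by apply/bigcupP; exists t => //; rewrite inE e; apply: imset_f.
have [t tT tM] : exists2 t, t \in T & (hits g X <= #|T| * #|Ct t|)%N.
  apply: NNPP => H.
  have h : (\sum_(t in T) (#|T| * #|Ct t|) <= \sum_(t in T) (hits g X).-1)%N.
    apply: leq_sum => t tT; have [h|h] := leqP (hits g X) (#|T| * #|Ct t|).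
      by case: H; exists t.
    by rewrite -ltnS (leq_trans h) // leqSpred.
  rewrite -big_distrr sum_nat_const /= in h.
  have hX : (0 < hits g X)%N by move: gM M_gt0; case: (hits g X) => //; rewrite muln0; case: M.
  have T0 : (0 < #|T|)%N.
    rewrite lt0n cards_eq0; apply: contraTneq hX => T0.
    by move: cov; rewrite T0 big_set0 subset0 => /eqP h0; rewrite /hits h0 cards0.
  rewrite leq_pmul2l // in h.
  have h' : (hits g X <= \sum_(t in T) #|Ct t|)%N.
    rewrite sum_card_dep; apply: leq_trans (leq_imset_card (fun z => z.2) _).
    apply: subset_leq_card; apply/subsetP => i /(subsetP cov)/bigcupP[t tT iC].
    by apply/imsetP; exists (t, i); rewrite // inE tT.
  by have := leq_trans h' h; rewrite leqNgt prednK // leqnn.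
exists S, (Ct t); split=> //.
- move=> n; apply: leq_trans (S_le n) _; rewrite leq_mul2l X_le orbT //.
- have := S_le 1; rewrite expg1 expn1 => /leq_trans; apply; rewrite leq_mul2l; apply/orP; right.
  have a1_q : (a1 <= q)%N.
    by apply: leq_trans a1q; rewrite -mulnn; move: a1_gt0; generalize a1; clear; nia.
  apply: subset_leq_card; apply/subsetP => y /(subsetP XY); rewrite inE => /andP[h _].
  exact: (subsetP (level_sub a1_q)) h.
split.
  apply: (leq_trans gM); apply: (@leq_trans (q ^ 5 * (4 * (q ^ 21) ^ 3 * #|Ct t|))%N).
    by rewrite leq_mul2l (leq_trans tM) ?orbT // leq_mul2r T_le orbT.
  have -> : (q ^ 69 = q ^ 5 * (q * q ^ (21 * 3)))%N by rewrite -expnS -expnD.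
  rewrite -expnM -[X in (_ <= X)%N]mulnA; apply: leq_mul => //; apply: leq_mul => //.
  by apply: leq_mul => //; apply: leq_trans q_big.
move=> i j; rewrite !inE => /imsetP[s /mulsgP[s1 s2 s1S s2S ->] ei] /imsetP[s' /mulsgP[s3 s4 s3S s4S ->] ej].
have -> : ((w i)^-1 * w j = s2^-1 * (s1^-1 * (s3 * s4)))%g.
  have -> : (w i = g^-1 * (t * (s1 * s2)))%g by rewrite -ei mulKg.
  have -> : (w j = g^-1 * (t * (s3 * s4)))%g by rewrite -ej mulKg.
  by rewrite !invMg invgK !mulgA mulgK mulgKV.
by rewrite !expgS expg0 mulg1 !mem_mulg ?SV.
Qed.

End Flattening.

(** The thresholds among which [growth_stops] finds one where the level set grows by at most the
    factor q. *)
Fixpoint level_seq (N j : nat) : nat :=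
  if j is j'.+1 then (32 * N ^ 2 * level_seq N j' ^ 2)%N else 1%N.

Lemma pigeonhole_fiber (X Y : finType) (C : {set X * Y}) : (0 < #|X|)%N ->
  exists x, (#|C| <= #|X| * #|[set y | (x, y) \in C]|)%N.
Proof.
move=> X0; apply: NNPP => H.
have E : (#|C| = \sum_(x in [set: X]) #|[set y | (x, y) \in C]|)%N.
  by rewrite sum_card_dep; apply: eq_card => -[x y]; rewrite !inE.
have : (\sum_(x in [set: X]) (#|X| * #|[set y | (x, y) \in C]|).+1 <= \sum_(x in [set: X]) #|C|)%N.
  by apply: leq_sum => x _; rewrite ltnNge; apply/negP => h; apply: H; exists x.
under eq_bigr do rewrite -addn1.
rewrite big_split /= -big_distrr /= -E !sum_nat_const cardsT muln1.
by move: #|X| #|C| X0; clear; lia.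
Qed.

(** * The spectral gap for the moves *)

Section Gap.

Variables (R : realType) (F : finFieldType) (r : nat).
Hypotheses (rud : incidence_bound F r) (r_gt0 : (0 < r)%N).
Variables (B : {set F}) (la : F).
Hypothesis la0 : la != 0.

Let sB := {x : F | x \in B}.
Let n := #|B|.
Let card_sB : #|{: sB}| = n. Proof. by rewrite card_sig; apply: eq_card. Qed.

(* In the coordinates s_i = a_i + b_i, this moves s_2 to s_1 exactly when
   1/a_1 - 1/a_2 = la. *)
Definition move_of (b : sB * sB) : sl2 F := (lower (- val b.2) * upper la * lower (val b.1))%g.

Lemma card_sl2 : (#|{: sl2 F}| <= #|F| ^ 4)%N.
Proof.
rewrite -(card_imset _ val_inj) (leq_trans (max_card _)) // !card_prod.
by rewrite !mulnn -expnM.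
Qed.

(** Chebyshev's inequality for the square sum of the correlations. The exponent 2 of |F| is what
    contradicts growth up to exponent 3. *)
Lemma card_level (f : F * F -> R) (q : nat) : balanced f -> 0 < ip f f -> (0 < q)%N ->
  (#|level (@vact F) f q| <= 2 * #|F| ^ 2 * q ^ 2)%N.
Proof.
move=> fb f0 q0; have q0' : 0 < q%:R :> R by rewrite ltr0n.
have := sum_corr2 fb; set D := ip f f in f0 *.
have low : #|level (@vact F) f q|%:R * (q%:R^-1 * D) ^+ 2 <= \sum_g corr (@vact F) f g ^+ 2.
  rewrite mulr_natl -sumr_const big_mkcond; apply: ler_sum => g _.
  case: ifP => [|_]; last exact: sqr_ge0.
  rewrite inE => h; rewrite ler_sqr ?nnegrE ?mulr_ge0 ?invr_ge0 ?ler0n ?(ltW f0) //.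
    by rewrite ler_pdivrMl.
  by apply: (@level_ge0 R _ _ (@vact F) f f0 q); rewrite inE.
move=> /(le_trans low) h; rewrite -(ler_nat R) (natrM _ (2 * #|F| ^ 2)) (natrM _ 2 (#|F| ^ 2)) !natrX.
have D2 : 0 < (q%:R^-1 * D) ^+ 2 by rewrite exprn_gt0 // mulr_gt0 ?invr_gt0.
rewrite -(ler_pM2r D2); apply: (le_trans h).
by rewrite le_eqVlt; apply/orP; left; apply/eqP; field; rewrite gt_eqF.
Qed.

Let word (b b' : sB * sB) := ((move_of b)^-1 * move_of b')%g.

(** A word has four parameters in B. Changing this one multiplies the word by a lower unipotent,
    while changing the one in [word_mid] multiplies it by a conjugate of one. *)
Lemma word_last b1 b2 b2' x y :
  ((word (b1, b2) (x, b2'))^-1 * word (b1, b2) (y, b2') = lower (val y - val x))%g.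
Proof.
by rewrite /word /move_of /= !invMg !invgK !mulgA !mulgK !mulgKV addrC lowerD lowerN.
Qed.

Lemma word_mid b1 b1' b2' x y : let Q := move_of (b1', b2') in
  ((word (b1, x) (b1', b2'))^-1 * word (b1, y) (b1', b2') = Q^-1 * lower (val y - val x) * Q)%g.
Proof.
rewrite /word; set Q := move_of (b1', b2'); rewrite /= addrC lowerD !lowerN.
by rewrite /move_of /= !lowerN !invMg !invgK !mulgA !mulgK.
Qed.

Lemma det2_conj_lower (Q : sl2 F) x x' :
  det2 (row1 (Q^-1 * lower x * Q)%g) (row1 (Q^-1 * lower x' * Q)%g) = (row1 Q).2 ^+ 2 * (x - x').
Proof. by rewrite !row1M det2_vact !vact_lower row1V /det2 /=; ring. Qed.

Lemma row1_move_of b : (row1 (move_of b)).2 = la.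
Proof.
rewrite /move_of !row1M vact_lower /vact /row1 /row2 /=.
by rewrite !(mul1r, mul0r, addr0).
Qed.

(** H = S^4 contains the quotients of the words in C, and H^10 = S^40 explains the exponent in
    [Lam]. C holds a proportion q^-69 of the n^4 words, so fixing three parameters leaves more than
    W values of the fourth; this yields unipotents for one parameter and directions for another.
    Then [sl2_growth] and [card_level] contradict each other. *)
Lemma sl2_gap (N q m Lam s W : nat) :
  (0 < N)%N -> (2 ^ 14 <= q)%N -> (level_seq N m <= q)%N -> (#|F| ^ 4 < q ^ m)%N ->
  ((2 * q ^ 42) ^ 40 * (2 * q ^ 21) <= Lam)%N -> (128 * r * Lam < s)%N ->
  (1024 * r * Lam * s ^ 2 < W)%N -> (q ^ 69 * W < n)%N ->
  (8 * s ^ 3 * Lam ^ 2 * q ^ 44 < #|F|)%N ->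
  forall f, balanced f ->
  ip (avg (@vact F) move_of f) (avg (@vact F) move_of f) <= N%:R^-1 * ip f f :> R.
Proof.
move=> N0 q14 levq qm HLam Hs HW Hn HF f0 bf0; rewrite leNgt; apply/negP => Hf0.
have n_gt0 : (0 < n)%N by apply: leq_ltn_trans Hn.
have q_gt0 : (0 < q)%N by apply: leq_trans q14.
have I_gt0 : (0 < #|{: sB * sB}|)%N by rewrite card_prod card_sB muln_gt0 n_gt0.
have ka0 : 0 < N%:R^-1 :> R by rewrite invr_gt0 ltr0n.
have tau0 : 0 < (2 * N * q)%:R^-1 :> R by rewrite invr_gt0 ltr0n !muln_gt0 N0 q_gt0.
have [f [bf D0 Hf]] := extremal (@vactM F) (@vact1 F) (@balanced_comb R F) (@balanced_act R F)
   I_gt0 ka0 tau0 bf0 Hf0.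
pose w (i : (sB * sB) * (sB * sB)) := word i.1 i.2.
have M_gt0 : (0 < #|{: (sB * sB) * (sB * sB)}|)%N by rewrite card_prod muln_gt0 I_gt0.
have harm g : 0 <= corr (@vact F) f g ->
   N%:R^-1 * corr (@vact F) f g - (2 * N * q)%:R^-1 * ip f f <=
   #|{: (sB * sB) * (sB * sB)}|%:R^-1 * \sum_i corr (@vact F) f (g * w i)%g.
  by move=> /Hf; rewrite [#|{: (sB * sB) * _}|]card_prod (natrM _ #|{: sB * sB}|) -expr2.
have lev_gt0 j : (0 < level_seq N j)%N.
  by elim: j => //= j IH; rewrite (muln_gt0 (32 * N ^ 2)) (muln_gt0 32) !expn_gt0 N0 IH.
have lev_mono j : (level_seq N j <= level_seq N j.+1)%N.
  rewrite /= -[(level_seq N j ^ 2)%N]mulnn mulnA leq_pmull //.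
  by rewrite muln_gt0 lev_gt0 (muln_gt0 32) expn_gt0 N0.
have [j jm Hj] := growth_stops (u := fun j => #|level (@vact F) f (level_seq N j)|)
   (q := q) (m := m) (N := (#|F| ^ 4)%N)
   (introT card_gt0P (ex_intro _ 1%g (level1 (@vact1 F) D0 (lev_gt0 0%N))))
   (leq_trans (max_card _) card_sl2) qm.
have a_le : (32 * N ^ 2 * level_seq N j ^ 2 <= q)%N.
  apply: leq_trans levq; rewrite -[X in (X <= _)%N]/(level_seq N j.+1).
  by apply: (homo_leq (f := level_seq N) (r := leq)) => //; apply: leq_trans.
have [S [C [S1 SV Sgrow Slev [CM CS]]]] :=
  flattening (@vactM F) (@vact1 F) D0 M_gt0 N0 q14 harm (lev_gt0 j) a_le Hj.
pose H : {set sl2 F} := (S ^+ 4)%g.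
have S1n k : 1%g \in (S ^+ k)%g.
  by elim: k => [|k IH]; rewrite ?expg0 ?inE // expgS -[1%g]mulg1 mem_mulg.
have HV g : g \in H -> (g^-1)%g \in H.
  rewrite /H !expgS expg0 mulg1 => /mulsgP[s1 x s1S /mulsgP[s2 y s2S /mulsgP[s3 s4 s3S s4S ->] ->] ->].
  by rewrite !invMg -!mulgA !mem_mulg ?SV.
have q1 : (1 <= 2 * q ^ 42)%N by rewrite muln_gt0 expn_gt0 q_gt0.
have Spow k : (k <= 40)%N -> (#|(S ^+ k)%g| <= Lam * #|S|)%N.
  move=> k40; apply: leq_trans (Sgrow k) _; rewrite mulnA leq_mul2r; apply/orP; right.
  by apply: leq_trans HLam; rewrite leq_mul2r leq_pexp2l ?orbT.
have SH : (#|S| <= #|H|)%N.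
  apply: subset_leq_card; apply/subsetP => x xS; rewrite /H expgS -[x]mulg1 mem_mulg //.
have grow k : (k <= 10)%N -> (#|(H ^+ k)%g| <= Lam * #|H|)%N.
  move=> k10; rewrite -(expgM S 4 k); apply: leq_trans (Spow (4 * k)%N (leq_mul (leqnn 4) k10)) _.
  by rewrite leq_mul2l SH orbT.
have cM : #|{: (sB * sB) * (sB * sB)}| = (n ^ 3 * n)%N.
  by rewrite !card_prod card_sB !expnS expn0 muln1; clear; lia.
have c3 : #|{: (sB * sB) * sB}| = (n ^ 3)%N by rewrite !card_prod card_sB !expnS expn0 muln1 mulnA.
have n3 : (0 < n ^ 3)%N by rewrite expn_gt0 n_gt0.
have fiber (h : (sB * sB) * (sB * sB) -> ((sB * sB) * sB) * sB) : injective h ->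
  exists x, (W < #|[set y | (x, y) \in h @: C]|)%N.
  move=> h_inj; have [|x] := pigeonhole_fiber (h @: C); first by rewrite c3.
  rewrite c3 card_imset // => hx; exists x.
  have q69 : (0 < q ^ 69)%N by rewrite expn_gt0 q_gt0.
  rewrite -(ltn_pmul2l q69); apply: (leq_trans Hn); rewrite -(leq_pmul2l n3).
  by rewrite -cM mulnCA; apply: leq_trans CM _; rewrite leq_mul2l hx orbT.
have V_W : (W <= #|lower_part (H ^+ 2)%g|)%N.
  have [|[[b1 b2] b2'] Hx] := @fiber (fun z => ((z.1, z.2.2), z.2.1)).
    by move=> [[? ?] [? ?]] [[? ?] [? ?]] [-> -> -> ->].
  apply: leq_trans (ltnW Hx) _; have /card_gt0P[y0 y0Y] := leq_ltn_trans (leq0n _) Hx.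
  set Y := [set y | _] in y0Y *.
  have YC y : y \in Y -> ((b1, b2), (y, b2')) \in C.
    by rewrite inE => /imsetP[[[? ?] [? ?]] zC [-> -> -> ->]].
  have inj : injective (fun y : sB => val y - val y0) by move=> y y' /addIr/val_inj.
  rewrite -(card_imset Y inj); apply: subset_leq_card; apply/subsetP => x /imsetP[y yY ->].
  rewrite inE -(word_last b1 b2 b2' y0 y) expgS -[X in X \in _]mulg1 mem_mulg ?expg1 //; last exact: S1n.
  exact: (CS _ _ (YC _ y0Y) (YC _ yY)).
have Dir_W : (W <= #|directions H|)%N.
  have [|[[b1 b1'] b2'] Hx] := @fiber (fun z => (((z.1.1, z.2.1), z.2.2), z.1.2)).
    by move=> [[? ?] [? ?]] [[? ?] [? ?]] [-> -> -> ->].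
  have /card_gt0P[y0 y0Y] := leq_ltn_trans (leq0n _) Hx.
  set Y := [set y | _] in Hx y0Y *.
  have YC y : y \in Y -> ((b1, y), (b1', b2')) \in C.
    by rewrite inE => /imsetP[[[? ?] [? ?]] zC [-> -> -> ->]].
  pose Q := move_of (b1', b2').
  pose v (y : sB) := row1 (Q^-1 * lower (val y - val y0) * Q)%g.
  have vH y : y \in Y -> v y \in (@row1 F) @: H.
    move=> yY; apply: imset_f; rewrite -(word_mid b1).
    exact: (CS _ _ (YC _ y0Y) (YC _ yY)).
  have vdet y y' : det2 (v y) (v y') = la ^+ 2 * (val y - val y').
    by rewrite /v det2_conj_lower row1_move_of; congr (_ * _); ring.
  have vinj y y' : det2 (v y) (v y') = 0 -> y = y'.
    rewrite vdet => /eqP; rewrite mulf_eq0 expf_eq0 (negPf la0) subr_eq0 => /eqP.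
    exact: val_inj.
  clearbody v.
  pose Y' := [set y in Y | (v y).1 != 0].
  (* The rows are pairwise non-parallel, so at most one of them has first coordinate zero. *)
  have Y'_W : (W <= #|Y'|)%N.
    have : (#|Y :\: Y'| <= 1)%N.
      apply/card_le1_eqP => y y'; rewrite !inE => /andP[h1 h2] /andP[h1' h2'].
      move: h1 h1'; rewrite h2 h2' /= !negbK => /eqP e /eqP e'.
      by apply: vinj; rewrite /det2 e e' mul0r mulr0 subr0.
    have := cardsID Y' Y; rewrite (setIidPr _); last by apply/subsetP => y; rewrite inE => /andP[].
    by move: Hx; clear; lia.
  have inj : {in Y' &, injective (fun y => (v y).2 / (v y).1)}.
    move=> y y'; rewrite !inE => /andP[_ h1] /andP[_ h2] e; apply: vinj.
    have -> : det2 (v y) (v y') = (v y).1 * (v y').1 * ((v y').2 / (v y').1 - (v y).2 / (v y).1).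
      by rewrite /det2; field; rewrite h1 h2.
    by rewrite e subrr mulr0.
  apply: leq_trans Y'_W _; rewrite -(card_in_imset inj); apply: subset_leq_card.
  apply/subsetP => z /imsetP[y]; rewrite inE => /andP[yY y1] ->.
  by apply/imsetP; exists (v y) => //; rewrite inE vH.
have := sl2_growth rud r_gt0 (S1n 4) HV grow V_W Dir_W Hs HW.
have HS : (#|H| <= Lam * #|S|)%N by apply: Spow.
have Sle : (#|S| <= 2 * q ^ 42 * (2 * #|F| ^ 2 * q ^ 2))%N.
  by apply: leq_trans Slev _; rewrite leq_mul2l card_level ?orbT.
have F0 : (0 < #|F| ^ 2)%N by rewrite expn_gt0; apply/orP; left; apply/card_gt0P; exists 0.
apply/negP; rewrite -ltnNge.
apply: (@leq_ltn_trans (2 * s ^ 3 * Lam * (Lam * (2 * q ^ 42 * (2 * #|F| ^ 2 * q ^ 2))))%N).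
  by rewrite leq_mul2l (leq_trans HS) ?orbT // leq_mul2l Sle orbT.
rewrite (expnS #|F| 2) -(ltn_pmul2r F0) in HF *.
apply: leq_ltn_trans HF; apply: eq_leq.
rewrite -[(Lam ^ 2)%N]mulnn (expnD q 42 2); move: (q ^ 42)%N (q ^ 2)%N (#|F| ^ 2)%N (s ^ 3)%N.
by clear; lia.
Qed.

End Gap.

(** [Lam], [s] and [W] are chosen in turn and bounded by powers of q, the numerical constants being
    absorbed once q >= Q0; c exceeds both resulting exponents, 3L + 72 and 5L + 48. *)
Lemma gap_parameters (r : nat) : exists Q0 c : nat, (0 < c)%N /\
  forall q, (Q0 <= q)%N -> (2 ^ 14 <= q)%N /\ exists Lam s W,
  [/\ ((2 * q ^ 42) ^ 40 * (2 * q ^ 21) <= Lam)%N, (128 * r * Lam < s)%N,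
      (1024 * r * Lam * s ^ 2 < W)%N &
      forall n, (q ^ c <= n)%N -> (q ^ 69 * W < n)%N /\ (8 * s ^ 3 * Lam ^ 2 * q ^ 44 < n)%N].
Proof.
have [L HL] : exists L, forall q, (2 <= q)%N -> ((2 * q ^ 42) ^ 40 * (2 * q ^ 21) <= q ^ L)%N.
  exists (43 * 40 + 22)%N => q q2; rewrite expnD expnM (expnS q 42) (expnS q 21).
  by apply: leq_mul; rewrite ?leq_exp2r // leq_mul2r q2 orbT.
exists (2 ^ 14 + (1024 * r + 1))%N, (5 * L + 200)%N; split; first by rewrite addn_gt0 orbT.
move=> q Hq; split; first exact: leq_trans (leq_addr _ _) Hq.
have q8 : (2 ^ 3 <= q)%N.
  by apply: leq_trans (leq_trans (leq_addr _ _) Hq); rewrite leq_exp2l.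
have q2 : (2 <= q)%N by apply: leq_trans q8.
have q0 : (0 < q)%N by apply: leq_trans q2.
have rq : (1024 * r + 1 <= q)%N by apply: leq_trans (leq_addl _ _) Hq.
have L0 : (0 < q ^ L)%N by rewrite expn_gt0 q0.
pose s := (128 * r * q ^ L + 1)%N; pose W := (1024 * r * q ^ L * s ^ 2 + 1)%N.
exists (q ^ L)%N, s, W.
have aux x y : (0 < y)%N -> (x + 1 <= q)%N -> (x * y + 1 <= q * y)%N.
  by move=> y0 xq; apply: (@leq_trans ((x + 1) * y)%N); [rewrite mulnDl mul1n leq_add2l|rewrite leq_mul2r xq orbT].
have s_le : (s <= q ^ L.+1)%N.
  rewrite expnS; apply: aux => //.
  by apply: leq_trans rq; rewrite leq_add2r leq_mul2r orbT.
have s0 : (0 < s)%N by rewrite /s addn1.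
have W_le : (W <= q ^ (1 + L + (L.+1 * 2)))%N.
  rewrite !expnD expnM expn1 /W -[X in (X + _ <= _)%N](mulnA (1024 * r)) -mulnA.
  apply: leq_trans (aux _ _ _ rq) _; first by rewrite muln_gt0 L0 expn_gt0 s0.
  by rewrite leq_mul2l leq_mul2l leq_exp2r // s_le !orbT.
split; [exact: HL|by rewrite /s addn1|by rewrite /W addn1|].
move=> n Hn; split; apply: leq_trans Hn.
  apply: (@leq_ltn_trans (q ^ (69 + (1 + L + L.+1 * 2)))%N); first by rewrite expnD leq_mul2l W_le orbT.
  by rewrite ltn_exp2l //; clear; lia.
apply: (@leq_ltn_trans (q ^ (1 + L.+1 * 3 + L * 2 + 44))%N); last by rewrite ltn_exp2l //; clear; lia.
rewrite !expnD !expnM expn1 leq_mul2r; apply/orP; right.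
by rewrite leq_mul2r; apply/orP; right; rewrite leq_mul ?leq_exp2r.
Qed.

(** Carrying a factor N^3 along makes the induction close: 32 N^2 a^2 N^3 <= (a N^3)^2 for N >=
    32. *)
Lemma level_seq_le N j : (32 <= N)%N -> (level_seq N j <= N ^ (3 * 2 ^ j))%N.
Proof.
move=> N32; have N0 : (0 < N)%N by apply: leq_trans N32.
suff H : (level_seq N j * N ^ 3 <= N ^ (3 * 2 ^ j))%N.
  by apply: leq_trans H; rewrite leq_pmulr // expn_gt0 N0.
elim: j => [|j IH]; first by rewrite mul1n.
rewrite [(2 ^ _)%N]expnSr mulnA expnM /=; apply: (@leq_trans ((level_seq N j * N ^ 3) ^ 2)%N); last first.
  by rewrite leq_exp2r.
rewrite expnMn -expnM (expnS N 5) (expnD N 2 3); move: (level_seq N j ^ 2)%N => a.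
apply: (@leq_trans (N * N ^ 2 * a * N ^ 3)%N).
  by rewrite leq_mul2r leq_mul2r leq_mul2r N32 !orbT.
by apply: eq_leq; move: (N ^ 2)%N (N ^ 3)%N; clear; lia.
Qed.

Lemma incidence_bound_Fp p r : prime p -> (864 * 32 <= r)%N -> incidence_bound 'F_p r.
Proof.
move=> pp Hr P k Q h1 h2 h3; have := @rudnev p pp P r k Q h1 h2.
by rewrite card_Fp // in h3 => H; apply: H.
Qed.

Lemma card_inv_diff_pairs (p : nat) (A : {set 'F_p}) (la : 'F_p) :
  (#|inv_diff_pairs A la| <= #|A|)%N.
Proof.
have inj : {in inv_diff_pairs A la &, injective (fun a : 'F_p * 'F_p => a.2)}.
  move=> [a1 a2] [c1 c2]; rewrite !inE /= => /and5P[_ _ _ _ /eqP h1] /and5P[_ _ _ _ /eqP h2] e.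
  rewrite e in h1 *; congr pair; apply: invr_inj.
  by apply: (addIr (- c2^-1)); rewrite h1 h2.
rewrite -(card_in_imset inj); apply: subset_leq_card; apply/subsetP => s /imsetP[a + ->].
by rewrite inE => /and5P[].
Qed.

(** q is about p^de with de = eps / (2c), so that q^c <= p^eps <= |B|. Next, m > 4 / de makes q^m
    exceed p^4, a bound for the order of SL2; N is about the E-th root of q, E = 3 2^m, so that the
    first m thresholds stay below q; and k is large enough for y^2 <= p^eta, where y =
    p^(1/2^(k+2)). *)
Lemma inv_diff_pairs_bound (R : realType) (r : nat) (eps : R) : (864 * 32 <= r)%N -> 0 < eps ->
  exists k : nat, forall (p : nat) (A B : {set 'F_p}) (K : R),
    prime p -> p%:R `^ eps <= #|B|%:R -> 1 <= K -> #|sumset A B|%:R <= K * #|A|%:R ->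
    forall lambda : 'F_p, lambda != 0 ->
    #|inv_diff_pairs A lambda|%:R <= K ^+ 2 * #|A|%:R ^+ 2 / p%:R
            + 2 * K * #|A|%:R * p%:R `^ (- (1 / 2 ^+ (k + 2)%N)).
Proof.
move=> Hr eps0; have r0 : (0 < r)%N by apply: leq_trans Hr.
have [Q0 [c [c0 Hc]]] := gap_parameters r.
pose de := eps / (2 * c%:R).
have c0' : 0 < c%:R :> R by rewrite ltr0n.
have de0 : 0 < de by rewrite divr_gt0 ?mulr_gt0.
have [m Hm] : exists m : nat, 4 < de * m%:R.
  exists (Num.truncn (4 / de)).+1; rewrite mulrC -ltr_pdivrMr //.
  by have /andP[] := truncn_itv (ltW (divr_gt0 (ltr0n R 4) de0)).
pose E := (3 * 2 ^ m)%N; have E0 : (0 < E)%N by rewrite muln_gt0 expn_gt0.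
have E0' : 0 < E%:R :> R by rewrite ltr0n.
pose eta := de / E%:R; have eta0 : 0 < eta by rewrite divr_gt0.
pose l := (33 + Q0)%N.
have [k Hk] : exists k : nat, l%:R <= 2 ^+ (k + 2) * eta.
  exists (Num.truncn (l%:R / eta)); rewrite -ler_pdivrMr //.
  have /andP[_ h] := truncn_itv (ltW (divr_gt0 (ltr0n R l) eta0)).
  apply: (le_trans (ltW h)); rewrite -natrX ler_nat; apply: (leq_trans (ltn_expl _ (isT : (1 < 2)%N))).
  by rewrite leq_exp2l // leq_addr.
exists k => p A B K pp HB K1 HK la la0.
have p1 : 1 < p%:R :> R by rewrite ltr1n prime_gt1.
have p0 : 0 < p%:R :> R by apply: lt_trans p1.
have K0 : 0 <= K by apply: le_trans K1.
pose P2 : R := 2 ^+ (k + 2); have P20 : 0 < P2 by rewrite exprn_gt0.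
rewrite -/P2 in Hk *; set y := p%:R `^ (1 / P2).
have y0 : 0 < y by rewrite powR_gt0.
have y1 : 1 <= y by rewrite -[leLHS](powRr0 p%:R) ler_powR ?(ltW p1) // ltW // divr_gt0.
have yP z : p%:R `^ z = y `^ (P2 * z).
  by rewrite /y -powRrM mulrA div1r mulVf ?mul1r // gt_eqF.
pose u := p%:R `^ eta; have u0 : 0 < u by rewrite powR_gt0.
have uE : p%:R `^ de = u ^+ E.
  by rewrite -(powR_mulrn E (ltW u0)) -powRrM divfK // gt_eqF.
rewrite powRN -/y; have yV0 : 0 < y^-1 by rewrite invr_gt0.
have main0 : 0 <= K ^+ 2 * #|A|%:R ^+ 2 / p%:R.
  by rewrite !mulr_ge0 ?exprn_ge0 ?invr_ge0 ?ler0n.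
(* For u < l, that is for bounded p, y is at most 2 and the trivial bound |A| suffices; otherwise
   all largeness conditions on N and q hold. *)
have [u_small|u_big] := ltP u l%:R.
  have y2 : y <= 2.
    rewrite leNgt; apply/negP => y2.
    have : 2 ^+ l <= u.
      rewrite /u yP; apply: (@le_trans _ _ (y `^ l%:R)); last by rewrite ler_powR.
      by rewrite (powR_mulrn l (ltW y0)) lerXn2r ?nnegrE ?(ltW y0) // ltW.
    rewrite leNgt => /negP; apply; apply: (lt_le_trans u_small).
    by rewrite -natrX ler_nat ltnW // ltn_expl.
  have h : 1 <= 2 * y^-1 by rewrite ler_pdivlMr ?mul1r.
  apply: (@le_trans _ _ (0 + 1 * #|A|%:R * 1)).
    by rewrite add0r mul1r mulr1 ler_nat card_inv_diff_pairs.
  apply: lerD => //; have -> : 2 * K * #|A|%:R * y^-1 = K * #|A|%:R * (2 * y^-1) by ring.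
  by apply: ler_pM; rewrite ?mul1r ?ler0n ?ler01 // ler_peMl.
have u33 : 33 <= u by apply: le_trans u_big; rewrite ler_nat leq_addr.
have u1 : 1 <= u by apply: le_trans u33; rewrite ler1n.
pose N := Num.truncn u; have /andP[Nu uN] := truncn_itv (ltW u0); rewrite -/N in Nu uN.
have N32 : (32 <= N)%N by rewrite -ltnS -(ltr_nat R); apply: le_lt_trans uN; apply: le_trans u33; rewrite ler_nat.
have N0 : (0 < N)%N by apply: leq_trans N32.
have uE0 : 0 < u ^+ E by rewrite exprn_gt0.
pose q := (Num.truncn (u ^+ E)).+1.
have /andP[Eq qE] := truncn_itv (ltW uE0); rewrite -/q in qE.
have uuE : u <= u ^+ E by rewrite -[leLHS]expr1 ler_eXn2l // (lt_le_trans _ u33) // ltr1n.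
have qQ0 : (Q0 <= q)%N.
  rewrite -(ler_nat R); apply: le_trans (ltW qE); apply: le_trans uuE; apply: le_trans u_big.
  by rewrite ler_nat leq_addl.
have q_le : q%:R <= u ^+ (E * 2).
  rewrite /q -natr1; apply: (@le_trans _ _ (u ^+ E * 2)).
    by move: Eq (le_trans u1 uuE); clear; lra.
  by rewrite exprM expr2 ler_pM2l // (le_trans _ uuE) // (le_trans _ u33) // ler_nat.
have [q14 [Lam [s [W [HLam Hs HW Hn]]]]] := Hc q qQ0.
have qB : (q ^ c <= #|B|)%N.
  rewrite -(ler_nat R) natrX; apply: le_trans HB.
  apply: (@le_trans _ _ ((u ^+ (E * 2)) ^+ c)); first by rewrite lerXn2r ?nnegrE ?exprn_ge0 ?(ltW u0).
  rewrite exprM -uE -!powR_mulrn ?powR_ge0 // -!powRrM.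
  by rewrite /de divfK // gt_eqF // mulr_gt0.
have qp : (q ^ c <= #|'F_p|)%N by apply: leq_trans qB (max_card _).
have lev : (level_seq N m <= q)%N.
  apply: leq_trans (level_seq_le m N32) _; rewrite -(ler_nat R) natrX.
  by apply: le_trans (ltW qE); rewrite lerXn2r ?nnegrE ?(ltW u0).
have qm : (#|'F_p| ^ 4 < q ^ m)%N.
  rewrite card_Fp // -(ltr_nat R) !natrX; apply: (@lt_le_trans _ _ ((u ^+ E) ^+ m)); last first.
    by rewrite lerXn2r ?nnegrE ?(ltW uE0) // ltW.
  rewrite -uE -!powR_mulrn ?powR_ge0 ?(ltW p0) // -powRrM /powR gt_eqF // ltr_expR.
  by rewrite ltr_pM2r // ln_gt0.
have gap := sl2_gap (incidence_bound_Fp pp Hr) r0 la0 N0 q14 lev qm HLam Hs HW (Hn _ qB).1 (Hn _ qp).2.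
have x0 : 0 < 2 * y^-1 by rewrite mulr_gt0.
(* N is u rounded down, so u <= 2N, and y^2 <= u by the choice of k. *)
have Nx : N%:R^-1 <= (2 * y^-1) ^+ 2.
  have y2u : y ^+ 2 <= u.
    rewrite /u yP -(powR_mulrn 2 (ltW y0)); apply: ler_powR => //; apply: le_trans Hk.
    by rewrite ler_nat.
  have N2 : u <= 2 * N%:R by move: uN u33; rewrite -natr1; clear; lra.
  have N0' : 0 < N%:R :> R by rewrite ltr0n.
  rewrite exprMn exprVn -[leLHS]mul1r ler_pdivrMr // mulrAC ler_pdivlMr ?exprn_gt0 // mul1r.
  by apply: (le_trans y2u); move: N2 N0'; clear; lra.
have I0 : (0 < #|{: {x | x \in B} * {x | x \in B}}|)%N.
  have B0 : (0 < #|B|)%N by apply: leq_trans qB; rewrite expn_gt0.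
  by rewrite card_prod card_sig muln_gt0 (eq_card (B := B)) ?B0.
have gap' f : balanced f -> ip (avg (@vact 'F_p) (@move_of _ B la) f) (avg (@vact 'F_p) (@move_of _ B la) f)
    <= (2 * y^-1) ^+ 2 * ip f f.
  by move=> bf; apply: le_trans (gap R f bf) _; rewrite ler_wpM2r ?ip_ge0.
have cnt (b : {x | x \in B} * {x | x \in B}) :
    (#|inv_diff_pairs A la| <= cone_count (sumset A B) (move_of la b))%N.
  by case: b => [[b1 b1B] [b2 b2B]]; apply: inv_diff_pairs_le.
apply: le_trans (cone_count_bound I0 x0 gap' cnt) _.
rewrite card_Fp //; apply: lerD.
  rewrite -exprMn ler_pM ?exprn_ge0 ?invr_ge0 ?addr_ge0 //.
    by rewrite lerXn2r ?nnegrE ?mulr_ge0.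
  by rewrite lef_pV2 ?posrE ?addr_gt0 // lerDl.
have -> : 2 * K * #|A|%:R * y^-1 = 2 * y^-1 * (K * #|A|%:R) by ring.
by rewrite ler_pM2l.
Qed.

Unset Implicit Arguments.
Set Strict Implicit.

Theorem theorem7 (R : realType) :
  exists C : R, 0 < C /\
  forall eps : R, 0 < eps ->
  exists k : nat,
  forall (p : nat) (A B : {set 'F_p}) (K : R),
    prime p -> odd p ->
    p%:R `^ eps <= #|B|%:R ->
    1 <= K ->
    #|sumset A B|%:R <= K * #|A|%:R ->
    (forall lambda : 'F_p, lambda != 0 ->
       #|inv_diff_pairs A lambda|%:R
         <= K ^+ 2 * #|A|%:R ^+ 2 / p%:R
            + 2 * K * #|A|%:R * p%:R `^ (- (1 / 2 ^+ (k + 2)%N)))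
    /\
    (T2plus (invset A) (invset B))%:R
        - K ^+ 2 * #|A|%:R ^+ 2 * #|B|%:R ^+ 2 / p%:R
      <= C * (K `^ (5 / 4) * #|A|%:R `^ (5 / 4) * #|B|%:R `^ (3 / 2)
              + K ^+ 2 * #|A|%:R ^+ 2).
Proof.
have [r Hr] : exists r, (864 * 32 <= r)%N by exists (864 * 32)%N.
exists (2 * r%:R + 2); split; first by rewrite ltr_wpDl // mulr_ge0.
move=> eps eps0; have [k Hk] := inv_diff_pairs_bound Hr eps0.
exists k => p A B K pp _ HB K1 HK; split; first exact: Hk HB K1 HK.
apply: T2plus_invset_bound => //; apply: contraTneq HB => ->.
by rewrite cards0 -ltNge powR_gt0 // ltr0n prime_gt0.
Qed.
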